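(* Let $X\in\mathcal{X}_2$ be a non-dicritical generalized curve with an isolated singularity at $0\in\mathbb{C}^2$, and suppose that $X$ is of non-rational type, i.e. the strict transform of the foliation $\mathcal{F}_X$ in the reduction of singularities of $X$ has at least one non-rational singularity. If the linear part $DX(0)$ is nilpotent, then $C(X)=\mathbb{C}\cdot X$.
   Context: $\mathcal{X}_2$ is the set of germs at $0\in\mathbb{C}^2$ of holomorphic vector fields and $C(X)=\{Y\in\mathcal{X}_2\mid [X,Y]=0\}$. ''Isolated singularity at $0$'' means that $X(0)=0$ and $0$ is an isolated zero of $X$. ''Nilpotent'' includes the case $DX(0)=0$. A separatrix of $X$ is a germ of irreducible analytic curve through $0$, regular outside $0$ and invariant by $X$ (tangent to $X$); $X$ is non-dicritical if it has finitely many separatrices, and dicritical otherwise. $\mathcal{F}_X$ denotes the germ of foliation defined by $X$. By Seidenberg's theorem there is a (minimal) finite composition of point blow-ups $\Pi:(M,D)\to(\mathbb{C}^2,0)$, $D=\Pi^{-1}(0)$ (the reduction, or resolution, of singularities of $X$), such that the strict transform $\widetilde{\mathcal{F}}_X$ of $\mathcal{F}_X$ (the pulled-back foliation with isolated singularities) has only reduced singularities on $D$; a singularity $p\in D$ is reduced if the foliation is represented near $p$ by a vector field $Y$ with isolated zero at $p$ whose linear part has eigenvalues $\lambda_1,\lambda_2$ such that either exactly one of them is zero (a saddle-node), or $\lambda_1\lambda_2\neq 0$ and $\lambda_2/\lambda_1\notin\mathbb{Q}_+$. $X$ is a generalized curve if there is no saddle-node in its resolution of singularities. A singularity $p\in D$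 of $\widetilde{\mathcal{F}}_X$ is non-rational if the eigenvalues $\lambda_1,\lambda_2$ of the linear part at $p$ of such a vector field $Y$ are both non-zero and $\lambda_2/\lambda_1\notin\mathbb{Q}$. *)

(* Defs.v *)
(* MathComp / MathComp-Analysis.  The field of complex numbers is [R[i]] for
   [R : realType]; points of C^2 are row vectors over [R[i]^o], which carries
   the library's normed-module structure. *)
From HB Require Import structures.
From mathcomp Require Import all_boot all_order all_algebra.
From mathcomp Require Import complex.
From mathcomp Require Import all_classical all_reals all_analysis.
Import Order.TTheory GRing.Theory Num.Theory.
Import numFieldNormedType.Exports.

Set Implicit Arguments.
Unset Strict Implicit.
Unset Printing Implicit Defensive.

Local Open Scope classical_set_scope.
Local Open Scope ring_scope.
Local Open Scope complex_scope.

Notation Cplx R := (R[i]^o) (only parsing).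
Notation plane R := 'rV[R[i]^o]_2 (only parsing).
Notation vfield R := ('rV[R[i]^o]_2 -> 'rV[R[i]^o]_2) (only parsing).

Definition vec2 (R : realType) (x y : Cplx R) : plane R :=
  \row_(j < 2) (if j == 0 then x else y).

(* Germs at 0 are represented by globally defined functions of which only the
   values near 0 matter: every predicate below depends only on the germ. *)

Definition partial_sum (R : realType) (a : nat -> nat -> Cplx R) (p : plane R)
    (N : nat) : Cplx R :=
  \sum_(i < N) \sum_(j < N) a i j * p 0 0 ^+ i * p 0 1 ^+ j.

(* f is, near 0, the sum of a convergent power series in two variables
   (convergence: the coefficients satisfy a Cauchy estimate for some r > 0). *)
Definition holomorphic (R : realType) (f : plane R -> Cplx R) : Prop :=
  exists (a : nat -> nat -> Cplx R) (r M : Cplx R),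
    [/\ 0 < r,
        forall i j, `|a i j| * r ^+ (i + j) <= M &
        \forall p \near (0 : plane R),
          partial_sum a p @ \oo --> f p].

Definition holomorphic_vf (R : realType) (X : vfield R) : Prop :=
  forall k : 'I_2, holomorphic (fun p => X p 0 k).

Definition lie_bracket (R : realType) (X Y : vfield R) : vfield R :=
  fun p => 'd Y p (X p) - 'd X p (Y p).

Definition centralizer (R : realType) (X : vfield R) : set (vfield R) :=
  [set Y | holomorphic_vf Y /\
           \forall p \near (0 : plane R), lie_bracket X Y p = 0].

Definition complex_line (R : realType) (X : vfield R) : set (vfield R) :=
  [set Y | exists c : Cplx R, \forall p \near (0 : plane R), Y p = c *: X p].

Definition isolated_singularity (R : realType) (X : vfield R) : Prop :=
  X 0 = 0 /\ \forall p \near (0 : plane R)^', X p != 0.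

(* [jacobian] is the matrix of the differential acting on row vectors, i.e.
   the transpose of the usual one; nilpotency and the characteristic
   polynomial do not see the difference. *)
Definition linear_part (R : realType) (X : vfield R) : 'M[Cplx R]_2 :=
  jacobian X 0.

Definition nilpotent_mx (R : realType) (A : 'M[Cplx R]_2) : Prop :=
  exists n : nat, A ^+ n = 0.

(* l1 and l2 are the eigenvalues of A, listed with multiplicity. *)
Definition eigenvalues (R : realType) (A : 'M[Cplx R]_2) (l1 l2 : Cplx R) :
    Prop :=
  char_poly A = ('X - l1%:P) * ('X - l2%:P).

Definition saddle_node_mx (R : realType) (A : 'M[Cplx R]_2) : Prop :=
  exists l1 l2, eigenvalues A l1 l2 /\ (l1 == 0) (+) (l2 == 0).

Definition reduced_mx (R : realType) (A : 'M[Cplx R]_2) : Prop :=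
  saddle_node_mx A \/
  exists l1 l2, [/\ eigenvalues A l1 l2, l1 * l2 != 0 &
                    forall q : rat, 0 < q -> l2 / l1 != ratr q].

Definition non_rational_mx (R : realType) (A : 'M[Cplx R]_2) : Prop :=
  exists l1 l2, [/\ eigenvalues A l1 l2, l1 != 0, l2 != 0 &
                    forall q : rat, l2 / l1 != ratr q].

(* Irreducible element of the ring of holomorphic germs (the zero germ is
   excluded by 0 = 0 * 0).  Such an f represents the irreducible curve germ
   {f = 0}. *)
Definition irreducible_germ (R : realType) (f : plane R -> Cplx R) : Prop :=
  [/\ holomorphic f, f 0 = 0 &
      forall g h : plane R -> Cplx R, holomorphic g -> holomorphic h ->
        (\forall p \near (0 : plane R), f p = g p * h p) ->
        g 0 != 0 \/ h 0 != 0].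

(* The curve {f = 0} is a separatrix of X: it is an irreducible curve germ,
   regular outside 0, and X is tangent to it. *)
Definition separatrix (R : realType) (X : vfield R) (f : plane R -> Cplx R) :
    Prop :=
  [/\ irreducible_germ f,
      \forall p \near (0 : plane R)^',
        f p = 0 -> exists v : plane R, 'd f p v != 0 &
      \forall p \near (0 : plane R), f p = 0 -> 'd f p (X p) = 0].

Definition same_curve (R : realType) (f g : plane R -> Cplx R) : Prop :=
  \forall p \near (0 : plane R), f p = 0 <-> g p = 0.

Definition non_dicritical (R : realType) (X : vfield R) : Prop :=
  exists (n : nat) (F : 'I_n -> plane R -> Cplx R),
    forall f, separatrix X f -> exists i, same_curve f (F i).

(* Infinitely near points.  The exceptional divisor of the blow-up of a point
   with coordinates (x, y) is the projective line of directions: [Some c] is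
   the direction y = c x and [None] is the direction x = 0.  [blowup_chart d]
   is the blow-down map in a chart centered at d.  A word [:: d1; ...; dk]
   stands for the point reached by choosing the direction d1 over the origin,
   then d2 over d1 (in the chart centered at d1), and so on; the empty word is
   the origin.  [blow_down w] is the composed blow-down map in the chart
   centered at the point w. *)
Definition blowup_chart (R : realType) (d : option (Cplx R)) :
    plane R -> plane R :=
  fun p => match d with
           | Some c => vec2 (p 0 0) (p 0 0 * (p 0 1 + c))
           | None => vec2 (p 0 0 * p 0 1) (p 0 1)
           end.

Definition blow_down (R : realType) (w : seq (option (Cplx R))) :
    plane R -> plane R :=
  foldr (fun d F => blowup_chart d \o F) id w.

(* A finite composition of point blow-ups Pi : (M, D) -> (C^2, 0) is given by
   the finite set S of its centers; the points of D = Pi^{-1}(0) are then the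
   infinitely near points which are not centers but lie over centers only.
   S = set0 is the identity of (C^2, 0), with D = {0}. *)
Definition blowup_composition (R : realType)
    (S : set (seq (option (Cplx R)))) : Prop :=
  finite_set S /\ forall w d, S (rcons w d) -> S w.

Definition divisor (R : realType) (S : set (seq (option (Cplx R)))) :
    set (seq (option (Cplx R))) :=
  [set w | ~ S w /\ forall u d, w = rcons u d -> S u].

Definition wedge (R : realType) (u v : plane R) : Cplx R :=
  u 0 0 * v 0 1 - u 0 1 * v 0 0.

(* Y represents, in the chart centered at w, the strict transform of the
   foliation of X: Y is non-zero outside w, and its image by the differential
   of the blow-down is parallel to X, so that Y spans the pulled-back
   foliation off D. *)
Definition strict_transform (R : realType) (X : vfield R)
    (w : seq (option (Cplx R))) (Y : vfield R) : Prop :=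
  [/\ holomorphic_vf Y,
      \forall p \near (0 : plane R)^', Y p != 0 &
      \forall p \near (0 : plane R),
        wedge ('d (blow_down w) p (Y p)) (X (blow_down w p)) = 0].

Definition regular_point (R : realType) (X : vfield R)
    (w : seq (option (Cplx R))) : Prop :=
  exists Y, strict_transform X w Y /\ Y 0 != 0.

Definition singularity_with (R : realType) (P : 'M[Cplx R]_2 -> Prop)
    (X : vfield R) (w : seq (option (Cplx R))) : Prop :=
  exists Y, [/\ strict_transform X w Y, Y 0 = 0 & P (linear_part Y)].

Definition resolves (R : realType) (X : vfield R)
    (S : set (seq (option (Cplx R)))) : Prop :=
  blowup_composition S /\
  forall w, divisor S w ->
    regular_point X w \/ singularity_with (@reduced_mx R) X w.

(* The reduction of singularities: the minimal resolving composition (T `<=` S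
   means that the composition S factors through the composition T). *)
Definition reduction_of_singularities (R : realType) (X : vfield R)
    (S : set (seq (option (Cplx R)))) : Prop :=
  resolves X S /\ forall T, resolves X T -> T `<=` S -> T = S.

Definition generalized_curve (R : realType) (X : vfield R) : Prop :=
  exists S, reduction_of_singularities X S /\
    forall w, divisor S w -> ~ singularity_with (@saddle_node_mx R) X w.

Definition non_rational_type (R : realType) (X : vfield R) : Prop :=
  exists S, reduction_of_singularities X S /\
    exists w, divisor S w /\ singularity_with (@non_rational_mx R) X w.

(* Main.v *)
(* Let Y commute with X.

   Suppose first that Y(0) = 0 and that DY(0) is not nilpotent.  As DX(0) is
   nilpotent and commutes with DY(0), it kills an eigenvector e of DY(0) for an
   eigenvalue q of largest modulus.  The vector field Y has an invariant analytic
   curve tangent to e, parametrized by q s gamma' = Y(gamma).  Along it X solves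
   the linear equation q s U' = DY(gamma) U and vanishes to order 2 at s = 0, so
   X = 0 on the curve and 0 is not an isolated zero of X.

   In the remaining cases one works with Taylor series.  Put f = X /\ Y; then
   X(f) = div(X) f.  If f = 0, the quotient of Y by X is a meromorphic first
   integral of X, hence of a vector field W defining the strict transform at the
   non-rational singularity; comparison of leading monomials, which are
   eigenvectors of the linear part of W with distinct eigenvalues, shows that it
   is constant.  If f <> 0, then f is lifted along the blow-ups together with a
   meromorphic vector field V / Q such that Q f = X /\ V.  At the singularity,
   P = W /\ V satisfies W(P) Q - W(Q) P = div(W) P Q, so that the leading
   monomial of P is xy times that of Q.  But V starts out regular or nilpotent,
   and through the blow-ups it can only become regular or a saddle of rational
   type, which is incompatible with this relation. *)

Require Import Defs.
From HB Require Import structures.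
From mathcomp Require Import all_boot all_order all_algebra.
From mathcomp Require Import ring lra zify.
From mathcomp Require Import complex.
From mathcomp Require Import all_classical all_reals all_analysis.
Import Order.TTheory GRing.Theory Num.Theory.
Import numFieldNormedType.Exports.

Set Implicit Arguments.
Unset Strict Implicit.
Unset Printing Implicit Defensive.

Local Open Scope ring_scope.

(** * Formal power series *)

(** The separate treatment of a non-nilpotent DY(0) with Y(0) = 0 is forced by the last step: for W
    = l x d/dx + m y d/dy and V = a x d/dx + d y d/dy, the series W /\ V starts with xy, which
    agrees with Q = 1. That case is excluded beforehand, and with convergence, because the
    hypothesis it contradicts is about actual points. Everything else is an identity between Taylor
    series. The function f is an inverse integrating factor of X. Fields are lifted by the adjugate
    of the differential of the chart, that is, its determinant times its inverse: X(f), div X and X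
    /\ V are then all multiplied by one factor, the equation of the exceptional divisor, and the
    equation for f survives every blow-up. Eigenvalues are followed through trace and determinant,
    which are polynomial in the coefficients and independent of coordinates. For the curve, q of
    largest modulus makes q n - DY(0) invertible for every n > 1, so that no resonance obstructs the
    recursion. *)

Record pser (K : Type) := PSer { pcoef :> nat -> K }.

Lemma pserP K (f g : pser K) : (forall n, f n = g n) -> f = g.
Proof. by case: f g => f [g] /= fg; congr PSer; apply/funext. Qed.

HB.instance Definition _ (K : Type) := gen_eqMixin (pser K).
HB.instance Definition _ (K : Type) := gen_choiceMixin (pser K).

(** The record keeps these operations apart from the pointwise ones on functions; the locks keep
    conversion from unfolding coefficients of nested series. *)
HB.lock Definition pser_add (K : zmodType) (f g : pser K) : pser K :=
  PSer (fun n => f n + g n).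
HB.lock Definition pser_opp (K : zmodType) (f : pser K) : pser K :=
  PSer (fun n => - f n).
HB.lock Definition pser_zero (K : zmodType) : pser K := PSer (fun=> 0).
HB.lock Definition pser_mul (K : comNzRingType) (f g : pser K) : pser K :=
  PSer (fun n => \sum_(i < n.+1) f i * g (n - i)%N).
HB.lock Definition pser_const (K : comNzRingType) (a : K) : pser K :=
  PSer (fun n => if n is 0%N then a else 0).
HB.lock Definition pderiv (K : comNzRingType) (f : pser K) : pser K :=
  PSer (fun n => f n.+1 *+ n.+1).

Section PserZmod.
Variable K : zmodType.
Notation pser_add := (@pser_add K).
Notation pser_opp := (@pser_opp K).
Notation pser_zero := (@pser_zero K).
Fact pser_addA : associative pser_add.
Proof. by move=> f g h; apply: pserP => n /=; rewrite pser_add.unlock /= addrA. Qed.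
Fact pser_addC : commutative pser_add.
Proof. by move=> f g; apply: pserP => n /=; rewrite pser_add.unlock /= addrC. Qed.
Fact pser_add0 : left_id pser_zero pser_add.
Proof. by move=> f; apply: pserP => n /=; rewrite pser_add.unlock pser_zero.unlock /= add0r. Qed.
Fact pser_addN : left_inverse pser_zero pser_opp pser_add.
Proof. by move=> f; apply: pserP => n /=; rewrite pser_add.unlock pser_opp.unlock pser_zero.unlock /= addNr. Qed.
HB.instance Definition _ :=
  GRing.isZmodule.Build (pser K) pser_addA pser_addC pser_add0 pser_addN.

Lemma pcoefD (f g : pser K) n : (f + g) n = f n + g n.
Proof. by rewrite -[f + g]/(pser_add f g) pser_add.unlock. Qed.
Lemma pcoefN (f : pser K) n : (- f) n = - f n.
Proof. by rewrite -[- f]/(pser_opp f) pser_opp.unlock. Qed.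
Lemma pcoefB (f g : pser K) n : (f - g) n = f n - g n.
Proof. by rewrite pcoefD pcoefN. Qed.
Lemma pcoef0 n : (0 : pser K) n = 0.
Proof. by rewrite -[0]/pser_zero pser_zero.unlock. Qed.
Lemma pcoef_sum I (r : seq I) (P : pred I) (F : I -> pser K) n :
  (\sum_(i <- r | P i) F i) n = \sum_(i <- r | P i) F i n.
Proof. by elim/big_rec2: _ => [|i x y _ <-]; rewrite ?pcoef0 ?pcoefD. Qed.
Lemma pcoefMn (f : pser K) k n : (f *+ k) n = f n *+ k.
Proof. by elim: k => [|k IH]; rewrite ?pcoef0 // !mulrS pcoefD IH. Qed.
End PserZmod.

Section PserRing.
Variable K : comNzRingType.
Implicit Types f g h : pser K.

Definition pser_trunc m f : {poly K} := \poly_(i < m.+1) f i.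

Lemma coef_trunc m f i : (i <= m)%N -> (pser_trunc m f)`_i = f i.
Proof. by move=> im; rewrite coef_poly ltnS im. Qed.

Notation pser_mul := (@pser_mul K).
Notation pser_const := (@pser_const K).
Notation pderiv := (@pderiv K).

(** Coefficient n of a product involves only coefficients up to n, so the ring laws and the Leibniz
    rule are inherited from polynomials. *)
Lemma pser_mul_trunc m f g n : (n <= m)%N ->
  pser_mul f g n = (pser_trunc m f * pser_trunc m g)`_n.
Proof.
move=> nm; rewrite pser_mul.unlock coefM; apply: eq_bigr => i _ /=.
by rewrite !coef_trunc //; [rewrite (leq_trans (leq_subr _ _))|rewrite (leq_trans _ nm) // -ltnS].
Qed.

Lemma coefM_eq (p q p' q' : {poly K}) n :
  (forall i, (i <= n)%N -> p`_i = p'`_i) ->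
  (forall i, (i <= n)%N -> q`_i = q'`_i) -> (p * q)`_n = (p' * q')`_n.
Proof.
move=> pp qq; rewrite !coefM; apply: eq_bigr => i _.
by rewrite pp ?qq // ?leq_subr // -ltnS.
Qed.

Lemma trunc_mul m f g n : (n <= m)%N ->
  (pser_trunc m (pser_mul f g))`_n = (pser_trunc m f * pser_trunc m g)`_n.
Proof. by move=> nm; rewrite coef_trunc // (pser_mul_trunc _ _ nm). Qed.

Fact pser_mulA : associative pser_mul.
Proof.
move=> f g h; apply: pserP => n; rewrite !(@pser_mul_trunc n) //.
rewrite (@coefM_eq _ _ (pser_trunc n f) (pser_trunc n g * pser_trunc n h)) //;
  last by move=> i; exact: trunc_mul.
rewrite (@coefM_eq (pser_trunc n (pser_mul f g)) _
  (pser_trunc n f * pser_trunc n g) (pser_trunc n h)) //;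
  last by move=> i; exact: trunc_mul.
by rewrite mulrA.
Qed.
Fact pser_mulC : commutative pser_mul.
Proof. by move=> f g; apply: pserP => n; rewrite !(@pser_mul_trunc n) // mulrC. Qed.

Lemma pser_const_mul a f n : pser_mul (pser_const a) f n = a * f n.
Proof.
rewrite pser_mul.unlock pser_const.unlock /= big_ord_recl /= subn0 big1 ?addr0 // => i _.
by rewrite mul0r.
Qed.
Fact pser_mul1 : left_id (pser_const 1) pser_mul.
Proof. by move=> f; apply: pserP => n; rewrite pser_const_mul mul1r. Qed.
Fact pser_mulD : left_distributive pser_mul (@pser_add K).
Proof.
move=> f g h; apply: pserP => n.
rewrite pser_mul.unlock pser_add.unlock /= -big_split /=.
by apply: eq_bigr => i _; rewrite mulrDl.
Qed.
Fact pser_1neq0 : pser_const 1 != 0.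
Proof.
apply/eqP => /(congr1 (fun f : pser K => f 0%N)) /eqP.
by rewrite pcoef0 pser_const.unlock /= oner_eq0.
Qed.
HB.instance Definition _ := GRing.Zmodule_isComNzRing.Build (pser K)
  pser_mulA pser_mulC pser_mul1 pser_mulD pser_1neq0.

Lemma pcoefM f g n : (f * g) n = \sum_(i < n.+1) f i * g (n - i)%N.
Proof. by rewrite -[f * g]/(pser_mul f g) pser_mul.unlock. Qed.
Lemma pcoef_const (a : K) n : pser_const a n = if n is 0%N then a else 0.
Proof. by rewrite pser_const.unlock. Qed.
Lemma pcoefM0 f g : (f * g) 0%N = f 0%N * g 0%N.
Proof. by rewrite pcoefM big_ord1. Qed.

Fact pser_const_is_additive : zmod_morphism pser_const.
Proof.
by move=> a b; apply: pserP => -[|n]; rewrite pcoefB !pcoef_const ?subr0.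
Qed.
Fact pser_const_is_mul : monoid_morphism pser_const.
Proof.
split=> // a b; apply: pserP => n.
by rewrite [RHS]pser_const_mul !pcoef_const; case: n => [|n]; rewrite ?mulr0.
Qed.
HB.instance Definition _ :=
  GRing.isZmodMorphism.Build K (pser K) pser_const pser_const_is_additive.
HB.instance Definition _ :=
  GRing.isMonoidMorphism.Build K (pser K) pser_const pser_const_is_mul.

Lemma pcoef_constM a f n : (pser_const a * f) n = a * f n.
Proof. exact: pser_const_mul. Qed.

Definition pvar : pser K := PSer (fun n => (n == 1%N)%:R).
Lemma pcoef_varM f n : (pvar * f) n = if n is m.+1 then f m else 0.
Proof.
case: n => [|n]; first by rewrite pcoefM0 mul0r.
rewrite pcoefM big_ord_recl /= mul0r add0r big_ord_recl /= mul1r big1 ?addr0 //.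
by rewrite subn1.
by move=> i _; rewrite mul0r.
Qed.

Lemma pcoef_deriv f n : pderiv f n = f n.+1 *+ n.+1.
Proof. by rewrite pderiv.unlock. Qed.
Fact pderiv_is_additive : zmod_morphism pderiv.
Proof. by move=> f g; apply: pserP => n; rewrite [RHS]pcoefB !pcoef_deriv pcoefB mulrnBl. Qed.
HB.instance Definition _ :=
  GRing.isZmodMorphism.Build (pser K) (pser K) pderiv pderiv_is_additive.

Lemma pderivM f g : pderiv (f * g) = pderiv f * g + f * pderiv g.
Proof.
apply: pserP => n; rewrite pcoefD.
rewrite pcoef_deriv -[(f * g) n.+1]/(pser_mul f g n.+1) (@pser_mul_trunc n.+1) //.
rewrite -coef_deriv derivM coefD; congr (_ + _).
  rewrite -[RHS]/(pser_mul (pderiv f) g n) (@pser_mul_trunc n) //.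
  apply: coefM_eq => i ni.
    by rewrite coef_deriv !coef_trunc ?pcoef_deriv // ltnS.
  by rewrite !coef_trunc // (leq_trans ni).
rewrite -[RHS]/(pser_mul f (pderiv g) n) (@pser_mul_trunc n) //.
apply: coefM_eq => i ni.
  by rewrite !coef_trunc // (leq_trans ni).
by rewrite coef_deriv !coef_trunc ?pcoef_deriv // ltnS.
Qed.

(** The product of the lowest terms cannot vanish. The domain property is an implication and not a
    structure, so that the lemma can be applied twice, to series with series as coefficients. *)
Lemma pser_mul_eq0 :
  (forall a b : K, a * b = 0 -> a = 0 \/ b = 0) ->
  forall f g, f * g = 0 -> f = 0 \/ g = 0.
Proof.
move=> dom f g fg0.
have [->|/eqP f0] := eqVneq f 0; first by left.
have [->|/eqP g0] := eqVneq g 0; first by right.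
have low h : h <> 0 -> exists n, h n != 0 /\ forall i, (i < n)%N -> h i = 0.
  move=> h0; have exn : exists n, h n != 0.
    apply/not_existsP => hn; apply: h0; apply: pserP => n; apply/eqP; rewrite pcoef0.
    by apply/negPn/negP; exact: hn.
  exists (ex_minn exn); case: ex_minnP => n hn hmin; split=> // i iltn.
  by apply/eqP/negPn/negP => /hmin; rewrite leqNgt iltn.
have [n [fn fl]] := low _ f0; have [m [gm gl]] := low _ g0.
have : (f * g) (n + m)%N = 0 by rewrite fg0 pcoef0.
have nlt : (n < (n + m).+1)%N by rewrite ltnS leq_addr.
rewrite pcoefM (bigD1 (Ordinal nlt)) //= big1 ?addr0; last first.
  move=> i /eqP ni; have [ilt|ige] := ltnP i n; first by rewrite fl // mul0r.
  rewrite gl ?mulr0 //.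
  have : (n < i)%N by rewrite ltn_neqAle ige andbT; apply/eqP => E; apply: ni; apply: val_inj.
  by have := ltn_ord i; lia.
by rewrite addKn => /dom[] /eqP; rewrite ?(negPf fn) ?(negPf gm).
Qed.

End PserRing.

(** * Series in two variables *)

(* [f i j] is the coefficient of x^i y^j. *)
Notation pser2 K := (pser (pser K)).

HB.lock Definition cser (K : comNzRingType) (a : K) : pser2 K :=
  pser_const (pser_const a).
HB.lock Definition xx (K : comNzRingType) : pser2 K := pvar (pser K).
HB.lock Definition yy (K : comNzRingType) : pser2 K := pser_const (pvar K).
HB.lock Definition ev0 (K : comNzRingType) (f : pser2 K) : K := f 0%N 0%N.
HB.lock Definition dx (K : comNzRingType) (f : pser2 K) : pser2 K := pderiv f.
HB.lock Definition dy (K : comNzRingType) (f : pser2 K) : pser2 K :=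
  PSer (fun i => pderiv (f i)).
HB.lock Definition psubst_trunc (K : comNzRingType) (N : nat) (u v f : pser2 K)
    : pser2 K :=
  \sum_(i < N) \sum_(j < N) cser (f i j) * u ^+ i * v ^+ j.
(** Coefficient (n, m) is read off a truncation of order n + m + 1. This is the substitution only
    when u and v have no constant term: a monomial of degree d in them then has order at least d. *)
HB.lock Definition psubst (K : comNzRingType) (u v f : pser2 K) : pser2 K :=
  PSer (fun n => PSer (fun m => psubst_trunc (n + m).+1 u v f n m)).

Section Pser2.
Variable K : comNzRingType.
Implicit Types (f g h u v : pser2 K) (i j k l n m N : nat) (a b : K).

Lemma pser2P f g : (forall i j, f i j = g i j) -> f = g.
Proof. by move=> fg; apply: pserP => i; apply: pserP => j; exact: fg. Qed.

Lemma coef2M f g n m :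
  (f * g) n m =
  \sum_(i < n.+1) \sum_(j < m.+1) f i j * g (n - i)%N (m - j)%N.
Proof. by rewrite pcoefM pcoef_sum; apply: eq_bigr => i _; rewrite pcoefM. Qed.

Lemma coef2_sum I (r : seq I) (P : pred I) (F : I -> pser2 K) n m :
  (\sum_(i <- r | P i) F i) n m = \sum_(i <- r | P i) F i n m.
Proof. by rewrite !pcoef_sum. Qed.

Notation cser := (@cser K).
Notation xx := (xx K).
Notation yy := (yy K).
Notation ev0 := (@ev0 K).
Notation dx := (@dx K).
Notation dy := (@dy K).

Fact cst_is_additive : zmod_morphism cser.
Proof. by move=> a b; rewrite cser.unlock !rmorphB. Qed.
Fact cst_is_mul : monoid_morphism cser.
Proof. by split=> [|a b]; rewrite cser.unlock ?rmorph1 ?rmorphM. Qed.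
HB.instance Definition _ :=
  GRing.isZmodMorphism.Build K (pser2 K) cser cst_is_additive.
HB.instance Definition _ :=
  GRing.isMonoidMorphism.Build K (pser2 K) cser cst_is_mul.

Lemma coef2_cst a i j :
  cser a i j = if (i == 0%N) && (j == 0%N) then a else 0.
Proof.
by rewrite cser.unlock pcoef_const; case: i => [|i]; rewrite ?pcoef_const ?pcoef0 //; case: j.
Qed.

Lemma coef2_cstM a f i j : (cser a * f) i j = a * f i j.
Proof. by rewrite cser.unlock !pcoef_constM. Qed.
Lemma coef2_xxM f i j : (xx * f) i j = if i is k.+1 then f k j else 0.
Proof. by rewrite xx.unlock pcoef_varM; case: i; rewrite ?pcoef0. Qed.
Lemma coef2_yyM f i j : (yy * f) i j = if j is k.+1 then f i k else 0.
Proof. by rewrite yy.unlock pcoef_constM pcoef_varM. Qed.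

Lemma coef2_mono i j n m :
  (xx ^+ i * yy ^+ j) n m = ((n == i) && (m == j))%:R.
Proof.
elim: i n => [|i IH] n.
  rewrite expr0 mul1r; elim: j m => [|j IH] m.
    by rewrite expr0 -[1](rmorph1 cser) coef2_cst; case: ifP.
  by rewrite exprS coef2_yyM; case: m => [|m]; rewrite ?andbF ?IH ?eqSS.
by rewrite exprS -mulrA coef2_xxM; case: n => [|n]; rewrite ?IH ?eqSS.
Qed.

Fact ev0_is_additive : zmod_morphism ev0.
Proof. by move=> f g; rewrite ev0.unlock !pcoefB. Qed.
Fact ev0_is_mul : monoid_morphism ev0.
Proof.
split=> [|f g]; rewrite ev0.unlock ?pcoefM0 //.
by rewrite -(rmorph1 cser) coef2_cst.
Qed.
HB.instance Definition _ :=
  GRing.isZmodMorphism.Build (pser2 K) K ev0 ev0_is_additive.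
HB.instance Definition _ :=
  GRing.isMonoidMorphism.Build (pser2 K) K ev0 ev0_is_mul.

Lemma ev0E f : ev0 f = f 0%N 0%N. Proof. by rewrite ev0.unlock. Qed.
Lemma ev0_cst a : ev0 (cser a) = a.
Proof. by rewrite ev0E coef2_cst. Qed.
Lemma ev0_xx : ev0 xx = 0.
Proof. by rewrite ev0E -[xx]mulr1 coef2_xxM. Qed.
Lemma ev0_yy : ev0 yy = 0.
Proof. by rewrite ev0E -[yy]mulr1 coef2_yyM. Qed.

Fact dx_is_additive : zmod_morphism dx.
Proof. by move=> f g; rewrite dx.unlock raddfB. Qed.
HB.instance Definition _ :=
  GRing.isZmodMorphism.Build (pser2 K) (pser2 K) dx dx_is_additive.
Fact dy_is_additive : zmod_morphism dy.
Proof.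
by move=> f g; apply: pserP => n; rewrite pcoefB dy.unlock /= pcoefB raddfB.
Qed.
HB.instance Definition _ :=
  GRing.isZmodMorphism.Build (pser2 K) (pser2 K) dy dy_is_additive.

Lemma coef2_dx f i j : (dx f) i j = f i.+1 j *+ i.+1.
Proof. by rewrite dx.unlock pcoef_deriv pcoefMn. Qed.
Lemma coef2_dy f i j : (dy f) i j = f i j.+1 *+ j.+1.
Proof. by rewrite dy.unlock pcoef_deriv. Qed.

Lemma dxM f g : dx (f * g) = dx f * g + f * dx g.
Proof. by rewrite dx.unlock pderivM. Qed.
Lemma dyM f g : dy (f * g) = dy f * g + f * dy g.
Proof.
apply: pserP => n; rewrite pcoefD dy.unlock /= !pcoefM raddf_sum.
by rewrite -big_split; apply: eq_bigr => i _; exact: pderivM.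
Qed.
Lemma dx_cst a : dx (cser a) = 0.
Proof. by apply: pser2P => i j; rewrite coef2_dx coef2_cst mul0rn !pcoef0. Qed.
Lemma dy_cst a : dy (cser a) = 0.
Proof.
by apply: pser2P => i j; rewrite coef2_dy coef2_cst andbF mul0rn !pcoef0.
Qed.
Lemma dxD f g : dx (f + g) = dx f + dx g. Proof. exact: raddfD. Qed.
Lemma dyD f g : dy (f + g) = dy f + dy g. Proof. exact: raddfD. Qed.
Lemma dxN f : dx (- f) = - dx f. Proof. exact: raddfN. Qed.
Lemma dyN f : dy (- f) = - dy f. Proof. exact: raddfN. Qed.
Lemma mono10 : xx = xx ^+ 1 * yy ^+ 0. Proof. by rewrite expr1 mulr1. Qed.
Lemma mono01 : yy = xx ^+ 0 * yy ^+ 1. Proof. by rewrite expr1 mul1r. Qed.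
Lemma mono00 : 1 = xx ^+ 0 * yy ^+ 0. Proof. by rewrite mul1r. Qed.
Lemma dx_xx : dx xx = 1.
Proof.
by apply: pser2P => i j; rewrite coef2_dx mono10 mono00 !coef2_mono eqSS; case: i => [|i]; rewrite ?mulr1n ?mul0rn.
Qed.
Lemma dx_yy : dx yy = 0.
Proof. by apply: pser2P => i j; rewrite coef2_dx mono01 coef2_mono mul0rn !pcoef0. Qed.
Lemma dy_xx : dy xx = 0.
Proof.
by apply: pser2P => i j; rewrite coef2_dy mono10 coef2_mono andbF mul0rn !pcoef0.
Qed.
Lemma dy_yy : dy yy = 1.
Proof.
apply: pser2P => i j; rewrite coef2_dy mono01 mono00 !coef2_mono.
by case: j => [|j]; rewrite ?andbF ?mul0rn ?eqSS.
Qed.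

(** Membership in the N-th power of the maximal ideal. Identities are proved modulo every power and
    concluded by [vge_eq]. *)
Definition vge N f := forall i j, (i + j < N)%N -> f i j = 0.

Lemma vge0 f : vge 0 f. Proof. by []. Qed.
Lemma vge_zero N : vge N 0. Proof. by move=> i j _; rewrite !pcoef0. Qed.
Lemma vgeW N M f : (N <= M)%N -> vge M f -> vge N f.
Proof. by move=> NM h i j ij; apply: h; apply: leq_trans NM. Qed.
Lemma vgeD N f g : vge N f -> vge N g -> vge N (f + g).
Proof. by move=> hf hg i j ij; rewrite !pcoefD hf // hg // addr0. Qed.
Lemma vgeN N f : vge N f -> vge N (- f).
Proof. by move=> hf i j ij; rewrite !pcoefN hf // oppr0. Qed.
Lemma vgeB N f g : vge N f -> vge N g -> vge N (f - g).
Proof. by move=> hf hg; apply: vgeD => //; exact: vgeN. Qed.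
Lemma vge_sum N I (r : seq I) (P : pred I) (F : I -> pser2 K) :
  (forall k : I, P k -> vge N (F k)) -> vge N (\sum_(i <- r | P i) F i).
Proof.
move=> h; apply: (big_ind (vge N)) => //; first exact: vge_zero.
by move=> f g; exact: vgeD.
Qed.
Lemma vgeM N M f g : vge N f -> vge M g -> vge (N + M) (f * g).
Proof.
move=> hf hg n m nm; rewrite coef2M big1 // => i _; rewrite big1 // => j _.
have := ltn_ord i; have := ltn_ord j => hi hj.
have [ij|ij] := ltnP (i + j) N; first by rewrite hf // mul0r.
by rewrite hg ?mulr0 //; lia.
Qed.
Lemma vgeMr N f g : vge N f -> vge N (f * g).
Proof. by move=> hf; rewrite -[N]addn0; apply: vgeM. Qed.
Lemma vgeMl N f g : vge N g -> vge N (f * g).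
Proof. by rewrite mulrC; exact: vgeMr. Qed.
Lemma vgeX n f : vge 1 f -> vge n (f ^+ n).
Proof. by move=> hf; elim: n => // n IH; rewrite exprS -add1n; apply: vgeM. Qed.
Lemma vge1P f : vge 1 f <-> ev0 f = 0.
Proof.
by rewrite ev0E; split=> [h|h i j]; [exact: h|rewrite ltnS leqn0 addn_eq0 => /andP[/eqP-> /eqP->]].
Qed.
Lemma vge_xx : vge 1 xx. Proof. by apply/vge1P; exact: ev0_xx. Qed.
Lemma vge_yy : vge 1 yy. Proof. by apply/vge1P; exact: ev0_yy. Qed.
Lemma vge_eq0 f : (forall N, vge N f) -> f = 0.
Proof. by move=> h; apply: pser2P => i j; rewrite !pcoef0; exact: (h (i + j).+1). Qed.
Lemma vge_eq f g : (forall N, vge N (f - g)) -> f = g.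
Proof. by move=> h; apply/subr0_eq/vge_eq0. Qed.
Lemma vge_trans N f g h : vge N (f - g) -> vge N (g - h) -> vge N (f - h).
Proof. by move=> h1 h2; rewrite -[f](subrK g) -addrA; exact: vgeD. Qed.
Lemma vge_sym N f g : vge N (f - g) -> vge N (g - f).
Proof. by move=> h; rewrite -opprB; exact: vgeN. Qed.
Lemma vgeMB N f g f' g' :
  vge N (f - f') -> vge N (g - g') -> vge N (f * g - f' * g').
Proof.
move=> h1 h2; have -> : f * g - f' * g' = (f - f') * g + f' * (g - g') by ring.
by apply: vgeD; [exact: vgeMr|exact: vgeMl].
Qed.
Lemma vge_dx N f : vge N.+1 f -> vge N (dx f).
Proof. by move=> h i j ij; rewrite coef2_dx h ?mul0rn // addSn ltnS. Qed.
Lemma vge_dy N f : vge N.+1 f -> vge N (dy f).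
Proof. by move=> h i j ij; rewrite coef2_dy h ?mul0rn // addnS ltnS. Qed.

Lemma sum2_delta (V : zmodType) N (T : nat -> nat -> V) i j :
  (i < N)%N -> (j < N)%N ->
  (forall k l, (k, l) != (i, j) -> T k l = 0) ->
  \sum_(k < N) \sum_(l < N) T k l = T i j.
Proof.
move=> iN jN T0; rewrite (bigD1 (Ordinal iN)) //= [X in _ + X]big1 ?addr0.
  rewrite (bigD1 (Ordinal jN)) //= big1 ?addr0 // => l lj.
  by apply: T0; apply: contra lj => /eqP[lj]; apply/eqP/val_inj.
move=> k ki; rewrite big1 // => l _.
by apply: T0; apply: contra ki => /eqP[kj _]; apply/eqP/val_inj.
Qed.

Lemma vge_ptrunc N f : vge N (f - psubst_trunc N xx yy f).
Proof.
move=> i j ij; rewrite !pcoefB psubst_trunc.unlock coef2_sum.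
under eq_bigr do rewrite coef2_sum.
rewrite (@sum2_delta _ N
  (fun k l => (cser (f k l) * xx ^+ k * yy ^+ l) i j) i j); try lia.
  by rewrite -mulrA coef2_cstM coef2_mono !eqxx mulr1 subrr.
move=> k l kl; rewrite -mulrA coef2_cstM coef2_mono.
by case: andP => [[/eqP ik /eqP jl]|_]; rewrite ?mulr0 //; rewrite ik jl eqxx in kl.
Qed.

(** Induction over polynomials; with [vge_ptrunc] it extends identities from polynomials to series
    by continuity. *)
Lemma psubst_trunc_ind (P : pser2 K -> Prop) :
  (forall a, P (cser a)) -> P xx -> P yy ->
  (forall f g, P f -> P g -> P (f + g)) ->
  (forall f g, P f -> P g -> P (f * g)) ->
  forall N f, P (psubst_trunc N xx yy f).
Proof.
move=> Pc Px Py PD PM N f.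
have P0 : P 0 by have := Pc 0; rewrite rmorph0.
have P1 : P 1 by have := Pc 1; rewrite rmorph1.
have PX g n : P g -> P (g ^+ n).
  by move=> Pg; elim: n => // n IH; rewrite exprS; exact: PM.
rewrite psubst_trunc.unlock.
apply: (big_ind P P0 PD) => i _; apply: (big_ind P P0 PD) => j _.
exact: (PM _ _ (PM _ _ (Pc _) (PX _ _ Px)) (PX _ _ Py)).
Qed.

(** * Substitution as a ring morphism *)

Section Subst.
Variables u v : pser2 K.
Hypotheses (u1 : vge 1 u) (v1 : vge 1 v).
Let sb := psubst u v.
Let sbt N := psubst_trunc N u v.

Lemma vge_mono i j : vge (i + j) (u ^+ i * v ^+ j).
Proof. by apply: vgeM; exact: vgeX. Qed.

(** The monomials added outside the square of side N have degree at least N in u and v. *)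
Lemma psubst_trunc_stab N M f : (N <= M)%N -> vge N (sbt M f - sbt N f).
Proof.
move=> NM n m nm; rewrite !pcoefB; apply/eqP; rewrite subr_eq0; apply/eqP.
pose T i j := (cser (f i j) * u ^+ i * v ^+ j) n m.
have T0 i j : (N <= i)%N || (N <= j)%N -> T i j = 0.
  rewrite /T -mulrA coef2_cstM => /orP ij; rewrite vge_mono ?mulr0 //.
  by case: ij; lia.
have E k : sbt k f n m = \sum_(0 <= i < k) \sum_(0 <= j < k) T i j.
  rewrite /sbt psubst_trunc.unlock big_mkord coef2_sum; apply: eq_bigr => i _.
  by rewrite big_mkord coef2_sum.
rewrite !E (big_cat_nat _ (n := N)) //= [X in _ + X]big1_seq ?addr0; last first.
  move=> i /andP[_]; rewrite mem_index_iota => /andP[Ni _].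
  by rewrite big1 // => j _; rewrite T0 ?Ni.
apply: eq_bigr => i _.
rewrite (big_cat_nat _ (n := N)) //= [X in _ + X]big1_seq ?addr0 //.
by move=> j /andP[_]; rewrite mem_index_iota => /andP[Ni _]; rewrite T0 ?Ni ?orbT.
Qed.

Lemma psubst_approx N f : vge N (sb f - sbt N f).
Proof.
move=> n m nm; rewrite !pcoefB /sb psubst.unlock /=; apply/eqP; rewrite subr_eq0 eq_sym; apply/eqP.
have := @psubst_trunc_stab (n + m).+1 N f nm n m (leqnn _).
by rewrite !pcoefB => /eqP; rewrite subr_eq0 => /eqP.
Qed.

Lemma coef_psubst N f n m : (n + m < N)%N ->
  psubst u v f n m =
  \sum_(i < N) \sum_(j < N) f i j * (u ^+ i * v ^+ j) n m.
Proof.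
move=> nm; have /eqP := @psubst_approx N f n m nm.
rewrite !pcoefB subr_eq0 => /eqP ->.
rewrite /sbt psubst_trunc.unlock coef2_sum; apply: eq_bigr => i _.
rewrite coef2_sum; apply: eq_bigr => j _.
by rewrite -mulrA coef2_cstM.
Qed.

Fact psubst_is_additive : zmod_morphism sb.
Proof.
have E N f g : sbt N (f - g) = sbt N f - sbt N g.
  rewrite /sbt psubst_trunc.unlock -sumrB; apply: eq_bigr => i _; rewrite -sumrB; apply: eq_bigr => j _.
  by rewrite !pcoefB rmorphB /= !mulrBl.
move=> f g; apply: pser2P => n m.
by rewrite !pcoefB /sb psubst.unlock /= -/(sbt _ _) E !pcoefB.
Qed.

Lemma psubst_vge N f : vge N f -> vge N (sb f).
Proof.
move=> h; rewrite -[sb f](subrK (sbt N f)); apply: vgeD.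
  exact: psubst_approx.
rewrite /sbt psubst_trunc.unlock; apply: vge_sum => i _; apply: vge_sum => j _; rewrite -mulrA.
have [ij|ij] := ltnP (i + j) N; first by rewrite h // rmorph0 mul0r; exact: vge_zero.
by apply: vgeMl; exact: (vgeW ij (@vge_mono i j)).
Qed.

Lemma psubst_mono a i j :
  sb (cser a * (xx ^+ i * yy ^+ j)) = cser a * (u ^+ i * v ^+ j).
Proof.
apply: vge_eq => N; pose M := maxn N (maxn i j).+1.
apply: vgeW (leq_maxl N (maxn i j).+1) _; rewrite -/M.
apply: (@vge_trans _ _ (sbt M (cser a * (xx ^+ i * yy ^+ j)))).
  exact: psubst_approx.
have iM : (i < M)%N by rewrite /M; lia.
have jM : (j < M)%N by rewrite /M; lia.
rewrite /sbt psubst_trunc.unlock (@sum2_delta _ M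
  (fun k l => cser ((cser a * (xx ^+ i * yy ^+ j)) k l) * u ^+ k * v ^+ l) i j) //.
  by rewrite coef2_cstM coef2_mono !eqxx mulr1 -mulrA subrr; exact: vge_zero.
move=> k l kl; rewrite coef2_cstM coef2_mono.
case: andP => [[/eqP ik /eqP jl]|_]; first by rewrite ik jl eqxx in kl.
by rewrite mulr0 rmorph0 !mul0r.
Qed.

Let sbD f g : sb (f + g) = sb f + sb g.
Proof.
have sbN h : sb (- h) = - sb h.
  by rewrite -sub0r psubst_is_additive -[X in sb X](subrr h) psubst_is_additive subrr sub0r.
by rewrite -[g in LHS]opprK psubst_is_additive sbN opprK.
Qed.

Let sb_sum I (r : seq I) (F : I -> pser2 K) :
  sb (\sum_(i <- r) F i) = \sum_(i <- r) sb (F i).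
Proof.
have sb0 : sb 0 = 0 by have := psubst_is_additive 0 0; rewrite !subrr.
by elim: r => [|i r IH]; rewrite ?big_nil // !big_cons sbD IH.
Qed.

Lemma psubst_ptrunc N f : sb (psubst_trunc N xx yy f) = sbt N f.
Proof.
rewrite /sbt psubst_trunc.unlock sb_sum; apply: eq_bigr => i _.
rewrite sb_sum; apply: eq_bigr => j _; have H := psubst_mono (f i j) i j.
rewrite [in LHS]mulrA in H.
by rewrite [in RHS]mulrA in H; exact H.
Qed.

(** Modulo order N both factors may be replaced by truncations, where the claim is bilinear and
    reduces to monomials. *)
Fact psubst_is_mul : monoid_morphism sb.
Proof.
split=> [|f g].
  by have := psubst_mono 1 0 0; rewrite rmorph1 !mul1r !expr0.
apply: vge_eq => N; pose t := psubst_trunc N xx yy.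
have sbt_eq h : vge N (sb h - sb (t h)).
  by rewrite psubst_ptrunc; exact: psubst_approx.
apply: (@vge_trans _ _ (sb (t f * t g))).
  rewrite -psubst_is_additive; apply: psubst_vge.
  by apply: vgeMB; exact: vge_ptrunc.
apply: (@vge_trans _ _ (sb (t f) * sb (t g))); last first.
  by apply: vgeMB; apply: vge_sym.
suff -> : sb (t f * t g) = sb (t f) * sb (t g).
  by rewrite subrr; exact: vge_zero.
(* Stated apart because the same expansion is needed at (x, y) and at (u, v). *)
have M4 (A B : nat -> nat -> pser2 K) :
    (\sum_(i < N) \sum_(j < N) A i j) * (\sum_(k < N) \sum_(l < N) B k l) =
    \sum_(i < N) \sum_(j < N) \sum_(k < N) \sum_(l < N) A i j * B k l.
  rewrite mulr_suml; apply: eq_bigr => i _.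
  rewrite mulr_suml; apply: eq_bigr => j _.
  rewrite mulr_sumr; apply: eq_bigr => k _.
  by rewrite mulr_sumr.
rewrite /t (psubst_ptrunc N f) (psubst_ptrunc N g) /sbt psubst_trunc.unlock.
pose A u v i j := cser (f i j) * u ^+ i * v ^+ j.
pose B u v i j := cser (g i j) * u ^+ i * v ^+ j.
apply: etrans (congr1 sb (M4 (A xx yy) (B xx yy))) _.
apply: etrans _ (esym (M4 (A u v) (B u v))).
rewrite /A /B {A B M4}.
rewrite sb_sum; apply: eq_bigr => i _; rewrite sb_sum; apply: eq_bigr => j _.
rewrite sb_sum; apply: eq_bigr => k _; rewrite sb_sum; apply: eq_bigr => l _.
have re (p q : pser2 K) : cser (f i j) * p ^+ i * q ^+ j *
    (cser (g k l) * p ^+ k * q ^+ l) =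
    cser (f i j * g k l) * (p ^+ (i + k) * q ^+ (j + l)).
  by rewrite !exprD rmorphM /=; ring.
exact: etrans (congr1 sb (re xx yy)) (etrans (psubst_mono _ _ _) (esym (re u v))).
Qed.

Lemma psubst_xx : sb xx = u.
Proof. by have := psubst_mono 1 1 0; rewrite rmorph1 !mul1r !expr0 !expr1 !mulr1. Qed.
Lemma psubst_yy : sb yy = v.
Proof. by have := psubst_mono 1 0 1; rewrite rmorph1 !mul1r ?expr0 ?expr1 ?mul1r. Qed.
Lemma psubst_cst a : sb (cser a) = cser a.
Proof. by have := psubst_mono a 0 0; rewrite ?expr0 ?mulr1. Qed.

Lemma ev0_psubst f : ev0 (sb f) = ev0 f.
Proof.
have : ev0 (sb (f - cser (ev0 f))) = 0.
  by apply/vge1P/psubst_vge/vge1P; rewrite rmorphB /= ev0_cst subrr.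
by rewrite psubst_is_additive rmorphB psubst_cst /= ev0_cst => /subr0_eq.
Qed.

End Subst.
End Pser2.

Ltac pring :=
  repeat match goal with
  | |- context [psubst ?u ?v ?f] => move: (psubst u v f) => ?
  | |- context [dx ?f] => move: (dx f) => ?
  | |- context [dy ?f] => move: (dy f) => ?
  | |- context [cser ?c] => move: (cser c) => ?
  end; ring.

Section SubstMorph.
Variable K : comNzRingType.
Implicit Types (f g u v : pser2 K).

Lemma psubstB u v f g : psubst u v (f - g) = psubst u v f - psubst u v g.
Proof. exact: psubst_is_additive. Qed.
Lemma psubst0 u v : psubst u v 0 = 0.
Proof. by have := psubstB u v 0 0; rewrite !subrr. Qed.
Lemma psubstN u v f : psubst u v (- f) = - psubst u v f.
Proof. by rewrite -sub0r psubstB psubst0 sub0r. Qed.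
Lemma psubstD u v f g : psubst u v (f + g) = psubst u v f + psubst u v g.
Proof. by rewrite -[g in LHS]opprK psubstB psubstN opprK. Qed.
Lemma psubstM u v f g : vge 1 u -> vge 1 v ->
  psubst u v (f * g) = psubst u v f * psubst u v g.
Proof. by move=> u1 v1; have [_] := psubst_is_mul u1 v1. Qed.
Lemma psubst1 u v : vge 1 u -> vge 1 v -> psubst u v 1 = 1.
Proof. by move=> u1 v1; have [] := psubst_is_mul u1 v1. Qed.

(** One chain rule for [dx] and [dy]. The last condition on D, lowering the order by at most one, is
    the continuity that carries the identity from polynomials to series. *)
Lemma psubst_chain u v (D : pser2 K -> pser2 K) :
  vge 1 u -> vge 1 v -> zmod_morphism D -> (forall f g, D (f * g) = D f * g + f * D g) ->
  (forall a, D (cser a) = 0) -> (forall N f, vge N.+1 f -> vge N (D f)) ->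
  forall f, D (psubst u v f) = psubst u v (dx f) * D u + psubst u v (dy f) * D v.
Proof.
move=> u1 v1 DB DM Dc Dv f.
have DN h : D (- h) = - D h.
  by rewrite -sub0r DB -[X in D X](subrr h) DB subrr sub0r.
have DD h g : D (h + g) = D h + D g by rewrite -[g in LHS]opprK DB DN opprK.
pose C f := D (psubst u v f) = psubst u v (dx f) * D u + psubst u v (dy f) * D v.
have HC N : C (psubst_trunc N (xx K) (yy K) f).
  apply: psubst_trunc_ind; rewrite /C.
  - by move=> a; rewrite psubst_cst // Dc dx_cst dy_cst psubst0 !mul0r addr0.
  - by rewrite psubst_xx // dx_xx dy_xx psubst0 (psubst1 u1 v1) mul0r mul1r addr0.
  - by rewrite psubst_yy // dx_yy dy_yy psubst0 (psubst1 u1 v1) mul0r mul1r add0r.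
  - by move=> g h Hg Hh; rewrite psubstD DD Hg Hh !raddfD !psubstD; move: (D u) (D v) => ? ?; pring.
  - move=> g h Hg Hh; rewrite (psubstM _ _ u1 v1) DM Hg Hh dxM dyM !psubstD !(psubstM _ _ u1 v1); move: (D u) (D v) => ? ?; pring.
apply: vge_eq => N; have ft := @vge_ptrunc _ N.+1 f.
set t := psubst_trunc N.+1 (xx K) (yy K) f in ft *.
apply: (@vge_trans _ _ _ (D (psubst u v t))).
  rewrite -DB -psubstB; apply: Dv; exact: psubst_vge.
have := HC N.+1; rewrite /C -/t => ->; apply: vge_sym.
have -> : psubst u v (dx f) * D u + psubst u v (dy f) * D v - (psubst u v (dx t) * D u + psubst u v (dy t) * D v)
   = (psubst u v (dx f) - psubst u v (dx t)) * D u + (psubst u v (dy f) - psubst u v (dy t)) * D v by move: (D u) (D v) => ? ?; pring.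
rewrite -!psubstB -!raddfB.
apply: vgeD; apply: vgeMr; apply: psubst_vge; try done; [exact: vge_dx|exact: vge_dy].
Qed.

Lemma dx_psubst u v f : vge 1 u -> vge 1 v ->
  dx (psubst u v f) = psubst u v (dx f) * dx u + psubst u v (dy f) * dx v.
Proof.
move=> u1 v1; apply: psubst_chain => //; [exact: raddfB|exact: dxM|exact: dx_cst|exact: vge_dx].
Qed.
Lemma dy_psubst u v f : vge 1 u -> vge 1 v ->
  dy (psubst u v f) = psubst u v (dx f) * dy u + psubst u v (dy f) * dy v.
Proof.
move=> u1 v1; apply: psubst_chain => //; [exact: raddfB|exact: dyM|exact: dy_cst|exact: vge_dy].
Qed.

Lemma psubst_id f : psubst (xx K) (yy K) f = f.
Proof.
apply: vge_eq => N; have x1 := @vge_xx K; have y1 := @vge_yy K.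
apply: (@vge_trans _ _ _ (psubst_trunc N (xx K) (yy K) f)).
  exact: psubst_approx.
by apply: vge_sym; exact: vge_ptrunc.
Qed.

Lemma psubst_comp u v u' v' f :
  vge 1 u -> vge 1 v -> vge 1 u' -> vge 1 v' ->
  psubst u' v' (psubst u v f) = psubst (psubst u' v' u) (psubst u' v' v) f.
Proof.
move=> u1 v1 u1' v1'.
have U1 := psubst_vge u1' v1' u1; have V1 := psubst_vge u1' v1' v1.
pose C f := psubst u' v' (psubst u v f) = psubst (psubst u' v' u) (psubst u' v' v) f.
have HC N : C (psubst_trunc N (xx K) (yy K) f).
  apply: psubst_trunc_ind; rewrite /C.
  - by move=> a; rewrite (psubst_cst u1 v1) !(psubst_cst _ _).
  - by rewrite (psubst_xx u1 v1) (psubst_xx U1 V1).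
  - by rewrite (psubst_yy u1 v1) (psubst_yy U1 V1).
  - by move=> g h Hg Hh; rewrite !psubstD Hg Hh.
  - move=> g h Hg Hh.
    by rewrite (psubstM _ _ u1 v1) (psubstM _ _ U1 V1) (psubstM _ _ u1' v1') Hg Hh.
apply: vge_eq => N; set t := psubst_trunc N (xx K) (yy K) f.
have ft : vge N (f - t) := @vge_ptrunc _ N f.
apply: (@vge_trans _ _ _ (psubst u' v' (psubst u v t))).
  by rewrite -!psubstB; do 2?apply: psubst_vge.
by have := HC N; rewrite /C -/t => ->; rewrite -psubstB; apply: psubst_vge => //; apply: vge_sym.
Qed.

(** The terms divisible by x go to g; what remains is a series in y alone. *)
Lemma vge_split N f : vge N.+1 f ->
  exists g h, [/\ f = xx K * g + yy K * h, vge N g & vge N h].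
Proof.
move=> fN; exists (PSer (fun n => f n.+1)).
exists (pser_const (PSer (fun m => f 0%N m.+1))); split.
- apply: pser2P => i j; rewrite !pcoefD coef2_xxM coef2_yyM pcoef_const.
  case: i => [|i]; case: j => [|j]; rewrite ?pcoef0 ?addr0 ?add0r //.
  exact: fN.
- by move=> i j ij; apply: fN; rewrite addSn.
- move=> i j ij; rewrite pcoef_const; case: i ij => [|i] ij; last by rewrite pcoef0.
  by apply: fN; rewrite addnS.
Qed.

End SubstMorph.

(** * Formal vector fields and blow-ups *)

Definition chart (F : comNzRingType) (d : option F) : pser2 F * pser2 F :=
  match d with
  | Some c => (xx F, xx F * (yy F + cser c))
  | None => (xx F * yy F, yy F)
  end.
HB.lock Definition pb (F : comNzRingType) (d : option F) (f : pser2 F) : pser2 F :=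
  psubst (chart d).1 (chart d).2 f.

Section FormalFields.
Variable F : numFieldType.
Notation S := (pser2 F).
Notation vec := (S * S)%type.
Implicit Types (f g h P Q : S) (X Y V W : vec) (d : option F) (c : F).

Lemma pser2_mul_eq0 f g : f * g = 0 -> f = 0 \/ g = 0.
Proof.
apply: pser_mul_eq0; apply: pser_mul_eq0 => a b /eqP.
by rewrite mulf_eq0 => /orP[] /eqP; tauto.
Qed.
Lemma pser2_mul_neq0 f g : f <> 0 -> g <> 0 -> f * g <> 0.
Proof. by move=> f0 g0 /pser2_mul_eq0[]. Qed.
Lemma pser2_mulfI f g h : f <> 0 -> f * g = f * h -> g = h.
Proof.
move=> f0 fgh; apply/subr0_eq; have : f * (g - h) = 0 by rewrite mulrBr fgh subrr.
by case/pser2_mul_eq0.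
Qed.

Definition act X f := X.1 * dx f + X.2 * dy f.
Definition divg X := dx X.1 + dy X.2.
Definition wdg X Y := X.1 * Y.2 - X.2 * Y.1.

Definition jac_tr X : F := ev0 (dx X.1) + ev0 (dy X.2).
Definition jac_det X : F :=
  ev0 (dx X.1) * ev0 (dy X.2) - ev0 (dy X.1) * ev0 (dx X.2).

Notation chart := (@chart F).
Definition exc d : S := if d is Some _ then xx F else yy F.
Notation pb := (@pb F).
(* The adjugate of the differential of [chart d], applied to [X o chart d]. *)
Definition blift d X : vec :=
  match d with
  | Some c => (xx F * pb d X.1, pb d X.2 - (yy F + cser c) * pb d X.1)
  | None => (pb d X.1 - xx F * pb d X.2, yy F * pb d X.2)
  end.

Lemma vge_chart1 d : vge 1 (chart d).1.
Proof. by case: d => [c|]; apply/vge1P; rewrite /= ?rmorphM /= ?ev0_xx ?ev0_yy ?mul0r. Qed.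
Lemma vge_chart2 d : vge 1 (chart d).2.
Proof. by case: d => [c|]; apply/vge1P; rewrite /= ?rmorphM /= ?ev0_xx ?ev0_yy ?mul0r. Qed.

Lemma pbE d f : pb d f = psubst (chart d).1 (chart d).2 f.
Proof. by rewrite pb.unlock. Qed.
Lemma pbM d f g : pb d (f * g) = pb d f * pb d g.
Proof. by rewrite pb.unlock; apply: psubstM; [exact: vge_chart1|exact: vge_chart2]. Qed.
Lemma pbD d f g : pb d (f + g) = pb d f + pb d g.
Proof. by rewrite pb.unlock; exact: psubstD. Qed.
Lemma pbB d f g : pb d (f - g) = pb d f - pb d g.
Proof. by rewrite pb.unlock; exact: psubstB. Qed.
Lemma pb1 d : pb d 1 = 1.
Proof. by rewrite pb.unlock; apply: psubst1; [exact: vge_chart1|exact: vge_chart2]. Qed.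
Lemma pb_cst d c : pb d (cser c) = cser c.
Proof. by rewrite pb.unlock; apply: psubst_cst; [exact: vge_chart1|exact: vge_chart2]. Qed.
Lemma pb_xx d : pb d (xx F) = (chart d).1.
Proof. by rewrite pb.unlock; apply: psubst_xx; [exact: vge_chart1|exact: vge_chart2]. Qed.
Lemma pb_yy d : pb d (yy F) = (chart d).2.
Proof. by rewrite pb.unlock; apply: psubst_yy; [exact: vge_chart1|exact: vge_chart2]. Qed.
Lemma ev0_pb d f : ev0 (pb d f) = ev0 f.
Proof. by rewrite pb.unlock; apply: ev0_psubst; [exact: vge_chart1|exact: vge_chart2]. Qed.

Lemma dx_pb d f :
  dx (pb d f) = pb d (dx f) * dx (chart d).1 + pb d (dy f) * dx (chart d).2.
Proof. by rewrite pb.unlock; apply: dx_psubst; [exact: vge_chart1|exact: vge_chart2]. Qed.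
Lemma dy_pb d f :
  dy (pb d f) = pb d (dx f) * dy (chart d).1 + pb d (dy f) * dy (chart d).2.
Proof. by rewrite pb.unlock; apply: dy_psubst; [exact: vge_chart1|exact: vge_chart2]. Qed.

Definition dE := (dxM, dyM, dx_xx, dx_yy, dy_xx, dy_yy, @dx_cst F, @dy_cst F,
  dxD, dyD, dxN, dyN).

Ltac vring :=
  repeat match goal with
  | |- context [pb ?d ?f] => move: (pb d f) => ?
  end; pring.

(** The adjugate is the determinant times the inverse, and the Jacobian determinant of the chart is
    [exc d]: the lift is [exc d] times the pulled-back field. *)
Lemma act_lift d X f : act (blift d X) (pb d f) = exc d * pb d (act X f).
Proof.
rewrite /act dx_pb dy_pb pbD !pbM.
by case: d => [c|] /=; rewrite !dE; vring.
Qed.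

(** Contracting dx /\ dy with the lift gives the pullback of its contraction with X, and pullback
    commutes with the exterior derivative. *)
Lemma divg_lift d X : divg (blift d X) = exc d * pb d (divg X).
Proof.
rewrite /divg pbD.
by case: d => [c|]; rewrite /= !dE !dx_pb !dy_pb /= !dE; vring.
Qed.

Lemma wdg_lift d X Y : wdg (blift d X) (blift d Y) = exc d * pb d (wdg X Y).
Proof. by rewrite /wdg pbB !pbM; case: d => [c|] /=; vring. Qed.

Lemma xx_neq0 : xx F <> 0.
Proof. by move=> /(congr1 (@dx F))/eqP; rewrite dx_xx raddf0 oner_eq0. Qed.
Lemma yy_neq0 : yy F <> 0.
Proof. by move=> /(congr1 (@dy F))/eqP; rewrite dy_yy raddf0 oner_eq0. Qed.
Lemma exc_neq0 d : exc d <> 0.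
Proof. by case: d => [c|] /=; [exact: xx_neq0|exact: yy_neq0]. Qed.
Lemma ev0_exc d : ev0 (exc d) = 0. Proof. by case: d => [c|]; [exact: ev0_xx|exact: ev0_yy]. Qed.

Lemma vge_lin a b : vge 1 (cser a * xx F + cser b * yy F).
Proof. by apply/vge1P; rewrite rmorphD !rmorphM /= ev0_xx ev0_yy !mulr0 addr0. Qed.

(** Exponents (i, j) become (i + j, j), so distinct monomials do not merge. *)
Lemma coef_psubst_x_xy f i j : psubst (xx F) (xx F * yy F) f (i + j)%N j = f i j.
Proof.
have y1 : vge 1 (xx F * yy F) by exact: vgeMr (@vge_xx F).
rewrite (coef_psubst (@vge_xx F) y1 f (leqnn _)).
have E k l : (xx F ^+ k * (xx F * yy F) ^+ l) (i + j)%N j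
    = (((i + j)%N == (k + l)%N) && (j == l))%:R.
  by rewrite exprMn mulrA -exprD coef2_mono.
rewrite (@sum2_delta _ (i + j + j).+1
  (fun k l => f k l * (xx F ^+ k * (xx F * yy F) ^+ l) (i + j)%N j) i j); try lia.
  by rewrite E !eqxx mulr1.
move=> k l kl; rewrite E; case: andP => [[/eqP ik /eqP jl]|_]; rewrite ?mulr0 //.
by case/eqP: kl; subst l; congr (_, _); lia.
Qed.

Lemma coef_psubst_xy_y f i j : psubst (xx F * yy F) (yy F) f i (i + j)%N = f i j.
Proof.
have y1 : vge 1 (xx F * yy F) by exact: vgeMr (@vge_xx F).
rewrite (coef_psubst y1 (@vge_yy F) f (leqnn _)).
have E k l : ((xx F * yy F) ^+ k * yy F ^+ l) i (i + j)%N
      = ((i == k) && ((i + j)%N == (k + l)%N))%:R.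
  by rewrite exprMn -mulrA -exprD coef2_mono.
rewrite (@sum2_delta _ (i + (i + j)).+1
  (fun k l => f k l * ((xx F * yy F) ^+ k * yy F ^+ l) i (i + j)%N) i j); try lia.
  by rewrite E !eqxx mulr1.
move=> k l kl; rewrite E; case: andP => [[/eqP ik /eqP jl]|_]; rewrite ?mulr0 //.
by case/eqP: kl; subst k; congr (_, _); lia.
Qed.

(** The invertible shear y + c x reduces the chart at c to the chart at 0, where the coefficients of
    f can be read off. *)
Lemma pb_inj d f : pb d f = 0 -> f = 0.
Proof.
rewrite pbE; case: d => [c|] /= fd; last first.
  by apply: pser2P => i j; rewrite -coef_psubst_xy_y fd !pcoef0.
have x1 := @vge_xx F; have y1 : vge 1 (xx F * yy F) by exact: vgeMr.
have yc1 e : vge 1 (yy F + cser e * xx F).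
  by apply: vgeD; [exact: vge_yy|exact: vgeMl].
have f0 : psubst (xx F) (yy F + cser c * xx F) f = 0.
  apply: pser2P => i j; rewrite -coef_psubst_x_xy (psubst_comp _ x1 (yc1 _) x1 y1).
  rewrite psubstD (psubstM _ _ x1 y1) (psubst_cst x1 y1) (psubst_xx x1 y1) (psubst_yy x1 y1).
  have -> : xx F * yy F + cser c * xx F = xx F * (yy F + cser c) by pring.
  by rewrite fd !pcoef0.
have : psubst (xx F) (yy F + cser (- c) * xx F) (psubst (xx F) (yy F + cser c * xx F) f) = 0.
  by rewrite f0 psubst0.
rewrite (psubst_comp _ x1 (yc1 _) x1 (yc1 _)).
rewrite psubstD (psubstM _ _ x1 (yc1 _)) (psubst_cst x1 (yc1 _)).
rewrite (psubst_xx x1 (yc1 _)) (psubst_yy x1 (yc1 _)).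
have -> : yy F + cser (- c) * xx F + cser c * xx F = yy F.
  by rewrite rmorphN /=; pring.
by rewrite psubst_id.
Qed.

Definition vneq0 X := X.1 <> 0 \/ X.2 <> 0.

Lemma lift_neq0 d X : vneq0 X -> vneq0 (blift d X).
Proof.
move=> X0; apply: contrapT => H.
have [/contrapT l1 /contrapT l2] := (not_orP _ _).1 H.
have [p1 p2] : pb d X.1 = 0 /\ pb d X.2 = 0.
  case: d {H} l1 l2 => [c|] /=.
    by case/pser2_mul_eq0 => [/xx_neq0//|E]; rewrite E mulr0 subr0.
  by move=> l1 /pser2_mul_eq0[/yy_neq0//|E]; move: l1; rewrite E mulr0 subr0.
by case: X0 => -[]; apply: pb_inj; [exact: p1|exact: p2].
Qed.

Fixpoint bliftw (w : seq (option F)) X := if w is d :: w' then bliftw w' (blift d X) else X.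

(* x^i y^j bounds P from below in the graded lexicographic order. *)
Definition low P i j :=
  forall k l, (k + l < i + j)%N || ((k + l == i + j) && (k < i))%N -> P k l = 0.

(** The order on exponents is compatible with addition, so leading monomials multiply. *)
Lemma lowM P Q i j k l : low P i j -> low Q k l ->
  low (P * Q) (i + k) (j + l) /\ (P * Q) (i + k)%N (j + l)%N = P i j * Q k l.
Proof.
move=> lP lQ.
(* In each product one factor lies strictly below its bound, unless both sit exactly at the leading
   exponents. *)
have T0 n m a b : (a <= n)%N -> (b <= m)%N ->
    (n + m < i + k + (j + l))%N || ((n + m == i + k + (j + l)) && (n <= i + k))%N ->
    (n, m, a, b) != (i + k, j + l, i, j)%N -> P a b * Q (n - a)%N (m - b)%N = 0.
  move=> an bm nm ne.
  have [Pab|Pab] := boolP ((a + b < i + j) || ((a + b == i + j) && (a < i)))%N.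
    by rewrite lP // mul0r.
  rewrite lQ ?mulr0 //; apply/orP.
  have [E|E] := eqVneq (n, m, a, b) (i + k, j + l, i, j)%N.
    by rewrite E eqxx in ne.
  have {E} : ~ (n = i + k /\ m = j + l /\ a = i /\ b = j)%N.
    by case=> E1 [E2 [E3 E4]]; rewrite E1 E2 E3 E4 eqxx in E.
  by move: nm Pab; clear -an bm; lia.
split.
  move=> n m nm; rewrite coef2M big1 // => a _; rewrite big1 // => b _.
  have := ltn_ord a; have := ltn_ord b => hb ha.
  apply: T0 => //; first by move: nm; lia.
  apply/eqP => -[E1 E2 _ _]; move: nm; rewrite E1 E2; lia.
rewrite coef2M.
have ia : (i < (i + k).+1)%N by lia. have jb : (j < (j + l).+1)%N by lia.
rewrite (bigD1 (Ordinal ia)) //= [X in _ + X]big1 ?addr0.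
  rewrite (bigD1 (Ordinal jb)) //= [X in _ + X]big1 ?addr0 ?addKn // => b bj.
  have hb := ltn_ord b; have := T0 (i + k)%N (j + l)%N i b; rewrite addKn; apply; try lia.
  by apply: contra bj => /eqP[E]; apply/eqP/val_inj.
move=> a ai; rewrite big1 // => b _.
have hb := ltn_ord b; have ha := ltn_ord a; apply: T0; try lia.
by apply: contra ai => /eqP[E _]; apply/eqP/val_inj.
Qed.

(** Two minimizations: of the total degree, then of the power of x within that degree. *)
Lemma lead_exists P : P <> 0 -> exists i j, P i j != 0 /\ low P i j.
Proof.
move=> P0.
have ex1 : exists n, `[< exists i j, (i + j = n)%N /\ P i j != 0 >].
  apply/not_existsP => H; apply: P0; apply: pser2P => i j; rewrite !pcoef0.
  apply/eqP/negPn/negP => Pij.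
  by apply: (H (i + j)%N); apply/asboolP; exists i, j.
case: (ex_minnP ex1) => n /asboolP[i0 [j0 [ij0 Pij0]]] nmin.
have ex2 : exists i, (i <= n)%N && (P i (n - i)%N != 0).
  by exists i0; rewrite -ij0 leq_addr addKn.
case: (ex_minnP ex2) => i /andP[ilen Pi] imin.
exists i, (n - i)%N; split=> // k l; rewrite subnKC // => H.
apply/eqP/negPn/negP => Pkl; case/orP: H => [kl|/andP[/eqP kl ki]].
  have : (n <= k + l)%N by apply: nmin; apply/asboolP; exists k, l.
  by rewrite leqNgt kl.
have : (i <= k)%N by apply: imin; rewrite -kl leq_addr addKn Pkl.
by rewrite leqNgt ki.
Qed.

Lemma coef2_xx i j : xx F i j = ((i == 1%N) && (j == 0%N))%:R.
Proof. by rewrite mono10 coef2_mono. Qed.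
Lemma coef2_yy i j : yy F i j = ((i == 0%N) && (j == 1%N))%:R.
Proof. by rewrite mono01 coef2_mono. Qed.

Lemma vge2P f : ev0 f = 0 ->
  vge 2 (f - cser (ev0 (dx f)) * xx F - cser (ev0 (dy f)) * yy F).
Proof.
move=> + i j ij; rewrite !pcoefB !coef2_cstM coef2_xx coef2_yy.
rewrite !ev0E coef2_dx coef2_dy !mulr1n => f0.
by case: i ij => [|[|i]]; case: j => [|[|j]] //= ij;
  rewrite ?mulr1 ?mulr0 ?subr0 ?subrr.
Qed.

(** The linear part of W multiplies x^i y^j by l i + m j, while its terms of order two only reach
    degree i + j + 1 or more. *)
Lemma coef_act_diag W P i j (l m : F) :
  ev0 W.1 = 0 -> ev0 W.2 = 0 ->
  ev0 (dx W.1) = l -> ev0 (dy W.1) = 0 ->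
  ev0 (dx W.2) = 0 -> ev0 (dy W.2) = m -> low P i j ->
  low (act W P) i j /\ (act W P) i j = (l * i%:R + m * j%:R) * P i j.
Proof.
move=> w1 w2 a b c d lP.
have := vge2P w1; rewrite a b rmorph0 mul0r subr0; set A := _ - _ => hA.
have := vge2P w2; rewrite c d rmorph0 mul0r subr0; set B := _ - _ => hB.
have vP : vge (i + j) P by move=> k n kn; apply: lP; rewrite kn.
(* The predecessor covers degree 0, where the derivatives have order 0 only; the order two of A and
   B still yields i + j + 1. *)
have vdx : vge (i + j).-1 (dx P) by case: (i + j)%N vP => // n vP; exact: vge_dx.
have vdy : vge (i + j).-1 (dy P) by case: (i + j)%N vP => // n vP; exact: vge_dy.
have E : act W P = cser l * (xx F * dx P) + cser m * (yy F * dy P) + (A * dx P + B * dy P).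
  by rewrite /act /A /B; vring.
have vR : vge (i + j).+1 (A * dx P + B * dy P).
  by apply: vgeD; (apply: (@vgeW _ _ (2 + (i + j).-1)); [lia|exact: vgeM]).
move: (A * dx P + B * dy P) E vR => R E vR.
have co k n : (k + n <= i + j)%N -> act W P k n = (l * k%:R + m * n%:R) * P k n.
  move=> kn; rewrite E !pcoefD (vR k n) // addr0 !coef2_cstM coef2_xxM coef2_yyM.
  case: k kn => [|k] kn; case: n kn => [|n] kn;
    rewrite ?coef2_dx ?coef2_dy -?[P _ _ *+ _]mulr_natl; vring.
split; last exact: co.
move=> k n kn; rewrite co ?lP ?mulr0 //; lia.
Qed.

(** Compare both sides at the sum of the leading exponents, where only leading coefficients meet. *)
Lemma lead_relation W P Q f (l m : F) :
  ev0 W.1 = 0 -> ev0 W.2 = 0 ->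
  ev0 (dx W.1) = l -> ev0 (dy W.1) = 0 ->
  ev0 (dx W.2) = 0 -> ev0 (dy W.2) = m ->
  Q * act W P - P * act W Q = f * (P * Q) ->
  forall i j i' j', P i j != 0 -> low P i j -> Q i' j' != 0 -> low Q i' j' ->
  l * (i%:R - i'%:R) + m * (j%:R - j'%:R) = ev0 f.
Proof.
move=> w1 w2 a b c d E i j i' j' Pij lP Qij lQ.
have [lWP cWP] := coef_act_diag w1 w2 a b c d lP.
have [lWQ cWQ] := coef_act_diag w1 w2 a b c d lQ.
have [_ c1] := lowM lQ lWP; have [_ c2] := lowM lP lWQ.
have [lPQ c3] := lowM lP lQ.
have lf : low f 0 0 by move=> k n; rewrite addn0 !ltn0 andbF.
have [_ c4] := lowM lf lPQ; rewrite !add0n in c4.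
have : (Q * act W P - P * act W Q) (i + i')%N (j + j')%N
     = (f * (P * Q)) (i + i')%N (j + j')%N by rewrite E.
rewrite c4 c3 !pcoefB c2 [(i + i')%N]addnC [(j + j')%N]addnC c1 cWP cWQ.
have PQ0 : P i j * Q i' j' != 0 by rewrite mulf_neq0.
move=> H; apply: (mulIf PQ0); rewrite ev0E -H; ring.
Qed.

End FormalFields.

(** * Nonresonant singularities *)

Section Resonance.
Variable F : numFieldType.
Notation S := (pser2 F).
Notation vec := (S * S)%type.
Implicit Types (f g P Q : S) (X Y V W : vec).

Section Irrational.
Variables l m : F.
Hypotheses (l0 : l != 0) (irr : forall q : rat, m / l != ratr q).

(** Independence of l and m over the rationals: monomials with the same eigenvalue under W have the
    same exponents. *)
Lemma irrational_int (a b : int) : l * a%:~R + m * b%:~R = 0 -> a = 0 /\ b = 0.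
Proof.
move=> E; have [b0|b0] := eqVneq b 0.
  move/eqP: E; rewrite b0 mulr0 addr0 mulf_eq0 (negPf l0) intr_eq0 => /eqP.
  by move->.
have bF : b%:~R != 0 :> F by rewrite intr_eq0.
have /eqP[] := irr (- (a%:~R / b%:~R)).
rewrite rmorphN fmorph_div !rmorph_int.
apply: (mulIf l0); rewrite divfK //; apply: (mulIf bF).
have -> : m * b%:~R = - (l * a%:~R) by apply/eqP; rewrite -subr_eq0 opprK addrC E.
by field.
Qed.

Lemma irrational_rat (r : rat) p : p != 0 -> m * p <> l * (ratr r * p).
Proof.
move=> p0 E; have /eqP[] := irr r; apply: (mulIf l0); rewrite divfK //.
by apply: (mulIf p0); rewrite E; ring.
Qed.
End Irrational.

(** Eigenvalues enter through trace and determinant, which linear changes of coordinates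
    preserve. *)
Definition nonresonant W (l m : F) :=
  [/\ ev0 W.1 = 0, ev0 W.2 = 0, jac_tr W = l + m & jac_det W = l * m].

Definition diagonal W (l m : F) :=
  [/\ ev0 W.1 = 0, ev0 W.2 = 0, ev0 (dx W.1) = l /\ ev0 (dy W.1) = 0
    & ev0 (dx W.2) = 0 /\ ev0 (dy W.2) = m].

(* Preserved when the meromorphic field V / Q is lifted through a blow-up; in the
   third case the eigenvalues of V are p and - r p, a saddle of rational type. *)
Definition blowup_inv V Q :=
  [\/ Q = 1 /\ [/\ ev0 V.1 = 0, ev0 V.2 = 0, jac_tr V = 0 & jac_det V = 0],
      ev0 V.1 <> 0 \/ ev0 V.2 <> 0 |
      [/\ ev0 V.1 = 0, ev0 V.2 = 0, ev0 Q = 0 &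
         exists (p : F) (r : rat), [/\ p != 0, 0 < r, jac_tr V = p - ratr r * p &
           jac_det V = - (ratr r * p * p)]]].

Section Diagonal.
Variables (W : vec) (l m : F).
Hypotheses (l0 : l != 0) (m0 : m != 0) (irr : forall q : rat, m / l != ratr q).
Hypothesis Wd : diagonal W l m.

(** Used with (a, b) = (1, 1) for inverse integrating factors and with (0, 0) for first
    integrals. *)
Lemma diagonal_lead P Q f (a b : int) :
  Q * act W P - P * act W Q = f * (P * Q) -> ev0 f = l * a%:~R + m * b%:~R ->
  forall i j i' j', P i j != 0 -> low P i j -> Q i' j' != 0 -> low Q i' j' ->
  i%:Z = i'%:Z + a /\ j%:Z = j'%:Z + b.
Proof.
case: Wd => w1 w2 [w11 w12] [w21 w22] E ef i j i' j' Pij lP Qij lQ.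
have := lead_relation w1 w2 w11 w12 w21 w22 E Pij lP Qij lQ; rewrite ef => R.
have : l * (i%:Z - i'%:Z - a)%:~R + m * (j%:Z - j'%:Z - b)%:~R = 0.
  by rewrite !rmorphB /= -!pmulrn; apply: (@addrI _ (l * a%:~R + m * b%:~R));
     rewrite addr0 -[RHS]R; ring.
by case/(irrational_int l0 irr) => /eqP; rewrite subr_eq0 => /eqP A /eqP;
   rewrite subr_eq0 => /eqP B; split; lia.
Qed.

(** The error made by replacing W by its linear part has order two, and order three when V vanishes
    at 0; hence the two ranges of degrees. *)
Lemma coef_wdg_diag V i j : (i + j <= 2)%N ->
  (ev0 V.1 = 0 /\ ev0 V.2 = 0) \/ (i + j <= 1)%N ->
  wdg W V i j = l * (xx F * V.2) i j - m * (yy F * V.1) i j.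
Proof.
case: Wd => w1 w2 [w11 w12] [w21 w22] ij H.
have := vge2P w1; rewrite w11 w12 rmorph0 mul0r subr0; set A := _ - _ => hA.
have := vge2P w2; rewrite w21 w22 rmorph0 mul0r subr0; set B := _ - _ => hB.
have E : wdg W V = cser l * (xx F * V.2) - cser m * (yy F * V.1) + (A * V.2 - B * V.1).
  by rewrite /wdg /A /B; pring.
have vR : (A * V.2 - B * V.1) i j = 0.
  case: H => [[v1 v2]|ij1]; last first.
    suff : vge 2 (A * V.2 - B * V.1) by apply; lia.
    by apply: vgeB; exact: vgeMr.
  suff : vge (2 + 1) (A * V.2 - B * V.1) by apply; lia.
  by apply: vgeB; apply: vgeM => //; apply/vge1P.
move: (A * V.2 - B * V.1) E vR => R -> vR.
by rewrite !pcoefD !pcoefN vR addr0 !coef2_cstM.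
Qed.

(** The leading exponent of P exceeds that of Q by (1, 1), so P has order at least 2 and no y^2
    term. This forces V(0) = 0 and a triangular linear part of V, whose diagonal then decides the
    two singular cases of [blowup_inv]. *)
Lemma diagonal_contra V Q : wdg W V <> 0 -> Q <> 0 ->
  Q * act W (wdg W V) - wdg W V * act W Q = divg W * (wdg W V * Q) ->
  ~ blowup_inv V Q.
Proof.
move=> P0 Q0 E; pose P := wdg W V; rewrite -/P in P0 E.
have [i [j [Pij lP]]] := lead_exists P0.
have [i' [j' [Qij lQ]]] := lead_exists Q0.
have dW : ev0 (divg W) = l * 1%:~R + m * 1%:~R.
  by case: Wd => _ _ [w11 _] [_ w22]; rewrite rmorphD /= w11 w22 !mulr1.
have [ii' jj'] := diagonal_lead E dW Pij lP Qij lQ.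
have Plow k n : (k + n < i + j)%N -> P k n = 0 by move=> kn; apply: lP; rewrite kn.
have v12 : ev0 V.1 = 0 /\ ev0 V.2 = 0.
  split; rewrite ev0E.
    have : P 0%N 1%N = 0 by apply: Plow; lia.
    rewrite /P coef_wdg_diag // ?coef2_xxM ?coef2_yyM; last by right.
    by rewrite mulr0 sub0r => /eqP; rewrite oppr_eq0 mulf_eq0 (negPf m0) => /eqP.
  have : P 1%N 0%N = 0 by apply: Plow; lia.
  rewrite /P coef_wdg_diag // ?coef2_xxM ?coef2_yyM; last by right.
  by rewrite mulr0 subr0 => /eqP; rewrite mulf_eq0 (negPf l0) => /eqP.
have [v1 v2] := v12.
have P02 : P 0%N 2%N = - (m * ev0 (dy V.1)).
  rewrite /P coef_wdg_diag //; last by left.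
  by rewrite coef2_xxM coef2_yyM ev0E coef2_dy mulr1n mulr0 sub0r.
have P20 : P 2%N 0%N = l * ev0 (dx V.2).
  rewrite /P coef_wdg_diag //; last by left.
  by rewrite coef2_xxM coef2_yyM ev0E coef2_dx mulr1n mulr0 subr0.
have P11 : P 1%N 1%N = l * ev0 (dy V.2) - m * ev0 (dx V.1).
  rewrite /P coef_wdg_diag //; last by left.
  by rewrite coef2_xxM coef2_yyM !ev0E coef2_dx coef2_dy !mulr1n.
(* The monomial y^2 precedes the leading one because i > 0. *)
have q0 : ev0 (dy V.1) = 0.
  have : P 0%N 2%N = 0.
    by apply: (lP 0%N 2%N); lia.
  by rewrite P02 => /eqP; rewrite oppr_eq0 mulf_eq0 (negPf m0) => /eqP.
(* Nilpotent case: Q = 1 makes xy the leading monomial of P, but its coefficient vanishes with the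
   diagonal of DV(0). *)
case=> [[Q1 [_ _ t0 d0]]|[]//|[_ _ Q00 [p [r [p0 r0 t0 d0]]]]].
  move: Qij; rewrite Q1 -(rmorph1 (@cser F)) coef2_cst.
  case: i' lQ ii' => [|i'] lQ ii'; last by rewrite /= eqxx.
  case: j' lQ jj' => [|j'] lQ jj'; last by rewrite /= eqxx.
  have ei : i = 1%N by lia. have ej : j = 1%N by lia.
  move: Pij; rewrite ei ej P11.
  move: t0 d0; rewrite /jac_tr /jac_det q0 mul0r subr0 => /eqP.
  rewrite addr_eq0 => /eqP t0 /eqP; rewrite mulf_eq0 t0 oppr_eq0 orbb => /eqP ->.
  by rewrite oppr0 !mulr0 subrr (eqxx (0 : F)).
(* Saddle case: Q(0) = 0 pushes P to order 3, so its xy coefficient gives l d = m a for the diagonal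
   entries a and d of DV(0). These are p and - r p in some order, and m / l would be rational. *)
have ij3 : (2 < i + j)%N.
  have : (i' + j' != 0)%N; last by lia.
  by apply: contra Qij; rewrite addn_eq0 => /andP[/eqP-> /eqP->]; rewrite -ev0E Q00.
have H11 : l * ev0 (dy V.2) = m * ev0 (dx V.1).
  by apply/eqP; rewrite -subr_eq0 -P11; apply/eqP/Plow.
have r20 : ev0 (dx V.2) = 0.
  have : P 2%N 0%N = 0 by apply: Plow.
  by rewrite P20 => /eqP; rewrite mulf_eq0 (negPf l0) => /eqP.
move: t0 d0 H11; rewrite /jac_tr /jac_det q0 mul0r subr0.
move: (ev0 (dx V.1)) (ev0 (dy V.2)) => a d t0 d0 H11.
have : (a - p) * (a + ratr r * p) = 0.
  have -> : (a - p) * (a + ratr r * p) = a * a - a * (p - ratr r * p) - ratr r * p * p by ring.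
  by rewrite -t0 -[X in _ + X]d0; ring.
move=> /eqP; rewrite mulf_eq0 subr_eq0 addr_eq0 => /orP[] /eqP ap.
  have dd : d = - (ratr r * p) by apply: (@addrI _ a); rewrite t0 ap; ring.
  by apply: (irrational_rat l0 irr (r := - r) p0); rewrite rmorphN /= mulNr -dd -ap.
have rF : ratr r != 0 :> F by rewrite fmorph_eq0 gt_eqF.
have dd : d = p by apply: (@addrI _ a); rewrite t0 ap; ring.
apply: (irrational_rat l0 irr (r := - r^-1) (p := a)).
  by rewrite ap oppr_eq0 mulf_neq0.
by rewrite rmorphN fmorphV /= -H11 dd ap; congr (_ * _); field.
Qed.

(** By [diagonal_lead], a nonzero solution of the equation has the leading exponent of Q.
    Subtracting the multiple of Q that cancels this coefficient leaves a solution that must be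
    zero. *)
Lemma diagonal_first_integral P Q : Q <> 0 ->
  Q * act W P = P * act W Q -> exists c, P = cser c * Q.
Proof.
move=> Q0 E; have [i [j [Qij lQ]]] := lead_exists Q0.
have lead P' : Q * act W P' = P' * act W Q -> P' <> 0 -> P' i j != 0.
  move=> E' /lead_exists[k [n [Pkn lP]]].
  have E0 : Q * act W P' - P' * act W Q = 0 * (P' * Q) by rewrite E' mul0r subrr.
  have e0 : ev0 (0 : S) = l * 0%:~R + m * 0%:~R by rewrite rmorph0 !mulr0 addr0.
  have [ki nj] := diagonal_lead E0 e0 Pkn lP Qij lQ.
  have <- : k = i by lia.
  by have <- : n = j by lia.
exists (P i j / Q i j); apply: contrapT => H.
have /lead /(_ _)/negP[] : Q * act W (P - cser (P i j / Q i j) * Q) = (P - cser (P i j / Q i j) * Q) * act W Q.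
  rewrite mulrBl -E /act !dE; pring.
- by move/subr0_eq/H.
- by rewrite !pcoefB coef2_cstM divfK // subrr.
Qed.

End Diagonal.

(** * Linear changes of coordinates *)

Section LinearChange.
Variables a b c d : F.
Let D := a * d - b * c.
Hypothesis D0 : D != 0.

Let u := cser a * xx F + cser b * yy F.
Let v := cser c * xx F + cser d * yy F.
Let s := psubst u v.
Let u1 : vge 1 u := vge_lin a b.
Let v1 : vge 1 v := vge_lin c d.

Definition linsubst := psubst u v.

(** The inverse matrix is applied after substitution, and not the adjugate as in [blift], so [act]
    and [divg] acquire no Jacobian factor. *)
Definition linpull V : vec :=
  (cser (d / D) * s V.1 - cser (b / D) * s V.2,
   cser (a / D) * s V.2 - cser (c / D) * s V.1).

Lemma linsubst_inj f : s f = 0 -> f = 0.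
Proof.
move=> sf0; pose u' := cser (d / D) * xx F + cser (- b / D) * yy F.
pose v' := cser (- c / D) * xx F + cser (a / D) * yy F.
have u1' : vge 1 u' := vge_lin _ _; have v1' : vge 1 v' := vge_lin _ _.
have : psubst u' v' (s f) = 0 by rewrite sf0 psubst0.
rewrite /s psubst_comp // /u /v !psubstD !psubstM // !psubst_cst // !psubst_xx //
  !psubst_yy // /u' /v'.
have cst0 : cser (0 : F) = 0 by rewrite rmorph0.
have cst1 : cser (1 : F) = 1 by rewrite rmorph1.
have -> : cser a * (cser (d / D) * xx F + cser (- b / D) * yy F) +
   cser b * (cser (- c / D) * xx F + cser (a / D) * yy F) = xx F.
  transitivity (cser (a * (d / D) + b * (- c / D)) * xx F +
                cser (a * (- b / D) + b * (a / D)) * yy F).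
    by rewrite !rmorphD !rmorphM /=; pring.
  have -> : a * (d / D) + b * (- c / D) = 1 by rewrite /D; field; exact: D0.
  have -> : a * (- b / D) + b * (a / D) = 0 by rewrite /D; field; exact: D0.
  by rewrite cst0 cst1; ring.
have -> : cser c * (cser (d / D) * xx F + cser (- b / D) * yy F) +
   cser d * (cser (- c / D) * xx F + cser (a / D) * yy F) = yy F.
  transitivity (cser (c * (d / D) + d * (- c / D)) * xx F +
                cser (c * (- b / D) + d * (a / D)) * yy F).
    by rewrite !rmorphD !rmorphM /=; pring.
  have -> : c * (d / D) + d * (- c / D) = 0 by rewrite /D; field; exact: D0.
  have -> : c * (- b / D) + d * (a / D) = 1 by rewrite /D; field; exact: D0.
  by rewrite cst0 cst1; ring.
by rewrite psubst_id.
Qed.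

Lemma dx_linsubst f : dx (s f) = s (dx f) * cser a + s (dy f) * cser c.
Proof. by rewrite /s dx_psubst // /u /v !dE; pring. Qed.
Lemma dy_linsubst f : dy (s f) = s (dx f) * cser b + s (dy f) * cser d.
Proof. by rewrite /s dy_psubst // /u /v !dE; pring. Qed.

Let sD f g : s (f + g) = s f + s g. Proof. exact: psubstD. Qed.
Let sB f g : s (f - g) = s f - s g. Proof. exact: psubstB. Qed.
Let sM f g : s (f * g) = s f * s g. Proof. exact: psubstM. Qed.
Let adj1 : cser (d / D) * cser a - cser (c / D) * cser b = 1.
Proof.
rewrite -!rmorphM -rmorphB -(rmorph1 (@cser F)); congr (cser _).
by rewrite /D; field; exact: D0.
Qed.
Let adj2 : cser (a / D) * cser d - cser (b / D) * cser c = 1.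
Proof.
rewrite -!rmorphM -rmorphB -(rmorph1 (@cser F)); congr (cser _).
by rewrite /D; field; exact: D0.
Qed.
Let adj3 : cser (d / D) * cser c - cser (c / D) * cser d = 0.
Proof.
rewrite -!rmorphM -rmorphB -(rmorph0 (@cser F)); congr (cser _).
by rewrite /D; field; exact: D0.
Qed.
Let adj4 : cser (a / D) * cser b - cser (b / D) * cser a = 0.
Proof.
rewrite -!rmorphM -rmorphB -(rmorph0 (@cser F)); congr (cser _).
by rewrite /D; field; exact: D0.
Qed.

Lemma act_linpull V f : act (linpull V) (s f) = s (act V f).
Proof.
rewrite /act sD !sM /linpull dx_linsubst dy_linsubst /=.
move: (s V.1) (s V.2) (s (dx f)) (s (dy f)) => A B fx fy.
transitivity (A * fx * (cser (d / D) * cser a - cser (c / D) * cser b) +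
  A * fy * (cser (d / D) * cser c - cser (c / D) * cser d) +
  B * fx * (cser (a / D) * cser b - cser (b / D) * cser a) +
  B * fy * (cser (a / D) * cser d - cser (b / D) * cser c)); first by pring.
by rewrite adj1 adj2 adj3 adj4; ring.
Qed.

Lemma divg_linpull V : divg (linpull V) = s (divg V).
Proof.
rewrite /divg /linpull /= !dE !dx_linsubst !dy_linsubst sD.
move: (s V.1) (s V.2) (s (dx V.1)) (s (dy V.1)) (s (dx V.2)) (s (dy V.2)) =>
  A B Ax Ay Bx By.
transitivity (Ax * (cser (d / D) * cser a - cser (c / D) * cser b) +
  Ay * (cser (d / D) * cser c - cser (c / D) * cser d) +
  Bx * (cser (a / D) * cser b - cser (b / D) * cser a) +
  By * (cser (a / D) * cser d - cser (b / D) * cser c)); first by pring.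
by rewrite adj1 adj2 adj3 adj4; ring.
Qed.

Lemma wdg_linpull U V : wdg (linpull U) (linpull V) = cser D^-1 * s (wdg U V).
Proof.
rewrite /wdg /linpull sB !sM /=.
move: (s U.1) (s U.2) (s V.1) (s V.2) => A B A' B'.
transitivity ((cser (d / D) * cser (a / D) - cser (b / D) * cser (c / D)) *
   (A * B' - B * A')); first by pring.
congr (_ * _); rewrite -!rmorphM -rmorphB; congr (cser _).
by rewrite /D; field; exact: D0.
Qed.

Lemma ev0_linsubst f : ev0 (s f) = ev0 f. Proof. exact: ev0_psubst. Qed.

Lemma ev0_linpull1 V : ev0 (linpull V).1 = d / D * ev0 V.1 - b / D * ev0 V.2.
Proof. by rewrite rmorphB !rmorphM /= !ev0_cst !ev0_linsubst. Qed.
Lemma ev0_linpull2 V : ev0 (linpull V).2 = a / D * ev0 V.2 - c / D * ev0 V.1.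
Proof. by rewrite rmorphB !rmorphM /= !ev0_cst !ev0_linsubst. Qed.

Lemma ev0_linpull V : ev0 (linpull V).1 = 0 /\ ev0 (linpull V).2 = 0 ->
  ev0 V.1 = 0 /\ ev0 V.2 = 0.
Proof.
rewrite ev0_linpull1 ev0_linpull2; move: (ev0 V.1) (ev0 V.2) => x y [e1 e2].
split.
  have -> : x = a * (d / D * x - b / D * y) + b * (a / D * y - c / D * x).
    by rewrite /D; field; exact: D0.
  by rewrite e1 e2 !mulr0 addr0.
have -> : y = c * (d / D * x - b / D * y) + d * (a / D * y - c / D * x).
  by rewrite /D; field; exact: D0.
by rewrite e1 e2 !mulr0 addr0.
Qed.

Let jac f : ev0 (dx (s f)) = ev0 (dx f) * a + ev0 (dy f) * c /\
            ev0 (dy (s f)) = ev0 (dx f) * b + ev0 (dy f) * d.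
Proof.
by rewrite dx_linsubst dy_linsubst !rmorphD !rmorphM /= !ev0_cst !ev0_linsubst.
Qed.

Lemma jac_linpull V (x := ev0 (dx V.1)) (y := ev0 (dy V.1))
    (z := ev0 (dx V.2)) (t := ev0 (dy V.2)) :
  [/\ ev0 (dx (linpull V).1) = d / D * (x * a + y * c) - b / D * (z * a + t * c),
     ev0 (dy (linpull V).1) = d / D * (x * b + y * d) - b / D * (z * b + t * d),
     ev0 (dx (linpull V).2) = a / D * (z * a + t * c) - c / D * (x * a + y * c) &
     ev0 (dy (linpull V).2) = a / D * (z * b + t * d) - c / D * (x * b + y * d)].
Proof.
have [[e1 e2] [e3 e4]] := (jac V.1, jac V.2).
by split; rewrite /= !dE !rmorphD !rmorphN !rmorphD !rmorphM /= !ev0_cst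
  ?e1 ?e2 ?e3 ?e4 rmorph0 !mul0r !add0r.
Qed.

Lemma jac_tr_linpull V : jac_tr (linpull V) = jac_tr V.
Proof.
rewrite /jac_tr; have [-> _ _ ->] := jac_linpull V.
by rewrite /D; field; exact: D0.
Qed.
Lemma jac_det_linpull V : jac_det (linpull V) = jac_det V.
Proof.
rewrite /jac_det; have [-> -> -> ->] := jac_linpull V.
by rewrite /D; field; exact: D0.
Qed.

Lemma blowup_inv_linpull V Q : blowup_inv V Q -> blowup_inv (linpull V) (s Q).
Proof.
have ev V' : ev0 V'.1 = 0 -> ev0 V'.2 = 0 ->
    ev0 (linpull V').1 = 0 /\ ev0 (linpull V').2 = 0.
  by move=> e1 e2; rewrite ev0_linpull1 ev0_linpull2 e1 e2 !mulr0 subrr.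
case=> [[-> [z1 z2 t0 d0]]|V0|[z1 z2 q0 [p [r [p0 r0 t0 d0]]]]].
- apply: Or31; have [e1 e2] := ev _ z1 z2.
  by rewrite jac_tr_linpull jac_det_linpull /s psubst1.
- apply: Or32; have [h1|h1] := EM (ev0 (linpull V).1 = 0); last by left.
  by right=> h2; have [h3 h4] := ev0_linpull (conj h1 h2); case: V0.
- apply: Or33; have [e1 e2] := ev _ z1 z2; split=> //.
    by rewrite ev0_linsubst.
  by exists p, r; rewrite jac_tr_linpull jac_det_linpull.
Qed.

End LinearChange.

(** The columns (a, c) and (b, d) are eigenvectors for l and m, orthogonal to a row of the shifted
    matrices: the first row if its off-diagonal entry is nonzero, else the second. *)
Lemma nonresonant_diagonalize W l m : l != m -> nonresonant W l m ->
  exists a b c d : F, a * d - b * c != 0 /\ diagonal (linpull a b c d W) l m.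
Proof.
move=> lm [w1 w2]; rewrite /jac_tr /jac_det => t0 d0.
suff [a [b [c [d [D0 [E1 E2] [E3 E4]]]]]] : exists a b c d : F,
    [/\ a * d - b * c != 0,
     ev0 (dx W.1) * a + ev0 (dy W.1) * c = l * a /\
     ev0 (dx W.2) * a + ev0 (dy W.2) * c = l * c &
     ev0 (dx W.1) * b + ev0 (dy W.1) * d = m * b /\
     ev0 (dx W.2) * b + ev0 (dy W.2) * d = m * d].
  exists a, b, c, d; split=> //.
  have [j1 j2 j3 j4] := jac_linpull a b c d W.
  split; rewrite ?ev0_linpull1 ?ev0_linpull2 ?w1 ?w2 ?mulr0 ?subrr //.
    by rewrite j1 j2 E1 E2 E3 E4; split; field.
  by rewrite j3 j4 E1 E2 E3 E4; split; field.
move: t0 d0; move: (ev0 (dx W.1)) (ev0 (dy W.1)) (ev0 (dx W.2)) (ev0 (dy W.2)).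
move=> x y z t t0 d0.
have ml : m - l != 0 by rewrite subr_eq0 eq_sym.
have tE : t = l + m - x by rewrite -t0; ring.
have cl : (l - x) * (l - t) = y * z.
  have -> : y * z = x * t - l * m by (rewrite -d0; ring).
  by rewrite tE; ring.
have cm : (m - x) * (m - t) = y * z.
  have -> : y * z = x * t - l * m by (rewrite -d0; ring).
  by rewrite tE; ring.
have [y0|y0] := eqVneq y 0; last first.
  exists y, y, (l - x), (m - x); split.
  - have -> : y * (m - x) - y * (l - x) = y * (m - l) by ring.
    by rewrite mulf_neq0.
  - split; first by ring.
    have -> : z * y + t * (l - x) = y * z + t * (l - x) by ring.
    by rewrite -cl; ring.
  - split; first by ring.
    have -> : z * y + t * (m - x) = y * z + t * (m - x) by ring.
    by rewrite -cm; ring.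
have [z0|z0] := eqVneq z 0; last first.
  exists (l - t), (m - t), z, z; split.
  - have -> : (l - t) * z - (m - t) * z = z * (l - m) by ring.
    by rewrite mulf_neq0 // subr_eq0.
  - split; last by ring.
    by rewrite -cl; ring.
  - split; last by ring.
    by rewrite -cm; ring.
(* The matrix is already diagonal; its entries may come in the other order, hence the swap of
   coordinates. *)
move: d0; rewrite y0 z0 mul0r subr0 => d0.
have : (l - x) * (l - t) = 0 by rewrite cl y0 mul0r.
move/eqP; rewrite mulf_eq0 !subr_eq0 => /orP[] /eqP e.
  exists 1, 0, 0, 1; rewrite tE -e; split; [|split; ring|split; ring].
  by rewrite mulr1 mulr0 subr0 oner_eq0.
have xm : x = m by apply/eqP; rewrite -subr_eq0; apply/eqP; rewrite tE in e; move/eqP: e;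
  rewrite -subr_eq0 => /eqP <-; ring.
exists 0, 1, 1, 0; rewrite xm -e; split; [|split; ring|split; ring].
by rewrite mulr1 mulr0 sub0r oppr_eq0 oner_eq0.
Qed.

Lemma irrational_neq (l m : F) : l != 0 -> (forall q : rat, m / l != ratr q) -> l != m.
Proof.
move=> l0 irr; apply/eqP => lm; have /eqP[] := irr 1.
by rewrite -lm divff // rmorph1.
Qed.

(** The relation is linear in P = W /\ V, so the constant that [linpull] puts on P is harmless. *)
Lemma nonresonant_contra W V Q l m :
  l != 0 -> m != 0 -> (forall q : rat, m / l != ratr q) ->
  nonresonant W l m -> wdg W V <> 0 -> Q <> 0 ->
  Q * act W (wdg W V) - wdg W V * act W Q = divg W * (wdg W V * Q) ->
  ~ blowup_inv V Q.
Proof.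
move=> l0 m0 irr Wn P0 Q0 E inv.
have [a [b [c [d [D0 Wd]]]]] :=
  nonresonant_diagonalize (irrational_neq l0 irr) Wn.
have cD0 : cser (a * d - b * c)^-1 <> 0 :> S.
  by move=> /(congr1 (@ev0 F)) /eqP; rewrite ev0_cst rmorph0 invr_eq0 (negPf D0).
have sN f : f <> 0 -> linsubst a b c d f <> 0 by move=> f0 /(linsubst_inj D0).
have sM f g : linsubst a b c d (f * g) = linsubst a b c d f * linsubst a b c d g.
  by apply: psubstM; exact: vge_lin.
apply: (diagonal_contra l0 m0 irr Wd (V := linpull a b c d V) (Q := linsubst a b c d Q)).
- by rewrite wdg_linpull //; apply: pser2_mul_neq0 => //; exact: sN.
- exact: sN.
- rewrite wdg_linpull // divg_linpull // act_linpull //.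
  have actc f e : act (linpull a b c d W) (cser e * f) = cser e * act (linpull a b c d W) f.
    by rewrite /act !dE; pring.
  rewrite actc act_linpull //.
  have := congr1 (linsubst a b c d) E.
  rewrite {1}/linsubst psubstB -!/(linsubst _ _ _ _ _) !sM => E'.
  set A := linsubst a b c d Q; set A' := linsubst a b c d (act W Q).
  set B := linsubst a b c d (wdg W V); set B' := linsubst a b c d (act W (wdg W V)).
  rewrite -/A -/A' -/B -/B' in E'; move: (cser _) => e.
  transitivity (e * (A * B' - B * A')); first by ring.
  by rewrite E'; ring.
- exact: blowup_inv_linpull.
Qed.

Lemma nonresonant_first_integral W P Q l m :
  l != 0 -> m != 0 -> (forall q : rat, m / l != ratr q) ->
  nonresonant W l m -> Q <> 0 -> Q * act W P = P * act W Q ->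
  exists c, P = cser c * Q.
Proof.
move=> l0 m0 irr Wn Q0 E.
have [a [b [c [d [D0 Wd]]]]] :=
  nonresonant_diagonalize (irrational_neq l0 irr) Wn.
have sM f g : linsubst a b c d (f * g) = linsubst a b c d f * linsubst a b c d g.
  by apply: psubstM; exact: vge_lin.
have Q0' : linsubst a b c d Q <> 0 by move=> /(linsubst_inj D0).
have [|e eE] := diagonal_first_integral l0 m0 irr Wd (P := linsubst a b c d P) Q0'.
  by rewrite !act_linpull // -!sM E.
exists e; apply/subr0_eq/(linsubst_inj D0).
rewrite psubstB -!/(linsubst _ _ _ _ _) sM eE.
have -> : linsubst a b c d (cser e) = cser e by apply: psubst_cst; exact: vge_lin.
by rewrite subrr.
Qed.

End Resonance.

(** * The formal centralizer *)

Section FormalCentralizer.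
Variable F : numFieldType.
Notation S := (pser2 F).
Notation vec := (S * S)%type.
Notation pb := (@pb F).
Implicit Types (f g P Q : S) (X Y V W : vec) (d : option F) (w : seq (option F)).

Lemma pb_neq0 d f : f <> 0 -> pb d f <> 0.
Proof. by move=> f0 /pb_inj. Qed.

(** A pulled-back series is constant along the exceptional divisor, so its derivative in that
    direction vanishes. *)
Lemma ev0_dx_pb_None f : ev0 (dx (pb None f)) = 0.
Proof. by rewrite dx_pb /= !dE !(mulr0, addr0, mul1r) rmorphM /= ev0_yy mulr0. Qed.
Lemma ev0_dy_pb_Some c f : ev0 (dy (pb (Some c) f)) = 0.
Proof. by rewrite dy_pb /= !dE !(mul0r, mulr0, addr0, add0r, mulr1) rmorphM /= ev0_xx mulr0. Qed.

Definition evE := (ev0_xx, ev0_yy, @ev0_cst F, @ev0_pb F, ev0_dx_pb_None, ev0_dy_pb_Some).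
Ltac evsimp := rewrite /= ?(dE, rmorphD, rmorphN, rmorphM, rmorph0, rmorph1, evE) /= ?evE.

(** If the lift vanishes, V is tangent to the chosen direction. The lift is then a saddle with
    eigenvalues p and - p, its divergence being divisible by [exc d]; the same factor gives Q(0) =
    0. *)
Lemma blowup_inv_regular d V Q : ev0 V.1 <> 0 \/ ev0 V.2 <> 0 ->
  blowup_inv (blift d V) (exc d * pb d Q).
Proof.
move=> V0.
have [h1|h1] := EM (ev0 (blift d V).1 = 0); last by apply: Or32; left.
have [h2|h2] := EM (ev0 (blift d V).2 = 0); last by apply: Or32; right.
apply: Or33; split=> //; first by rewrite rmorphM /= ev0_exc mul0r.
exists (ev0 (if d is Some _ then V.1 else V.2)), 1; rewrite rmorph1 !mul1r subrr.
split=> //.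
- apply/eqP; move: h1 h2 V0; case: d => [c|] /=; rewrite !rmorphD !rmorphN !rmorphM /= ?rmorphD /= !evE => h1 h2 V0 v0.
    by case: V0 => //; move: h2; rewrite v0 mulr0 subr0.
  by case: V0 => //; move: h1; rewrite v0 mulr0 subr0.
- by rewrite /jac_tr -rmorphD -/(divg _) divg_lift rmorphM /= ev0_exc mul0r.
- rewrite /jac_det; case: d {h1 h2} => [c|]; evsimp; ring.
Qed.

(** V' stands for the lift of V divided by the equation of the divisor. It vanishes at 0 only if the
    chosen direction is an eigenvector; if p is its eigenvalue and p' the other one, V' has
    eigenvalues p and p' - p. Thus (0, 0) stays (0, 0), and a ratio - r becomes - (r + 1) or - (r +
    1) / r. *)
Lemma blowup_inv_child V V' Q Q' (p : F) :
  ev0 V.1 = 0 -> ev0 V.2 = 0 -> blowup_inv V Q ->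
  (Q = 1 -> Q' = 1) -> (ev0 Q = 0 -> ev0 Q' = 0) ->
  (ev0 V'.1 = 0 -> ev0 V'.2 = 0 -> [/\ p * p - jac_tr V * p + jac_det V = 0,
     jac_tr V' = jac_tr V - p & jac_det V' = p * (jac_tr V - p *+ 2)]) ->
  blowup_inv V' Q'.
Proof.
move=> v1 v2 inv Q1 Q0 H.
have [h1|h1] := EM (ev0 V'.1 = 0); last by apply: Or32; left.
have [h2|h2] := EM (ev0 V'.2 = 0); last by apply: Or32; right.
have [pp t' d'] := H h1 h2.
case: inv => [[/Q1 Q1' [_ _ t0 d0]]|[]//|[_ _ /Q0 Q0' [p0 [r [p00 r0 t0 d0]]]]].
  apply: Or31; split=> //; move: pp; rewrite t0 d0 mul0r subr0 addr0 => /eqP.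
  rewrite mulf_eq0 orbb => /eqP p0.
  by split; rewrite ?t' ?d' ?t0 ?p0 ?mul0r ?subr0.
apply: Or33; split=> //.
have : (p - p0) * (p + ratr r * p0) = 0.
  by rewrite -pp t0 d0; ring.
move/eqP; rewrite mulf_eq0 subr_eq0 addr_eq0 => /orP[] /eqP E.
  exists p0, (r + 1); split=> //; first by rewrite addr_gt0.
    by rewrite t' t0 E rmorphD rmorph1 /=; ring.
  by rewrite d' t0 E rmorphD rmorph1 /=; ring.
have rF : ratr r != 0 :> F by rewrite fmorph_eq0 gt_eqF.
have rne : r != 0 by rewrite gt_eqF.
have E2 : (ratr ((1 + r) / r) : F) = (1 + ratr r) / ratr r.
  by rewrite fmorph_div rmorphD rmorph1.
exists p, ((1 + r) / r); split=> //.
- by rewrite E oppr_eq0 mulf_neq0.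
- by rewrite divr_gt0 // addr_gt0.
- by rewrite t' t0 E2 E; field.
- by rewrite d' t0 E2 E; field.
Qed.

(** A regular V is lifted as it is, at the price of a factor [exc d] on Q. A singular V has a lift
    divisible by [exc d]; dividing by it leaves Q without new factor, so Q = 1 persists in the
    nilpotent case. *)
Lemma blowup_step d X V f Q : Q <> 0 -> Q * f = wdg X V -> blowup_inv V Q ->
  exists V' Q', [/\ Q' <> 0, Q' * pb d f = wdg (blift d X) V' & blowup_inv V' Q'].
Proof.
move=> Q0 E inv.
have [V0|V0] := EM (ev0 V.1 <> 0 \/ ev0 V.2 <> 0).
  exists (blift d V), (exc d * pb d Q); split; last exact: blowup_inv_regular.
    by apply: pser2_mul_neq0; [exact: exc_neq0|exact: pb_neq0].
  by rewrite wdg_lift -E pbM mulrA.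
have [/contrapT v1 /contrapT v2] := (not_orP _ _).1 V0.
have [g1 [h1 [V1 _ _]]] := vge_split ((vge1P _).2 v1).
have [g2 [h2 [V2 _ _]]] := vge_split ((vge1P _).2 v2).
have e1 : ev0 (dx V.1) = ev0 g1 by rewrite V1; evsimp; ring.
have e2 : ev0 (dy V.1) = ev0 h1 by rewrite V1; evsimp; ring.
have e3 : ev0 (dx V.2) = ev0 g2 by rewrite V2; evsimp; ring.
have e4 : ev0 (dy V.2) = ev0 h2 by rewrite V2; evsimp; ring.
case: d => [c|].
  (* [G g h] is the pullback of x g + y h divided by x. *)
  pose G g h : S := pb (Some c) g + (yy F + cser c) * pb (Some c) h.
  have pbV1 : pb (Some c) V.1 = xx F * G g1 h1.
    by rewrite V1 pbD !pbM pb_xx pb_yy /= /G; ring.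
  have pbV2 : pb (Some c) V.2 = xx F * G g2 h2.
    by rewrite V2 pbD !pbM pb_xx pb_yy /= /G; ring.
  have evG g h : ev0 (G g h) = ev0 g + c * ev0 h by rewrite /G; evsimp; ring.
  have evGy g h : ev0 (dy (G g h)) = ev0 h by rewrite /G; evsimp; ring.
  move: G pbV1 pbV2 evG evGy => G pbV1 pbV2 evG evGy.
  pose V' := (xx F * G g1 h1, G g2 h2 - (yy F + cser c) * G g1 h1).
  exists V', (pb (Some c) Q); split.
  - exact: pb_neq0.
  - rewrite -pbM E; apply: (pser2_mulfI (@exc_neq0 F (Some c))).
    by rewrite -wdg_lift /wdg /V' /= pbV1 pbV2; ring.
  - apply: (blowup_inv_child (p := ev0 g1 + c * ev0 h1) v1 v2 inv).
    + by move=> ->; rewrite pb1.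
    + by move=> q0; rewrite ev0_pb.
    rewrite /V' /jac_tr /jac_det e1 e2 e3 e4; evsimp; rewrite !evG !evGy => _ H.
    (* Vanishing of the second component says that (1, c) is an eigenvector of DV(0), with
       eigenvalue p. *)
    have g2E : ev0 g2 = c * (ev0 g1 + c * ev0 h1) - c * ev0 h2.
      apply/eqP; rewrite -subr_eq0; apply/eqP; rewrite -H; ring.
    by split; rewrite ?g2E; ring.
pose G g h : S := xx F * pb None g + pb None h.
have pbV1 : pb None V.1 = yy F * G g1 h1.
  by rewrite V1 pbD !pbM pb_xx pb_yy /= /G; ring.
have pbV2 : pb None V.2 = yy F * G g2 h2.
  by rewrite V2 pbD !pbM pb_xx pb_yy /= /G; ring.
have evG g h : ev0 (G g h) = ev0 h by rewrite /G; evsimp; ring.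
have evGx g h : ev0 (dx (G g h)) = ev0 g by rewrite /G; evsimp; ring.
move: G pbV1 pbV2 evG evGx => G pbV1 pbV2 evG evGx.
pose V' := (G g1 h1 - xx F * G g2 h2, yy F * G g2 h2).
exists V', (pb None Q); split.
- exact: pb_neq0.
- rewrite -pbM E; apply: (pser2_mulfI (@exc_neq0 F None)).
  by rewrite -wdg_lift /wdg /V' /= pbV1 pbV2; ring.
- apply: (blowup_inv_child (p := ev0 h2) v1 v2 inv).
  + by move=> ->; rewrite pb1.
  + by move=> q0; rewrite ev0_pb.
  rewrite /V' /jac_tr /jac_det e1 e2 e3 e4; evsimp; rewrite !evG !evGx => H _.
  have h1E : ev0 h1 = 0 by rewrite -H; ring.
  by split; rewrite ?h1E; ring.
Qed.

(** This is the Lie derivative along X of the area form evaluated at X and Y: the flow of X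
    preserves both fields and scales the form by div X. *)
Lemma act_wdg X Y : act X Y.1 = act Y X.1 -> act X Y.2 = act Y X.2 ->
  act X (wdg X Y) = divg X * wdg X Y.
Proof.
move=> c1 c2.
have -> : act X (wdg X Y) = act X X.1 * Y.2 + X.1 * act X Y.2 -
    act X X.2 * Y.1 - X.2 * act X Y.1.
  by rewrite /wdg /act !dE; pring.
by rewrite c1 c2 /act /divg /wdg; pring.
Qed.

(** Proportionality over the fraction field: cross-multiply by a nonzero component of X. *)
Lemma parallel_scalars W X : vneq0 X -> vneq0 W -> wdg W X = 0 ->
  exists A C, [/\ A <> 0, C <> 0, A * W.1 = C * X.1 & A * W.2 = C * X.2].
Proof.
move=> X0 W0 /subr0_eq WX.
have neq A C : A * W.1 = C * X.1 -> A * W.2 = C * X.2 -> A <> 0 -> C <> 0.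
  move=> E1 E2 A0 C0; case: W0 => -[]; apply: (pser2_mulfI A0).
    by rewrite E1 C0 mul0r mulr0.
  by rewrite E2 C0 mul0r mulr0.
case: X0 => X0.
  have E2 : X.1 * W.2 = W.1 * X.2 by rewrite WX mulrC.
  exists X.1, W.1; split=> //; last by rewrite mulrC.
  by apply: (neq X.1) => //; rewrite mulrC.
have E1 : X.2 * W.1 = W.2 * X.1 by rewrite -WX mulrC.
exists X.2, W.2; split=> //; last by rewrite mulrC.
by apply: (neq X.2) => //; rewrite mulrC.
Qed.

Lemma act_parallel A C W X f : A * W.1 = C * X.1 -> A * W.2 = C * X.2 ->
  A * act W f = C * act X f.
Proof. by move=> E1 E2; rewrite /act mulrDr !mulrA E1 E2; ring. Qed.

Lemma divg_parallel A C W X : A * W.1 = C * X.1 -> A * W.2 = C * X.2 ->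
  A * divg W = C * divg X + act X C - act W A.
Proof.
move=> E1 E2; have := congr1 (@dx F) E1; have := congr1 (@dy F) E2.
rewrite !dE /divg /act => e2 e1.
have -> : A * (dx W.1 + dy W.2) =
  (dx A * W.1 + A * dx W.1) + (dy A * W.2 + A * dy W.2) - (dx A * W.1 + dy A * W.2) by pring.
by rewrite e1 e2; pring.
Qed.

Section NonResonantPoint.
Variables (W : vec) (l m : F).
Hypotheses (l0 : l != 0) (m0 : m != 0) (irr : forall q : rat, m / l != ratr q).
Hypothesis Wn : nonresonant W l m.

Lemma nonresonant_neq0 : vneq0 W.
Proof.
apply: contrapT => H; have [/contrapT w1 /contrapT w2] := (not_orP _ _).1 H.
case: Wn => _ _ _; rewrite /jac_det w1 w2 !raddf0 !mulr0 subrr => /esym/eqP.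
by rewrite mulf_eq0 (negPf l0) (negPf m0).
Qed.

(* P = W /\ V satisfies W(P) Q - W(Q) P = div(W) P Q: the leading exponents of P and
   Q differ by (1, 1) in coordinates that diagonalize W, which the possible linear
   parts of V exclude. *)
Lemma integrating_factor_contra X V f Q : vneq0 X -> wdg W X = 0 -> f <> 0 ->
  act X f = divg X * f -> Q <> 0 -> Q * f = wdg X V -> ~ blowup_inv V Q.
Proof.
move=> X0 WX f0 Xf Q0 Qf.
have [A [C [A0 C0 E1 E2]]] := parallel_scalars X0 nonresonant_neq0 WX.
have AP : A * wdg W V = C * (Q * f).
  by rewrite Qf /wdg mulrBr !mulrA E1 E2; ring.
have P0 : wdg W V <> 0.
  move=> P0; move: AP; rewrite P0 mulr0 => /esym/pser2_mul_eq0[//|].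
  by case/pser2_mul_eq0.
apply: (nonresonant_contra l0 m0 irr Wn P0 Q0).
move: (wdg W V) AP {P0} => P AP.
have aM U g h : act U (g * h) = act U g * h + g * act U h.
  by rewrite /act !dE; pring.
have := congr1 (act W) AP; rewrite !aM => dAP.
have eX g : A * act W g = C * act X g := act_parallel g E1 E2.
have eD := divg_parallel E1 E2.
have eC : C * act X C = A * act W C by rewrite eX.
have eF : A * act W f = C * (divg X * f) by rewrite eX Xf.
(* P is C Q f / A and W is C X / A; a factor A^2 clears the denominators. The identity below then
   exhibits the difference as a combination of the collected relations. *)
apply: (pser2_mulfI A0); apply: (pser2_mulfI A0).
move: (act W A) (act W P) (act W C) (act W Q) (act W f) (act X C) (divg X) (divg W)
  dAP eD eC eF => WA WP WC WQ Wf XC dX dW dAP eD eC eF.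
apply/eqP; rewrite -subr_eq0; apply/eqP.
have -> : A * (A * (Q * WP - P * WQ)) - A * (A * (dW * (P * Q))) =
  A * Q * ((WA * P + A * WP) - (WC * (Q * f) + C * (WQ * f + Q * Wf)))
  - A * WQ * (A * P - C * (Q * f))
  - (A * P * Q) * (A * dW - (C * dX + XC - WA))
  - Q * Q * f * (C * XC - A * WC)
  + C * Q * Q * (A * Wf - C * (dX * f))
  - (A * P - C * (Q * f)) * Q * (C * dX + XC) by ring.
by rewrite dAP AP eD eC eF !subrr; ring.
Qed.

Lemma first_integral_const X P Q : vneq0 X -> wdg W X = 0 -> Q <> 0 ->
  Q * act X P = P * act X Q -> exists c, P = cser c * Q.
Proof.
move=> X0 WX Q0 E.
have [A [C [A0 C0 E1 E2]]] := parallel_scalars X0 nonresonant_neq0 WX.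
apply: (nonresonant_first_integral l0 m0 irr Wn Q0).
apply: (pser2_mulfI A0).
by rewrite mulrCA (act_parallel _ E1 E2) mulrCA E [RHS]mulrCA (act_parallel _ E1 E2); ring.
Qed.

(** Each letter of the word transforms X, f, V and Q together and preserves all hypotheses; the
    contradiction comes at the end of the word. *)
Lemma formal_contra w X V f Q : vneq0 X -> wdg W (bliftw w X) = 0 -> f <> 0 ->
  act X f = divg X * f -> Q <> 0 -> Q * f = wdg X V -> ~ blowup_inv V Q.
Proof.
elim: w X V f Q => [|d w IH] X V f Q X0 /= WX f0 Xf Q0 Qf inv.
  exact: (integrating_factor_contra X0 WX f0 Xf Q0 Qf).
have [V' [Q' [Q0' E inv']]] := blowup_step d Q0 Qf inv.
have Xf' : act (blift d X) (pb d f) = divg (blift d X) * pb d f.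
  by rewrite act_lift divg_lift Xf pbM mulrA.
exact: IH (lift_neq0 d X0) WX (pb_neq0 (d := d) f0) Xf' Q0' E inv'.
Qed.

(** The constant is found at the end of the word and descends because pullback is injective. *)
Lemma formal_first_integral w X P Q : vneq0 X -> wdg W (bliftw w X) = 0 ->
  Q <> 0 -> Q * act X P = P * act X Q -> exists c, P = cser c * Q.
Proof.
elim: w X P Q => [|d w IH] X P Q X0 /= WX Q0 E.
  exact: (first_integral_const X0 WX Q0).
have [|c Ec] := IH _ (pb d P) _ (lift_neq0 d X0) WX (pb_neq0 (d := d) Q0).
  by rewrite !act_lift mulrCA -pbM E pbM; ring.
exists c; apply/subr0_eq/(@pb_inj _ d).
by rewrite pbB pbM pb_cst Ec subrr.
Qed.

(** If Y = h X, then X(Y.1) = Y(X.1) = h X(X.1), so Y.1 / X.1 is a first integral, and likewise for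
    the second components. *)
Lemma formal_parallel w X Y : vneq0 X -> wdg W (bliftw w X) = 0 ->
  act X Y.1 = act Y X.1 -> act X Y.2 = act Y X.2 -> wdg X Y = 0 ->
  exists c, Y.1 = cser c * X.1 /\ Y.2 = cser c * X.2.
Proof.
move=> X0 WX c1 c2 /subr0_eq XY; case: (X0) => Xk.
  have [|c E] := formal_first_integral (P := Y.1) X0 WX Xk.
    by rewrite c1 /act !mulrDr !mulrA XY; ring.
  exists c; split=> //; apply: (pser2_mulfI Xk); rewrite XY E; ring.
have [|c E] := formal_first_integral (P := Y.2) X0 WX Xk.
  by rewrite c2 /act !mulrDr !mulrA -XY; ring.
exists c; split=> //; apply: (pser2_mulfI Xk); rewrite -XY E; ring.
Qed.

Theorem formal_centralizer w X Y : vneq0 X -> wdg W (bliftw w X) = 0 ->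
  act X Y.1 = act Y X.1 -> act X Y.2 = act Y X.2 -> blowup_inv Y 1 ->
  exists c, Y.1 = cser c * X.1 /\ Y.2 = cser c * X.2.
Proof.
move=> X0 WX c1 c2 inv.
have [f0|f0] := EM (wdg X Y = 0); first exact: formal_parallel WX _ _ _.
have n10 : (1 : S) <> 0 by apply/eqP; rewrite oner_eq0.
(* The induction on the word starts from V = Y, Q = 1 and f = X /\ Y. *)
have := formal_contra (V := Y) (Q := 1) X0 WX f0 (act_wdg c1 c2) n10 (mul1r _).
by move/(_ inv).
Qed.

End NonResonantPoint.
End FormalCentralizer.

(** * Double series *)

Section FiniteSums.
Variable K : numFieldType.
Implicit Types (a : nat -> nat -> K) (x y r M t : K).

Lemma sum_half N : \sum_(i < N) (2^-1 : K) ^+ i <= 2.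
Proof.
suff -> : \sum_(i < N) (2^-1 : K) ^+ i = 2 - 2 * 2^-1 ^+ N.
  by rewrite lerBlDr lerDl mulr_ge0 // exprn_ge0 // invr_ge0.
elim: N => [|N IH]; first by rewrite big_ord0 expr0 mulr1 subrr.
rewrite big_ord_recr /= IH exprS; set z := _ ^+ N.
by have : (2 : K) != 0 by []; move=> ?; field.
Qed.

Lemma sum2_half A B : \sum_(i < A) \sum_(j < B) (2^-1 : K) ^+ (i + j) <= 4.
Proof.
under eq_bigr do under eq_bigr do rewrite exprD.
under eq_bigr do rewrite -mulr_sumr.
rewrite -mulr_suml; have -> : (4 : K) = 2 * 2 by rewrite -natrM.
by apply: ler_pM; rewrite ?sum_half // sumr_ge0 // => i _; rewrite exprn_ge0 // invr_ge0.
Qed.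

(** The order of the field is partial, so half the harmonic mean replaces a minimum. *)
Lemma common_lower x y : 0 < x -> 0 < y -> exists z, [/\ 0 < z, z <= x & z <= y].
Proof.
move=> x0 y0; have xy0 : 0 < x + y by rewrite addr_gt0.
exists (x * y / (x + y)); split; first by rewrite divr_gt0 // mulr_gt0.
  by rewrite ler_pdivrMr // ler_pM2l // lerDr ltW.
by rewrite ler_pdivrMr // mulrC ler_pM2l // lerDl ltW.
Qed.

(** Rectangles and not only squares, because a partial derivative shortens one of the two ranges. *)
Definition rect A B a x y := \sum_(i < A) \sum_(j < B) a i j * x ^+ i * y ^+ j.

Lemma rect_bound A B (P : nat -> nat -> bool) a x y D :
  (forall i j, ~~ P i j -> `|a i j * x ^+ i * y ^+ j| <= D * 2^-1 ^+ (i + j)) ->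
  0 <= D ->
  `|\sum_(i < A) \sum_(j < B) if P i j then 0 else a i j * x ^+ i * y ^+ j|
     <= 4 * D.
Proof.
move=> H D0; apply: le_trans (ler_norm_sum _ _ _) _.
apply: (@le_trans _ _ (\sum_(i < A) \sum_(j < B) D * 2^-1 ^+ (i + j))).
  apply: ler_sum => i _; apply: le_trans (ler_norm_sum _ _ _) _.
  apply: ler_sum => j _; case: ifPn => [_|/H//].
  by rewrite normr0 mulr_ge0 // exprn_ge0 // invr_ge0.
under eq_bigr do rewrite -mulr_sumr.
by rewrite -mulr_sumr mulrC ler_wpM2r // sum2_half.
Qed.

Lemma rect_diff N A B a x y : (N <= A)%N -> (N <= B)%N ->
  rect A B a x y - rect N N a x y =
  \sum_(i < A) \sum_(j < B)
     if (i < N)%N && (j < N)%N then 0 else a i j * x ^+ i * y ^+ j.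
Proof.
move=> NA NB.
have -> : rect N N a x y = \sum_(i < A) \sum_(j < B)
    if (i < N)%N && (j < N)%N then a i j * x ^+ i * y ^+ j else 0.
  rewrite /rect (big_ord_widen _ (fun i => \sum_(j < N) a i j * x ^+ i * y ^+ j) NA).
  rewrite big_mkcond; apply: eq_bigr => i _ /=.
  rewrite (big_ord_widen _ (fun j => a i j * x ^+ i * y ^+ j) NB) big_mkcond /=.
  by case: ifP => // _; rewrite big1.
rewrite -sumrB; apply: eq_bigr => i _; rewrite -sumrB; apply: eq_bigr => j _.
by case: ifP => _; rewrite ?subrr ?subr0.
Qed.

Section Tail.
Variables (a : nat -> nat -> K) (r M : K).
Hypotheses (r0 : 0 < r) (aM : forall i j, `|a i j| * r ^+ (i + j) <= M).

Lemma term_bound x y t i j : `|x| <= t -> `|y| <= t ->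
  `|a i j * x ^+ i * y ^+ j| <= M * (t / r) ^+ (i + j).
Proof.
move=> xt yt; have t0 : 0 <= t by apply: le_trans xt.
rewrite !normrM !normrX expr_div_n.
apply: (@le_trans _ _ (`|a i j| * t ^+ (i + j))).
  by rewrite exprD mulrA ler_pM ?mulr_ge0 ?exprn_ge0 // ?ler_wpM2l // lerXn2r // nnegrE.
rewrite mulrCA mulrC ler_wpM2l ?exprn_ge0 // ler_pdivlMr ?exprn_gt0 //.
Qed.

(** Split t / r as (2 t / r) / 2. The first factor gives the N-th power, as i or j is at least N
    outside the square; the second makes the double sum at most 4. *)
Lemma rect_tail x y t N A B : `|x| <= t -> `|y| <= t -> t * 2 <= r ->
  (N <= A)%N -> (N <= B)%N ->
  `|rect A B a x y - rect N N a x y| <= 4 * (M * (t * 2 / r) ^+ N).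
Proof.
move=> xt yt tr NA NB; have t0 : 0 <= t by apply: le_trans xt.
have M0 : 0 <= M by apply: le_trans (aM 0 0); rewrite mulr1.
have q0 : 0 <= t * 2 / r by rewrite divr_ge0 ?mulr_ge0 // ltW.
have q1 : t * 2 / r <= 1 by rewrite ler_pdivrMr // mul1r.
rewrite rect_diff //; apply: (@rect_bound A B (fun i j => (i < N)%N && (j < N)%N)); last first.
  by rewrite mulr_ge0 // exprn_ge0.
move=> i j /nandP ij; apply: le_trans (term_bound _ _ xt yt) _.
have -> : t / r = (t * 2 / r) * 2^-1 by field; rewrite lt0r_neq0.
rewrite exprMn mulrA ler_wpM2r ?exprn_ge0 ?invr_ge0 // ler_wpM2l //.
by apply: ler_wiXn2l => //; case: ij; lia.
Qed.
End Tail.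

Definition cauchy_bound (f : pser2 K) r M := forall i j, `|f i j| * r ^+ (i + j) <= M.

Lemma cauchy_bound_ge0 f r M : cauchy_bound f r M -> 0 <= M.
Proof. by move=> fM; apply: le_trans (fM 0%N 0%N); rewrite mulr1. Qed.

Lemma cauchy_bound_le f r s M : 0 <= s -> s <= r ->
  cauchy_bound f r M -> cauchy_bound f s M.
Proof.
move=> s0 sr fM i j; apply: le_trans (fM i j); rewrite ler_wpM2l //.
by apply: lerXn2r; rewrite ?nnegrE // (le_trans s0).
Qed.

End FiniteSums.

Local Open Scope classical_set_scope.
Local Open Scope ring_scope.
Local Open Scope complex_scope.

(** * Convergence of complex sequences *)

Section Convergence.
Variable R : realType.
Local Notation C := (R[i]^o).
Implicit Types (u : nat -> C) (l c : C).

Lemma cvg_norm_le u l c (B : C) N : u @ \oo --> l ->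
  (forall n, (N <= n)%N -> `|u n - c| <= B) -> `|l - c| <= B.
Proof.
move=> ul uB; apply/ler_addgt0Pr => e e0.
have /cvgrPdist_lt/(_ e e0)[n _ nl] := ul.
have {}nl := nl (maxn n N) (leq_maxl _ _).
have := uB (maxn n N) (leq_maxr _ _) => uBn.
rewrite -[l - c](subrKA (u (maxn n N))) addrC.
apply: le_trans (ler_normD _ _) _; apply: lerD => //; exact: ltW.
Qed.

Lemma half_small (e : R) : 0 < e -> exists n, 2^-1 ^+ n < e.
Proof.
move=> e0; have : (fun n => (2^-1 : R) ^+ n) @ \oo --> (0 : R).
  by apply: cvg_expr; rewrite ger0_norm ?invr_ge0 // invf_lt1 // ltr1n.
by move/cvgrPdist_lt/(_ e e0) => [n _ /(_ n (leqnn _))]; rewrite /= sub0r normrN ger0_norm ?exprn_ge0 ?invr_ge0 //; exists n.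
Qed.

Lemma real_half_cvg (v : nat -> R) (b : R) :
  (forall n m, (n <= m)%N -> `|v m - v n| <= b * 2^-1 ^+ n) -> cvgn v.
Proof.
move=> vb; have b0 : 0 <= b by have := vb 0%N 0%N (leqnn _); rewrite subrr normr0 mulr1.
apply/cauchy_cvgP/cauchy_exP => e e0.
have [n ne] := @half_small (e / (b + 1)) (divr_gt0 e0 (ltr_wpDl b0 ltr01)).
exists (v n); exists n => // m /= nm; rewrite /ball /= distrC.
apply: le_lt_trans (vb _ _ nm) _.
rewrite ltr_pdivlMr ?ltr_wpDl // in ne; apply: le_lt_trans ne.
by rewrite mulrC ler_wpM2l ?exprn_ge0 ?invr_ge0 // lerDl.
Qed.

Lemma normr_real_complex (x : R) : `|(x%:C : R[i])| = `|x|%:C.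
Proof. by rewrite normc_def /= expr0n addr0 sqrtr_sqr. Qed.

Lemma normc_ge_Im (z : R[i]) : `|complex.Im z|%:C <= `|z|.
Proof.
by rewrite normc_def lecR -sqrtr_sqr ler_wsqrtr // lerDr sqr_ge0.
Qed.

Lemma normc_le_ReIm (z : R[i]) : `|z| <= (`|complex.Re z| + `|complex.Im z|)%:C.
Proof.
rewrite [in leLHS](complexE z) rmorphD /=; apply: le_trans (ler_normD _ _) _.
rewrite normrM !normr_real_complex; apply: lerD => //.
by rewrite normc_def /= expr0n expr1n add0r sqrtr1 mul1r.
Qed.

(** Completeness is applied to the real and imaginary parts separately. *)
Lemma half_cvg u (B : C) :
  (forall n m, (n <= m)%N -> `|u m - u n| <= B * 2^-1 ^+ n) ->
  exists l, u @ \oo --> l.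
Proof.
move=> uB; pose b := complex.Re (B : R[i]).
have B0 : 0 <= B by have := uB 0%N 0%N (leqnn _); rewrite subrr normr0 mulr1.
have Bb : B = b%:C by rewrite RRe_real // ger0_real.
have hE n : (2^-1 : C) ^+ n = (2^-1 ^+ n)%:C by rewrite rmorphXn /= fmorphV rmorph_nat.
have reB (z : C) (n : nat) : `|z| <= B * 2^-1 ^+ n -> `|complex.Re (z : R[i])| <= b * 2^-1 ^+ n.
  by rewrite -lecR rmorphM /= -hE -Bb; apply: le_trans; exact: normc_ge_Re.
have imB (z : C) (n : nat) : `|z| <= B * 2^-1 ^+ n -> `|complex.Im (z : R[i])| <= b * 2^-1 ^+ n.
  by rewrite -lecR rmorphM /= -hE -Bb; apply: le_trans; exact: normc_ge_Im.
have /cvg_ex[x ux] : cvgn (fun n => complex.Re (u n : R[i])).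
  by apply: (@real_half_cvg _ b) => n m nm; rewrite -raddfB; apply/reB/uB.
have /cvg_ex[y uy] : cvgn (fun n => complex.Im (u n : R[i])).
  by apply: (@real_half_cvg _ b) => n m nm; rewrite -raddfB; apply/imB/uB.
exists (x +i* y); apply/cvgrPdist_lt => e e0.
have eE : e = (complex.Re (e : R[i]))%:C by rewrite RRe_real // gtr0_real.
have re0 : 0 < complex.Re (e : R[i]) by rewrite -ltcR -eE.
move/cvgrPdist_lt/(_ _ (divr_gt0 re0 (ltr0n _ 2))) : ux => [n1 _ h1].
move/cvgrPdist_lt/(_ _ (divr_gt0 re0 (ltr0n _ 2))) : uy => [n2 _ h2].
exists (maxn n1 n2) => // n /=; rewrite geq_max => /andP[nn1 nn2].
apply: le_lt_trans (normc_le_ReIm _) _.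
rewrite eE ltcR [ltRHS]splitr !raddfB /=.
by apply: ltrD; [exact: h1|exact: h2].
Qed.
End Convergence.

(** * Asymptotic expansions *)

Section Expansions.
Variable R : realType.
Local Notation C := (R[i]^o).
Local Notation P := ('rV[R[i]^o]_2).
Implicit Types (f g : P -> C) (p : P) (N M : nat) (a b u v : pser2 C) (B c : C).

Lemma norm_coord p k : `|p 0 k| <= `|p|.
Proof.
have H := le_bigmax 0%:nng (fun i : 'I_1 * 'I_2 => `|p i.1 i.2|%:nng) (0, k).
exact: H.
Qed.

Lemma ord2P (k : 'I_2) : k = 0 \/ k = 1.
Proof.
by case: k => -[|[|k]] // H; [left|right]; apply: val_inj.
Qed.

Lemma norm_plane_le p B : 0 <= B -> `|p 0 0| <= B -> `|p 0 1| <= B -> `|p| <= B.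
Proof.
move=> B0 p0 p1; have [->//|] := eqVneq `|p| 0.
move=> /mx_norm_neq0[[i j]] /= E; rewrite [leLHS]E ord1.
by case: (ord2P j) => ->.
Qed.

(** The Landau class O(|p|^N) at 0. *)
Definition bO N f :=
  exists2 B : C, 0 <= B & \forall p \near (0 : P), `|f p| <= B * `|p| ^+ N.

Lemma bO_eq N f g : (\forall p \near (0 : P), f p = g p) -> bO N f -> bO N g.
Proof.
move=> fg [B B0 fB]; exists B => //; near=> p.
by have <- : f p = g p; near: p.
Unshelve. all: by end_near. Qed.

Lemma bO0 N : bO N (fun=> 0).
Proof. by exists 0 => //; near=> p; rewrite normr0 mul0r.
Unshelve. all: by end_near. Qed.

Lemma bOD N f g : bO N f -> bO N g -> bO N (fun p => f p + g p).
Proof.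
move=> [B B0 fB] [D D0 gD]; exists (B + D); first exact: addr_ge0.
near=> p; apply: le_trans (ler_normD _ _) _; rewrite mulrDl.
by apply: lerD; near: p.
Unshelve. all: by end_near. Qed.

Lemma bOM N M f g : bO N f -> bO M g -> bO (N + M) (fun p => f p * g p).
Proof.
move=> [B B0 fB] [D D0 gD]; exists (B * D); first exact: mulr_ge0.
near=> p; rewrite normrM exprD mulrACA.
by apply: ler_pM => //; near: p.
Unshelve. all: by end_near. Qed.

Lemma near_norm_lt (e : C) : 0 < e -> \forall p \near (0 : P), `|p| < e.
Proof. by move=> e0; apply/nbhs_norm0P; exists e. Qed.

Lemma bOW N M f : (N <= M)%N -> bO M f -> bO N f.
Proof.
move=> NM [B B0 fB]; exists B => //; near=> p.
apply: (@le_trans _ _ (B * `|p| ^+ M)); first by near: p.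
rewrite ler_wpM2l // ler_wiXn2l // ltW //; near: p; exact: near_norm_lt.
Unshelve. all: by end_near. Qed.

Lemma bO_cst c : bO 0 (fun=> c).
Proof. by exists `|c| => //; near=> p; rewrite mulr1.
Unshelve. all: by end_near. Qed.

Lemma bO_coord k : bO 1 (fun p => p 0 k).
Proof. by exists 1 => //; near=> p; rewrite mul1r; exact: norm_coord.
Unshelve. all: by end_near. Qed.

Lemma bOcM N c f : bO N f -> bO N (fun p => c * f p).
Proof. exact: (@bOM 0 N _ _ (bO_cst c)). Qed.

Lemma bON N f : bO N f -> bO N (fun p => - f p).
Proof.
by move=> /(bOcM (-1)); apply: bO_eq; near=> p; rewrite mulN1r.
Unshelve. all: by end_near. Qed.

Lemma bOB N f g : bO N f -> bO N g -> bO N (fun p => f p - g p).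
Proof. by move=> hf hg; apply: bOD => //; exact: bON. Qed.

Lemma bO_sum N I (r : seq I) (F : I -> P -> C) :
  (forall k, bO N (F k)) -> bO N (fun p => \sum_(k <- r) F k p).
Proof.
move=> H; elim: r => [|k r IH].
  by apply: bO_eq (bO0 N); near=> p; rewrite big_nil.
apply: bO_eq (bOD (H k) IH); near=> p; by rewrite big_cons.
Unshelve. all: by end_near. Qed.

Lemma bOX N n f : bO N f -> bO (N * n) (fun p => f p ^+ n).
Proof.
move=> hf; elim: n => [|n IH]; first by rewrite muln0; exact: bO_cst.
rewrite mulnS; apply: bO_eq (bOM hf IH).
by near=> p; rewrite exprS.
Unshelve. all: by end_near. Qed.

Lemma bO_mono i j : bO (i + j) (fun p => p 0 0 ^+ i * p 0 1 ^+ j).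
Proof.
have := bOX i (bO_coord 0); have := bOX j (bO_coord 1); rewrite !mul1n.
by move=> hj hi; exact: bOM.
Qed.

Definition pev N a p := rect N N (fun i j => a i j) (p 0 0) (p 0 1).

Lemma pevE N a p :
  pev N a p = \sum_(i < N) \sum_(j < N) a i j * (p 0 0 ^+ i * p 0 1 ^+ j).
Proof. by apply: eq_bigr => i _; apply: eq_bigr => j _; rewrite mulrA. Qed.

Lemma pevD N a b p : pev N (a + b) p = pev N a p + pev N b p.
Proof.
rewrite !pevE -big_split; apply: eq_bigr => i _.
by rewrite -big_split; apply: eq_bigr => j _; rewrite !pcoefD mulrDl.
Qed.

Lemma pev0 N p : pev N 0 p = 0.
Proof.
by rewrite pevE big1 // => i _; rewrite big1 // => j _; rewrite !pcoef0 mul0r.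
Qed.

Lemma pevN N a p : pev N (- a) p = - pev N a p.
Proof. by apply/eqP; rewrite -addr_eq0 -pevD addNr pev0. Qed.

Lemma pev_cstM N c a p : pev N (cser c * a) p = c * pev N a p.
Proof.
rewrite !pevE mulr_sumr; apply: eq_bigr => i _.
by rewrite mulr_sumr; apply: eq_bigr => j _; rewrite coef2_cstM -mulrA.
Qed.

Lemma pev_sum N I (r : seq I) (F : I -> pser2 C) p :
  pev N (\sum_(k <- r) F k) p = \sum_(k <- r) pev N (F k) p.
Proof.
by elim: r => [|k r IH]; rewrite ?big_nil ?pev0 // !big_cons pevD IH.
Qed.

Lemma bO_pev_vge N M a : vge N a -> bO N (pev M a).
Proof.
move=> va; apply: bO_eq (_ : bO N (fun p => \sum_(i < M) \sum_(j < M)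
    a i j * (p 0 0 ^+ i * p 0 1 ^+ j))).
  by near=> p; rewrite pevE.
apply: bO_sum => i; apply: bO_sum => j.
have [ij|ij] := ltnP (i + j) N; last exact/bOcM/(bOW ij)/bO_mono.
by rewrite va //; apply: bO_eq (bO0 N); near=> p; rewrite mul0r.
Unshelve. all: by end_near. Qed.

Lemma pev_mono N i j :
  bO N (fun p => p 0 0 ^+ i * p 0 1 ^+ j - pev N (xx C ^+ i * yy C ^+ j) p).
Proof.
have [/andP[iN jN]|ij] := boolP ((i < N) && (j < N))%N.
  apply: bO_eq (bO0 N); near=> p; rewrite pevE.
  rewrite (@sum2_delta _ N (fun k l => (xx C ^+ i * yy C ^+ j) k l *
    (p 0 0 ^+ k * p 0 1 ^+ l)) i j) //; first by rewrite coef2_mono !eqxx mul1r subrr.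
  move=> k l kl; rewrite coef2_mono; case: andP => [[/eqP ik /eqP jl]|_]; last by rewrite mul0r.
  by rewrite ik jl eqxx in kl.
apply: bOB; first by apply: (bOW _ (bO_mono i j)); lia.
apply: bO_pev_vge; apply: (@vgeW _ _ (i + j)%N); first by lia.
exact: (vge_mono (@vge_xx C) (@vge_yy C)).
Unshelve. all: by end_near. Qed.

(** Once a and b are replaced by polynomials, the difference is a finite sum of truncation errors of
    monomials, each treated by [pev_mono]. *)
Lemma pevM N a b : bO N (fun p => pev N a p * pev N b p - pev N (a * b) p).
Proof.
pose ta := psubst_trunc N (xx C) (yy C) a; pose tb := psubst_trunc N (xx C) (yy C) b.
have h1 : bO N (pev N (ta * tb - a * b)).
  by apply/bO_pev_vge/vgeMB; apply: vge_sym; exact: vge_ptrunc.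
suff h2 : bO N (fun p => pev N a p * pev N b p - pev N (ta * tb) p).
  by apply: bO_eq (bOD h2 h1); near=> p; rewrite pevD pevN addrA subrK.
have E : ta * tb = \sum_(i < N) \sum_(j < N) \sum_(k < N) \sum_(l < N)
    cser (a i j * b k l) * (xx C ^+ (i + k) * yy C ^+ (j + l)).
  rewrite /ta /tb psubst_trunc.unlock mulr_suml; apply: eq_bigr => i _.
  rewrite mulr_suml; apply: eq_bigr => j _.
  rewrite mulr_sumr; apply: eq_bigr => k _.
  rewrite mulr_sumr; apply: eq_bigr => l _.
  by rewrite !exprD rmorphM /=; pring.
have {}E p : pev N a p * pev N b p - pev N (ta * tb) p =
   \sum_(i < N) \sum_(j < N) \sum_(k < N) \sum_(l < N) a i j * b k l *
    (p 0 0 ^+ (i + k) * p 0 1 ^+ (j + l) - pev N (xx C ^+ (i + k) * yy C ^+ (j + l)) p).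
  rewrite E (pevE N a p) (pevE N b p) mulr_suml pev_sum -sumrB; apply: eq_bigr => i _.
  rewrite mulr_suml pev_sum -sumrB; apply: eq_bigr => j _.
  rewrite mulr_sumr pev_sum -sumrB; apply: eq_bigr => k _.
  rewrite mulr_sumr pev_sum -sumrB; apply: eq_bigr => l _.
  by rewrite pev_cstM mulrBr !exprD; congr (_ - _); ring.
apply: bO_eq (_ : bO N (fun p => \sum_(i < N) \sum_(j < N) \sum_(k < N) \sum_(l < N) a i j * b k l *
    (p 0 0 ^+ (i + k) * p 0 1 ^+ (j + l) - pev N (xx C ^+ (i + k) * yy C ^+ (j + l)) p))).
  by near=> p; rewrite E.
do 4!(apply: bO_sum => ?); apply: bOcM; exact: pev_mono.
Unshelve. all: by end_near. Qed.

(* Asymptotic, not convergent, expansions: sums, products and compositions then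
   need no rearrangement of series. *)
Definition has_exp f a := forall N, bO N (fun p => f p - pev N a p).

Lemma has_exp_eq f g a : (\forall p \near (0 : P), f p = g p) ->
  has_exp f a -> has_exp g a.
Proof.
move=> fg fa N; apply: bO_eq (fa N); near=> p.
by have -> : f p = g p by near: p.
Unshelve. all: by end_near. Qed.

Lemma has_exp_bO0 f a : has_exp f a -> bO 0 f.
Proof.
move=> /(_ 0%N); apply: bO_eq; near=> p; by rewrite pevE big_ord0 subr0.
Unshelve. all: by end_near. Qed.

Lemma bO0_pev N a : bO 0 (pev N a).
Proof. exact/bO_pev_vge/vge0. Qed.

Lemma has_expD f g a b : has_exp f a -> has_exp g b ->
  has_exp (fun p => f p + g p) (a + b).
Proof.
move=> fa gb N; apply: bO_eq (bOD (fa N) (gb N)); near=> p.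
by rewrite pevD; ring.
Unshelve. all: by end_near. Qed.

Lemma has_expM f g a b : has_exp f a -> has_exp g b ->
  has_exp (fun p => f p * g p) (a * b).
Proof.
move=> fa gb N.
have h1 := bOM (fa N) (has_exp_bO0 gb); rewrite addn0 in h1.
have h2 := bOM (bO0_pev N a) (gb N); rewrite add0n in h2.
apply: bO_eq (bOD (bOD h1 h2) (pevM N a b)); near=> p.
by ring.
Unshelve. all: by end_near. Qed.

Lemma has_exp_mono i j :
  has_exp (fun p => p 0 0 ^+ i * p 0 1 ^+ j) (xx C ^+ i * yy C ^+ j).
Proof. by move=> N; exact: pev_mono. Qed.

Lemma has_exp_cst c : has_exp (fun=> c) (cser c).
Proof.
move=> N; apply: bO_eq (bOcM c (pev_mono N 0 0)); near=> p.
by rewrite -[cser c]mulr1 pev_cstM !expr0 !mulr1 mulrBr mulr1.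
Unshelve. all: by end_near. Qed.

Lemma has_exp_xx : has_exp (fun p => p 0 0) (xx C).
Proof.
have := has_exp_mono 1 0; rewrite !expr0 !expr1 mulr1; apply: has_exp_eq.
by near=> p; rewrite mulr1.
Unshelve. all: by end_near. Qed.
Lemma has_exp_yy : has_exp (fun p => p 0 1) (yy C).
Proof.
have := has_exp_mono 0 1; rewrite !expr0 !expr1 mul1r; apply: has_exp_eq.
by near=> p; rewrite mul1r.
Unshelve. all: by end_near. Qed.

Lemma has_expN f a : has_exp f a -> has_exp (fun p => - f p) (- a).
Proof.
move=> fa N; apply: bO_eq (bON (fa N)); near=> p.
by rewrite pevN; ring.
Unshelve. all: by end_near. Qed.

Lemma has_expB f g a b : has_exp f a -> has_exp g b ->
  has_exp (fun p => f p - g p) (a - b).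
Proof. by move=> fa gb; apply: has_expD => //; exact: has_expN. Qed.

Lemma has_exp_sum I (r : seq I) (F : I -> P -> C) (G : I -> pser2 C) :
  (forall k, has_exp (F k) (G k)) ->
  has_exp (fun p => \sum_(k <- r) F k p) (\sum_(k <- r) G k).
Proof.
move=> H N; have := bO_sum r (fun k => H k N); apply: bO_eq; near=> p.
by rewrite pev_sum sumrB.
Unshelve. all: by end_near. Qed.

Lemma has_expX f a n : has_exp f a -> has_exp (fun p => f p ^+ n) (a ^+ n).
Proof.
move=> fa; elim: n => [|n IH].
  by rewrite expr0 -(rmorph1 (@cser C)); exact: has_exp_cst.
rewrite exprS; apply: has_exp_eq (has_expM fa IH).
by near=> p; rewrite exprS.
Unshelve. all: by end_near. Qed.

Lemma has_exp_bO N f a : has_exp f a -> vge N a -> bO N f.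
Proof.
move=> fa va; apply: bO_eq (bOD (fa N) (bO_pev_vge N va)); near=> p.
by rewrite subrK.
Unshelve. all: by end_near. Qed.

Lemma bO1_lt f (e : C) : bO 1 f -> 0 < e -> \forall p \near (0 : P), `|f p| < e.
Proof.
move=> [B B0 fB] e0; near=> p.
apply: (@le_lt_trans _ _ (B * `|p| ^+ 1)); first by near: p.
rewrite expr1; apply: (@le_lt_trans _ _ ((B + 1) * `|p|)).
  by rewrite ler_wpM2r // lerDl.
rewrite mulrC -ltr_pdivlMr ?ltr_wpDl //; near: p; apply: near_norm_lt.
by rewrite divr_gt0 // ltr_wpDl.
Unshelve. all: by end_near. Qed.

Lemma vec2_0 (x y : C) : (vec2 x y : P) 0 0 = x. Proof. by rewrite mxE. Qed.
Lemma vec2_1 (x y : C) : (vec2 x y : P) 0 1 = y. Proof. by rewrite mxE. Qed.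

Lemma near_comp (g1 g2 : P -> C) (Q : P -> Prop) : bO 1 g1 -> bO 1 g2 ->
  (\forall p \near (0 : P), Q p) ->
  \forall p \near (0 : P), Q (vec2 (g1 p) (g2 p)).
Proof.
move=> h1 h2 /nbhs_norm0P[e /= e0 eQ].
have e20 : 0 < e / 2 by rewrite divr_gt0.
near=> p; apply: eQ => /=.
apply: (@le_lt_trans _ _ (e / 2)); last by rewrite ltr_pdivrMr // ltr_pMr // ltr1n.
apply: norm_plane_le; rewrite ?vec2_0 ?vec2_1; first exact: ltW.
  by apply: ltW; near: p; exact: bO1_lt h1 e20.
by apply: ltW; near: p; exact: bO1_lt h2 e20.
Unshelve. all: by end_near. Qed.

(** Three errors add up: f against its polynomial at the inner point, that polynomial expanded
    through sums and products, and the truncation of the substituted series. *)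
Lemma has_exp_comp f g1 g2 a u v : has_exp f a -> has_exp g1 u -> has_exp g2 v ->
  vge 1 u -> vge 1 v ->
  has_exp (fun p => f (vec2 (g1 p) (g2 p))) (psubst u v a).
Proof.
move=> fa gu gv u1 v1 N.
have b1 := has_exp_bO gu u1; have b2 := has_exp_bO gv v1.
have [D1 D10 gD1] := b1; have [D2 D20 gD2] := b2.
pose D := D1 + D2.
have h1 : bO N (fun p => f (vec2 (g1 p) (g2 p)) - pev N a (vec2 (g1 p) (g2 p))).
  have [B B0 fB] := fa N; exists (B * D ^+ N).
    by rewrite mulr_ge0 // exprn_ge0 // addr_ge0.
  near=> p; apply: (@le_trans _ _ (B * `|(vec2 (g1 p) (g2 p) : P)| ^+ N)).
    by near: p; exact: (near_comp b1 b2 fB).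
  rewrite -mulrA -exprMn ler_wpM2l //; apply: lerXn2r; rewrite ?nnegrE //.
    by rewrite mulr_ge0 // addr_ge0.
  apply: norm_plane_le; rewrite ?vec2_0 ?vec2_1; first by rewrite mulr_ge0 // addr_ge0.
    apply: (@le_trans _ _ (D1 * `|p| ^+ 1)); first by near: p.
    by rewrite expr1 ler_wpM2r // lerDl.
  apply: (@le_trans _ _ (D2 * `|p| ^+ 1)); first by near: p.
  by rewrite expr1 ler_wpM2r // lerDr.
have h2 : has_exp (fun p => \sum_(i < N) \sum_(j < N) a i j * g1 p ^+ i * g2 p ^+ j)
    (psubst_trunc N u v a).
  rewrite psubst_trunc.unlock; apply: has_exp_sum => i; apply: has_exp_sum => j.
  apply: has_expM; last exact: has_expX.
  apply: has_expM; [exact: has_exp_cst|exact: has_expX].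
have h3 : bO N (pev N (psubst_trunc N u v a - psubst u v a)).
  by apply/bO_pev_vge/vge_sym; exact: psubst_approx.
apply: bO_eq (bOD (bOD h1 (h2 N)) h3); near=> p.
rewrite pevD pevN [X in _ - X + _]/pev /rect vec2_0 vec2_1; ring.
Unshelve. all: by end_near. Qed.

Lemma poly_eq0_horner (q : {poly C}) : (forall z, q.[z] = 0) -> q = 0.
Proof.
move=> q0; apply: (roots_geq_poly_eq0 (rs := [seq (k%:R : C) | k <- iota 0 (size q)])).
- by apply/allP => z _; apply/rootP.
- by rewrite map_inj_uniq ?iota_uniq // => i j /eqP; rewrite eqr_nat => /eqP.
- by rewrite size_map size_iota.
Qed.

(** On the line (t, t z) the homogeneous part of degree n is t^n S(z). Being O(t^(n+1)), it forces
    S(z) = 0 for all z, and S is a polynomial whose coefficients are those of a in degree n. *)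
Lemma has_exp_uniq0 a : has_exp (fun=> 0) a -> a = 0.
Proof.
move=> ha; apply: vge_eq0; elim=> [|n IH]; first exact: vge0.
suff S0 (z : C) : \sum_(j < n.+1) a (n - j)%N j * z ^+ j = 0.
  have q0 : \poly_(j < n.+1) a (n - j)%N j = 0.
    by apply: poly_eq0_horner => z; rewrite horner_poly.
  move=> i j; rewrite ltnS leq_eqVlt => /orP[/eqP ij|]; last exact: IH.
  have := congr1 (fun q : {poly C} => q`_j) q0.
  by rewrite coef_poly coef0 ltnS -ij leq_addl addnK.
have va : vge n a by [].
pose S := \sum_(j < n.+1) a (n - j)%N j * z ^+ j; rewrite -/S.
pose hom p := \sum_(j < n.+1) a (n - j)%N j * (p 0 0 ^+ (n - j) * p 0 1 ^+ j).
have homO : bO n.+1 hom.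
  pose h : pser2 C := \sum_(j < n.+1) cser (a (n - j)%N j) * (xx C ^+ (n - j) * yy C ^+ j).
  have hE : has_exp hom h.
    apply: has_exp_sum => j; apply: has_expM; first exact: has_exp_cst.
    exact: has_exp_mono.
  have vh : vge n.+1 (h - a).
    move=> i j; rewrite ltnS leq_eqVlt => ij.
    have hij : h i j = if (i + j == n)%N then a i j else 0.
      rewrite /h coef2_sum; case: ifPn => [/eqP ijn|ijn]; last first.
        rewrite big1 // => k _; rewrite coef2_cstM coef2_mono.
        case: andP => [[/eqP E1 /eqP E2]|_]; rewrite ?mulr0 //.
        by case/eqP: ijn; rewrite E1 E2 subnK // -ltnS.
      have jn : (j < n.+1)%N by lia.
      rewrite (bigD1 (Ordinal jn)) //= big1 ?addr0.
        have ni : (n - j = i)%N by lia.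
        by rewrite coef2_cstM coef2_mono ni !eqxx mulr1.
      move=> k kj; rewrite coef2_cstM coef2_mono.
      case: andP => [[_ /eqP E2]|_]; rewrite ?mulr0 //.
      by case/eqP: kj; apply: val_inj.
    rewrite !pcoefB hij; case/orP: ij => [->|ij]; first by rewrite subrr.
    by rewrite ltn_eqF // va // subrr.
  have h1 := bOB (hE n.+1) (ha n.+1).
  apply: bO_eq (bOD h1 (bO_pev_vge n.+1 vh)); near=> p.
  by rewrite pevD pevN; ring.
have [B B0 /nbhs_norm0P[d /= d0 dB]] := homO.
apply/eqP; rewrite -normr_le0; apply/ler_addgt0Pr => e e0; rewrite add0r.
pose k := 1 + `|z|; have k1 : 1 <= k by rewrite lerDl.
have k0 : 0 < k by apply: lt_le_trans k1.
pose Bk := B * k ^+ n.+1; have Bk0 : 0 <= Bk by rewrite mulr_ge0 // exprn_ge0 // ltW.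
pose dk := d / k; have dk0 : 0 < dk by rewrite divr_gt0.
pose den := e + Bk * dk; have den0 : 0 < den by rewrite ltr_wpDr // mulr_ge0 // ltW.
(* Chosen with t < d / k and Bk t <= e: half of 1 / (1 / dk + Bk / e), in a form that allows Bk =
   0. *)
pose t := e * dk / den / 2.
have t0 : 0 < t by rewrite !divr_gt0 // mulr_gt0.
have t1 : t < dk.
  rewrite /t ltr_pdivrMr // ltr_pdivrMr // mulrC -mulrA ltr_pM2l //.
  rewrite /den; apply: (@le_lt_trans _ _ (e + Bk * dk)).
    by rewrite lerDl mulr_ge0 // ltW.
  by rewrite -/den ltr_pMl // ltr1n.
have t2 : Bk * t <= e.
  rewrite /t; move: dk dk0 @den den0 {t t0 t1} => dk dk0 den den0.
  have -> : Bk * (e * dk / den / 2) = e * (Bk * dk) / den / 2 by ring.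
  rewrite ler_pdivrMr // ler_pdivrMr //.
  rewrite -mulrA ler_pM2l //; apply: (@le_trans _ _ den).
    by rewrite lerDr ltW.
  by rewrite ler_pMl // ler1n.
clearbody t.
have pn : `|(vec2 t (t * z) : P)| <= k * t.
  apply: norm_plane_le; first by rewrite mulr_ge0 // ltW.
    by rewrite vec2_0 gtr0_norm // ler_peMl // ltW.
  by rewrite vec2_1 normrM gtr0_norm // mulrC ler_wpM2r ?(ltW t0) // /k lerDr.
have pd : `|(vec2 t (t * z) : P)| < d.
  by apply: le_lt_trans pn _; rewrite mulrC -ltr_pdivlMr.
have := dB _ pd; have -> : hom (vec2 t (t * z)) = S * t ^+ n.
  rewrite /hom /S mulr_suml; apply: eq_bigr => j _.
  have jn : (j <= n)%N by rewrite -ltnS.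
  have -> : t ^+ n = t ^+ (n - j) * t ^+ j by rewrite -exprD subnK.
  by rewrite vec2_0 vec2_1 exprMn; ring.
rewrite normrM [X in _ * X]gtr0_norm ?exprn_gt0 // => H.
have : `|S| * t ^+ n <= Bk * t * t ^+ n.
  apply: le_trans H _; rewrite /Bk -!mulrA ler_wpM2l // -exprS -exprMn.
  by apply: lerXn2r; rewrite ?nnegrE // mulr_ge0 // ltW.
by rewrite ler_pM2r ?exprn_gt0 // => /le_trans; apply.
Unshelve. all: by end_near. Qed.

Lemma has_exp_uniq f g a b : (\forall p \near (0 : P), f p = g p) ->
  has_exp f a -> has_exp g b -> a = b.
Proof.
move=> fg fa gb; apply/subr0_eq/has_exp_uniq0.
apply: has_exp_eq (has_expB fa gb); near=> p.
by have -> : f p = g p; [near: p|rewrite subrr].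
Unshelve. all: by end_near. Qed.

End Expansions.

(** * Holomorphic germs *)

Section Jets.
Variable K : numFieldType.
Implicit Types (t B m D x h : K).

(** A first-order Taylor expansion at scale t: old value m, new value m', differential D, with one
    constant B for all three estimates. *)
Definition jet t B m m' D :=
  [/\ `|m| <= B, `|D| <= B * t & `|m' - m - D| <= B * t ^+ 2].

(** Expanding the product leaves six error terms, each at most B1 B2 t^2; this is the constant 6. *)
Lemma jetM t B1 B2 m1 m1' D1 m2 m2' D2 : 0 <= t -> t <= 1 ->
  jet t B1 m1 m1' D1 -> jet t B2 m2 m2' D2 ->
  jet t (6 * (B1 * B2)) (m1 * m2) (m1' * m2') (m1 * D2 + D1 * m2).
Proof.
move=> t0 t1 [a1 a2 a3] [b1 b2 b3].
have B10 : 0 <= B1 by apply: le_trans a1.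
have B20 : 0 <= B2 by apply: le_trans b1.
have BB0 : 0 <= B1 * B2 by rewrite mulr_ge0.
have t20 : 0 <= t ^+ 2 by rewrite exprn_ge0.
have t21 : t ^+ 2 <= t by rewrite expr2 ler_piMl.
have le6 (c : K) : 1 <= c -> B1 * B2 <= c * (B1 * B2) by move=> c1; rewrite ler_peMl.
split.
- rewrite normrM; apply: le_trans (le6 6 _); last by rewrite ler1n.
  exact: ler_pM.
- apply: le_trans (ler_normD _ _) _; rewrite !normrM.
  apply: (@le_trans _ _ (B1 * (B2 * t) + B1 * t * B2)).
    by apply: lerD; apply: ler_pM.
  have -> : B1 * (B2 * t) + B1 * t * B2 = (2 * (B1 * B2)) * t by ring.
  by rewrite ler_wpM2r // ler_wpM2r // ler_nat.
- set r1 := m1' - m1 - D1 in a3; set r2 := m2' - m2 - D2 in b3.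
  have -> : m1' * m2' - m1 * m2 - (m1 * D2 + D1 * m2) =
    m1 * r2 + D1 * D2 + D1 * r2 + r1 * m2 + r1 * D2 + r1 * r2.
    by rewrite /r1 /r2; ring.
  have c1 : `|D1| <= B1 by apply: le_trans a2 _; rewrite ler_piMr.
  have c2 : `|r1| <= B1 * t.
    by apply: le_trans a3 _; rewrite ler_wpM2l.
  have c3 : `|r1| <= B1 by apply: le_trans c2 _; rewrite ler_piMr.
  have e1 : `|m1 * r2| <= B1 * B2 * t ^+ 2 by rewrite normrM -mulrA ler_pM.
  have e2 : `|D1 * D2| <= B1 * B2 * t ^+ 2.
    by rewrite normrM expr2 mulrACA ler_pM.
  have e3 : `|D1 * r2| <= B1 * B2 * t ^+ 2 by rewrite normrM -mulrA ler_pM.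
  have e4 : `|r1 * m2| <= B1 * B2 * t ^+ 2 by rewrite normrM mulrAC ler_pM.
  have e5 : `|r1 * D2| <= B1 * B2 * t ^+ 2 by rewrite normrM expr2 mulrACA ler_pM.
  have e6 : `|r1 * r2| <= B1 * B2 * t ^+ 2 by rewrite normrM -mulrA ler_pM.
  have -> : 6 * (B1 * B2) * t ^+ 2 = B1 * B2 * t ^+ 2 + B1 * B2 * t ^+ 2 + B1 * B2 * t ^+ 2
     + B1 * B2 * t ^+ 2 + B1 * B2 * t ^+ 2 + B1 * B2 * t ^+ 2 by ring.
  by do 5!(apply: le_trans (ler_normD _ _) _; apply: lerD => //).
Qed.

Lemma jet1 t : 0 <= t -> jet t 1 1 1 0.
Proof. by move=> t0; split; rewrite ?normr1 ?normr0 ?subrr ?subr0 ?normr0 ?mulr_ge0 ?exprn_ge0. Qed.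

Lemma jet_var t B x h : `|x| <= B -> `|h| <= B * t -> 0 <= t -> jet t B x (x + h) h.
Proof.
move=> xB hB t0; have B0 : 0 <= B by apply: le_trans xB.
split=> //; have -> : x + h - x - h = 0 by ring.
by rewrite normr0 mulr_ge0 // exprn_ge0.
Qed.

Lemma jetX t B x h n : `|x| <= B -> `|h| <= B * t -> 0 <= t -> t <= 1 ->
  jet t ((6 * B) ^+ n) (x ^+ n) ((x + h) ^+ n) (x ^+ n.-1 * h *+ n).
Proof.
move=> xB hB t0 t1; elim: n => [|n IH]; first by rewrite !expr0 mulr0n; exact: jet1.
have := jetM t0 t1 (jet_var xB hB t0) IH.
have -> : 6 * (B * (6 * B) ^+ n) = (6 * B) ^+ n.+1 by rewrite exprS mulrA.
have -> : x * (x ^+ n.-1 * h *+ n) + h * x ^+ n = x ^+ n * h *+ n.+1.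
  case: n {IH} => [|n]; first by rewrite expr0 mulr0n mulr0 add0r mulr1n mulrC.
  by rewrite /= [RHS]mulrS mulrnAr mulrA -exprS addrC (mulrC h).
by rewrite -!exprS.
Qed.

End Jets.

Section Holo.
Variable R : realType.
Local Notation C := (R[i]^o).
Local Notation P := ('rV[R[i]^o]_2).
Implicit Types (f g : P -> C) (p : P) (N M : nat) (a b u v : pser2 C).

Definition holo f a := exists r M : C, [/\ 0 < r, cauchy_bound a r M &
  \forall p \near (0 : P), pev n a p @[n --> \oo] --> f p].

Lemma holomorphicP f : holomorphic f <-> exists a, holo f a.
Proof.
split=> [[a [r [M [r0 aM fa]]]]|[a [r [M [r0 aM fa]]]]].
  by exists (PSer (fun i => PSer (a i))), r, M; split.
by exists (fun i j => a i j), r, M; split.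
Qed.

Lemma le_half_limit (z c D : C) : 0 <= D ->
  (forall n, z <= c + D * 2^-1 ^+ n) -> z <= c.
Proof.
move=> D0 H; apply/ler_addgt0Pr => e e0.
have eE : e = (complex.Re (e : R[i]))%:C by rewrite RRe_real // gtr0_real.
have DE : D = (complex.Re (D : R[i]))%:C by rewrite RRe_real // ger0_real.
set e' := complex.Re _ in eE; set D' := complex.Re _ in DE.
have e'0 : 0 < e' by rewrite -ltcR -eE.
have D'0 : 0 <= D' by rewrite -lecR -DE.
have D1 : 0 < D' + 1 by rewrite ltr_wpDl.
have [n ne] := half_small (divr_gt0 e'0 D1).
apply: le_trans (H n) _; rewrite lerD2l eE DE.
have -> : (2^-1 : C) ^+ n = (2^-1 ^+ n)%:C by rewrite rmorphXn /= fmorphV rmorph_nat.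
rewrite -rmorphM /= lecR; move: ne; rewrite ltr_pdivlMr // => /ltW.
apply: le_trans; rewrite mulrC ler_wpM2l ?exprn_ge0 ?invr_ge0 // lerDl //.
Qed.

Lemma holo_tail a r (M : C) (l : C) p N A B : 0 < r -> cauchy_bound a r M ->
  pev n a p @[n --> \oo] --> l -> `|p| * 2 <= r -> (N <= A)%N -> (N <= B)%N ->
  `|l - rect A B (fun i j => a i j) (p 0 0) (p 0 1)| <= 8 * (M * (`|p| * 2 / r) ^+ N).
Proof.
move=> r0 aM al pr NA NB.
have T A' B' : (N <= A')%N -> (N <= B')%N -> `|rect A' B' (fun i j => a i j) (p 0 0) (p 0 1) - pev N a p| <= 4 * (M * (`|p| * 2 / r) ^+ N).
  by move=> ? ?; apply: rect_tail => //; exact: norm_coord.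
have h1 : `|l - pev N a p| <= 4 * (M * (`|p| * 2 / r) ^+ N).
  by apply: (cvg_norm_le (N := N) al) => n Nn; exact: T.
rewrite -[l](subrK (pev N a p)) -addrA; apply: le_trans (ler_normD _ _) _.
have -> : 8 * (M * (`|p| * 2 / r) ^+ N) = 4 * (M * (`|p| * 2 / r) ^+ N) + 4 * (M * (`|p| * 2 / r) ^+ N).
  by rewrite -mulrDl -natrD.
by apply: lerD => //; rewrite distrC T.
Qed.

Lemma holo_exp f a : holo f a -> has_exp f a.
Proof.
move=> [r [M [r0 aM fa]]] N; exists (8 * (M * (2 / r) ^+ N)).
  rewrite !mulr_ge0 ?(cauchy_bound_ge0 aM) // exprn_ge0 // divr_ge0 // ltW //.
near=> p.
have -> : 8 * (M * (2 / r) ^+ N) * `|p| ^+ N = 8 * (M * (`|p| * 2 / r) ^+ N).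
  by rewrite -!mulrA -exprMn; congr (_ * (_ * _ ^+ _)); ring.
apply: holo_tail => //; first by near: p.
rewrite -ler_pdivlMr //; apply: ltW; near: p; apply: near_norm_lt.
by rewrite divr_gt0.
Unshelve. all: by end_near. Qed.

Lemma holo_exists a r (M : C) : 0 < r -> cauchy_bound a r M -> exists f, holo f a.
Proof.
move=> r0 aM; have M0 := cauchy_bound_ge0 aM.
exists (fun p => lim (pev n a p @[n --> \oo])), r, M; split=> //.
have r40 : 0 < r / 4 by rewrite divr_gt0.
near=> p; have p4 : `|p| <= r / 4 by apply: ltW; near: p; exact: near_norm_lt.
have [l al] : exists l : C, pev n a p @[n --> \oo] --> l.
  apply: (@half_cvg _ _ (4 * M)) => n m nm; rewrite -mulrA.
  have := @rect_tail _ (fun i j => a i j) r M r0 aM (p 0 0) (p 0 1) (r / 4) n m m.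
  have -> : r / 4 * 2 / r = 2^-1.
    have -> : (4 : C) = 2 * 2 by rewrite -natrM.
    by field; rewrite lt0r_neq0.
  apply=> //; try exact: le_trans (norm_coord _ _) p4.
  have -> : (4 : C) = 2 * 2 by rewrite -natrM.
  have -> : r / (2 * 2) * 2 = r / 2 by field.
  by rewrite ler_pdivrMr // ler_peMr // ?ler1n // ltW.
exact: (cvgP _ al).
Unshelve. all: by end_near. Qed.

(** Halving the radius absorbs the factor i + 1, since i + 1 <= 2^i. *)
Lemma cauchy_bound_dx a r (M : C) : 0 < r -> cauchy_bound a r M ->
  cauchy_bound (dx a) (r / 2) (M / r).
Proof.
move=> r0 aM i j; rewrite coef2_dx normrMn expr_div_n.
have H := aM i.+1 j; rewrite addSn exprS in H.
rewrite ler_pdivlMr //; apply: le_trans H.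
have -> : `|a i.+1 j| *+ i.+1 * (r ^+ (i + j) / 2 ^+ (i + j)) * r =
   (i.+1%:R / 2 ^+ (i + j)) * (`|a i.+1 j| * (r * r ^+ (i + j))).
  by rewrite -[_ *+ i.+1]mulr_natl; ring.
apply: ler_piMl; first by rewrite !mulr_ge0 ?exprn_ge0 ?(ltW r0).
rewrite ler_pdivrMr ?exprn_gt0 // mul1r -natrX ler_nat.
by apply: (@leq_trans (2 ^ i)%N); [exact: ltn_expl|rewrite leq_exp2l // leq_addr].
Qed.

Lemma cauchy_bound_dy a r (M : C) : 0 < r -> cauchy_bound a r M ->
  cauchy_bound (dy a) (r / 2) (M / r).
Proof.
move=> r0 aM i j; rewrite coef2_dy normrMn expr_div_n.
have H := aM i j.+1; rewrite addnS exprS in H.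
rewrite ler_pdivlMr //; apply: le_trans H.
have -> : `|a i j.+1| *+ j.+1 * (r ^+ (i + j) / 2 ^+ (i + j)) * r =
   (j.+1%:R / 2 ^+ (i + j)) * (`|a i j.+1| * (r * r ^+ (i + j))).
  by rewrite -[_ *+ j.+1]mulr_natl; ring.
apply: ler_piMl; first by rewrite !mulr_ge0 ?exprn_ge0 ?(ltW r0).
rewrite ler_pdivrMr ?exprn_gt0 // mul1r -natrX ler_nat.
by apply: (@leq_trans (2 ^ j)%N); [exact: ltn_expl|rewrite leq_exp2l // leq_addl].
Qed.

(** Apply [jetM] termwise. The radius r / 12 turns the factor 6 of each jet into 6 (r / 12) = r / 2,
    so the errors sum as a geometric series. The rectangles of the derivatives are one shorter
    because differentiation shifts an index. *)
Lemma rect_jet a r (M : C) x y h k t n : 0 < r -> cauchy_bound a r M ->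
  `|x| <= r / 12 -> `|y| <= r / 12 -> `|h| <= r / 12 * t -> `|k| <= r / 12 * t ->
  0 <= t -> t <= 1 ->
  `|rect n.+1 n.+1 (fun i j => a i j) (x + h) (y + k) -
    rect n.+1 n.+1 (fun i j => a i j) x y -
    (rect n n.+1 (fun i j => dx a i j) x y * h +
     rect n.+1 n (fun i j => dy a i j) x y * k)| <= 24 * M * t ^+ 2.
Proof.
move=> r0 aM xr yr hr kr t0 t1; have M0 := cauchy_bound_ge0 aM.
pose D i j := a i j * (x ^+ i * (y ^+ j.-1 * k *+ j) + (x ^+ i.-1 * h *+ i) * y ^+ j).
have E1 : rect n n.+1 (fun i j => dx a i j) x y * h =
    \sum_(i < n.+1) \sum_(j < n.+1) a i j * ((x ^+ i.-1 * h *+ i) * y ^+ j).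
  rewrite big_ord_recl /= [X in X + _]big1 ?add0r; last first.
    by move=> j _; rewrite mulr0n mul0r mulr0.
  rewrite mulr_suml; apply: eq_bigr => i _; rewrite mulr_suml; apply: eq_bigr => j _.
  by rewrite coef2_dx /bump /= add1n /= !(mulrnAl, mulrnAr); congr (_ *+ _); ring.
have E2 : rect n.+1 n (fun i j => dy a i j) x y * k =
    \sum_(i < n.+1) \sum_(j < n.+1) a i j * (x ^+ i * (y ^+ j.-1 * k *+ j)).
  rewrite mulr_suml; apply: eq_bigr => i _.
  rewrite big_ord_recl /= mulr0n !mulr0 add0r.
  rewrite mulr_suml; apply: eq_bigr => j _.
  by rewrite coef2_dy /bump /= add1n /= !(mulrnAl, mulrnAr); congr (_ *+ _); ring.
have -> : rect n.+1 n.+1 (fun i j => a i j) (x + h) (y + k) -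
    rect n.+1 n.+1 (fun i j => a i j) x y -
    (rect n n.+1 (fun i j => dx a i j) x y * h +
     rect n.+1 n (fun i j => dy a i j) x y * k) =
  \sum_(i < n.+1) \sum_(j < n.+1) a i j *
     ((x + h) ^+ i * (y + k) ^+ j - x ^+ i * y ^+ j -
      (x ^+ i * (y ^+ j.-1 * k *+ j) + (x ^+ i.-1 * h *+ i) * y ^+ j)).
  rewrite E1 E2 /rect -sumrB -big_split -sumrB; apply: eq_bigr => i _.
  rewrite -sumrB -big_split -sumrB; apply: eq_bigr => j _ /=; ring.
have -> : 24 * M * t ^+ 2 = 6 * M * t ^+ 2 * 4.
  by have -> : (24 : C) = 6 * 4 by [rewrite -natrM]; ring.
apply: (@le_trans _ _ (\sum_(i < n.+1) \sum_(j < n.+1) 6 * M * t ^+ 2 * 2^-1 ^+ (i + j))).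
  apply: le_trans (ler_norm_sum _ _ _) _; apply: ler_sum => i _.
  apply: le_trans (ler_norm_sum _ _ _) _; apply: ler_sum => j _.
  have [_ _ J] := jetM t0 t1 (jetX i xr hr t0 t1) (jetX j yr kr t0 t1).
  rewrite normrM; apply: le_trans (ler_wpM2l (normr_ge0 _) J) _.
  have -> : `|a i j| * (6 * ((6 * (r / 12)) ^+ i * (6 * (r / 12)) ^+ j) * t ^+ 2) =
     (`|a i j| * r ^+ (i + j)) * (6 * t ^+ 2 * 2^-1 ^+ (i + j)).
    have -> : 6 * (r / 12) = r * 2^-1.
      by have -> : (12 : C) = 6 * 2 by [rewrite -natrM]; field.
    by rewrite -exprD exprMn; ring.
  have -> : 6 * M * t ^+ 2 * 2^-1 ^+ (i + j) = M * (6 * t ^+ 2 * 2^-1 ^+ (i + j)) by ring.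
  by rewrite ler_wpM2r ?aM // !mulr_ge0 ?exprn_ge0 ?invr_ge0.
under eq_bigr do rewrite -mulr_sumr.
rewrite -mulr_sumr ler_wpM2l ?sum2_half // !mulr_ge0 ?exprn_ge0 //.
Qed.

Lemma holo_tail_half a r (M : C) (l : C) p N A B : 0 < r -> cauchy_bound a r M ->
  pev n a p @[n --> \oo] --> l -> `|p| * 4 <= r -> (N <= A)%N -> (N <= B)%N ->
  `|l - rect A B (fun i j => a i j) (p 0 0) (p 0 1)| <= 8 * M * 2^-1 ^+ N.
Proof.
move=> r0 aM al pr NA NB.
have p2 : `|p| * 2 / r <= 2^-1.
  rewrite ler_pdivrMr // ler_pdivlMl // mulrC -mulrA.
  by have -> : (2 * 2 : C) = 4 by rewrite -natrM.
have pr2 : `|p| * 2 <= r by apply: le_trans pr; rewrite ler_wpM2l // ler_nat.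
apply: le_trans (holo_tail r0 aM al pr2 NA NB) _; rewrite -[leRHS]mulrA.
rewrite !ler_wpM2l ?(cauchy_bound_ge0 aM) //; apply: lerXn2r => //; rewrite nnegrE ?invr_ge0 //.
by rewrite divr_ge0 ?mulr_ge0 // ltW.
Qed.

(** The estimate of [rect_jet] has a constant independent of n, so it passes from partial sums to f,
    uniformly in the base point p. *)
Lemma holo_diff f a : holo f a -> exists f1 f2 : P -> C,
  [/\ holo f1 (dx a), holo f2 (dy a) & exists B d : C, [/\ 0 <= B, 0 < d &
    forall p h, `|p| < d -> `|h| < d ->
      `|f (p + h) - f p - (f1 p * h 0 0 + f2 p * h 0 1)| <= B * `|h| ^+ 2]].
Proof.
move=> [r [M [r0 aM fa]]]; have M0 := cauchy_bound_ge0 aM.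
have r20 : 0 < r / 2 by rewrite divr_gt0.
have b1 := cauchy_bound_dx r0 aM; have b2 := cauchy_bound_dy r0 aM.
have [f1 h1] := holo_exists r20 b1; have [f2 h2] := holo_exists r20 b2.
exists f1, f2; split=> //.
have [r1 [M1 [_ _ c1]]] := h1; have [r2 [M2 [_ _ c2]]] := h2.
have : \forall p \near (0 : P), [/\ pev n a p @[n --> \oo] --> f p,
   pev n (dx a) p @[n --> \oo] --> f1 p & pev n (dy a) p @[n --> \oo] --> f2 p].
  by apply: filterS3 fa c1 c2 => p ? ? ?; split.
move=> /nbhs_norm0P[e /= e0 eP]; pose s := r / 24.
have s0 : 0 < s by rewrite divr_gt0.
have [d [d0 de2 ds2]] := common_lower (divr_gt0 e0 (ltr0n C 2)) (divr_gt0 s0 (ltr0n C 2)).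
have de : d * 2 <= e by rewrite -ler_pdivlMr.
have ds : d * 2 <= s by rewrite -ler_pdivlMr.
have dd : d <= d * 2 by rewrite ler_peMr ?ltW // ltr1n.
have r12 : 0 < r / 12 by rewrite divr_gt0.
exists (24 * M / (r / 12) ^+ 2), d; split=> //.
  by rewrite divr_ge0 ?exprn_ge0 ?(ltW r12) ?mulr_ge0.
move=> p h pd hd.
have phd : `|p + h| < d * 2.
  by apply: le_lt_trans (ler_normD _ _) _; rewrite mulr_natr mulr2n ltrD.
have [fp f1p f2p] := eP p (lt_le_trans pd (le_trans dd de)).
have [fph _ _] := eP (p + h) (lt_le_trans phd de).
have ps : `|p| <= s by apply: le_trans (ltW pd) (le_trans dd ds).
have hs : `|h| <= s by apply: le_trans (ltW hd) (le_trans dd ds).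
have phs : `|p + h| <= s by apply: le_trans (ltW phd) ds.
have s24 : s * 24 = r by rewrite /s divfK.
have sm (z k : C) : 0 <= k -> k <= 24 -> z <= s -> z * k <= r.
  move=> k0 k24 zs; rewrite -s24; apply: (@le_trans _ _ (s * k)).
    by rewrite ler_wpM2r.
  by rewrite ler_wpM2l // ltW.
pose t := `|h| / (r / 12).
have t0 : 0 <= t by rewrite divr_ge0 // ltW.
have s12 (z : C) : z <= s -> z <= r / 12.
  by move=> zs; rewrite ler_pdivlMr //; apply: sm => //; rewrite ler_nat.
have t1 : t <= 1 by rewrite ler_pdivrMr // mul1r s12.
have ht k : `|h 0 k| <= r / 12 * t.
  by rewrite /t mulrC divfK ?lt0r_neq0 // norm_coord.
have -> : 24 * M / (r / 12) ^+ 2 * `|h| ^+ 2 = 24 * M * t ^+ 2.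
  by rewrite /t [(`|h| / _) ^+ 2]expr_div_n; ring.
(* Four tails of size 8 M / 2^n: those of f at p + h and at p, and those of the two partial
   derivatives. *)
apply: (@le_half_limit _ _ (32 * M)); first by rewrite mulr_ge0.
move=> n.
have J := rect_jet n r0 aM (le_trans (norm_coord p 0) (s12 _ ps))
   (le_trans (norm_coord p 1) (s12 _ ps)) (ht 0) (ht 1) t0 t1.
have sm4 (z : C) : z <= s -> z * 4 <= r by move=> zs; apply: sm => //; rewrite ler_nat.
have T1 := holo_tail_half r0 aM fph (sm4 _ phs) (leqnSn n) (leqnSn n).
have T2 := holo_tail_half r0 aM fp (sm4 _ ps) (leqnSn n) (leqnSn n).
have p42 : `|p| * 4 <= r / 2.
  rewrite ler_pdivlMr // -mulrA; apply: sm => //; by rewrite -natrM ?ler_nat.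
have T3 := holo_tail_half r20 b1 f1p p42 (leqnn n) (leqnSn n).
have T4 := holo_tail_half r20 b2 f2p p42 (leqnSn n) (leqnn n).
move: J T1 T2 T3 T4; rewrite !mxE.
set S' := rect _ _ _ _ _; set S := rect _ _ _ _ _; set R1 := rect _ _ _ _ _.
set R2 := rect _ _ _ _ _ => J T1 T2 T3 T4.
have -> : f (p + h) - f p - (f1 p * h 0 0 + f2 p * h 0 1) =
  (S' - S - (R1 * h 0 0 + R2 * h 0 1)) + (f (p + h) - S') - (f p - S)
   - (f1 p - R1) * h 0 0 - (f2 p - R2) * h 0 1 by ring.
have hr : `|h| <= r by rewrite -[`|h|]mulr1; apply: sm => //; rewrite ler1n.
have HM (z : C) k : `|z| <= 8 * (M / r) * 2^-1 ^+ n -> `|z * h 0 k| <= 8 * M * 2^-1 ^+ n.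
  move=> zb; rewrite normrM.
  have -> : 8 * M * 2^-1 ^+ n = 8 * (M / r) * 2^-1 ^+ n * r.
    by field; rewrite lt0r_neq0.
  by apply: ler_pM => //; apply: le_trans hr; exact: norm_coord.
have -> : 24 * M * t ^+ 2 + 32 * M * 2^-1 ^+ n = 24 * M * t ^+ 2 + 8 * M * 2^-1 ^+ n
  + 8 * M * 2^-1 ^+ n + 8 * M * 2^-1 ^+ n + 8 * M * 2^-1 ^+ n by ring.
apply: le_trans (ler_normB _ _) _; apply: lerD; last exact: HM.
apply: le_trans (ler_normB _ _) _; apply: lerD; last exact: HM.
apply: le_trans (ler_normB _ _) _; apply: lerD; last exact: T2.
by apply: le_trans (ler_normD _ _) _; apply: lerD; [exact: J|exact: T1].
Qed.

End Holo.

(** * Taylor series of vector fields *)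

Section VectorFields.
Variable R : realType.
Local Notation C := (R[i]^o).
Local Notation P := ('rV[R[i]^o]_2).
Implicit Types (f g : P -> C) (p q h : P) (X Y W : P -> P) (a b : 'I_2 -> pser2 C).

Lemma planeP p q : p 0 0 = q 0 0 -> p 0 1 = q 0 1 -> p = q.
Proof. by move=> e0 e1; apply/rowP => k; case: (ord2P k) => ->. Qed.

Lemma mulmx2E n1 n2 (A : 'M[C]_(n1, 2)) (B : 'M[C]_(2, n2)) i j :
  (A *m B) i j = A i 0 * B 0 j + A i 1 * B 1 j.
Proof.
by rewrite mxE big_ord_recl big_ord1; congr (_ + A _ _ * B _ _); exact: val_inj.
Qed.

Lemma mulrow_bound (J : 'M[C]_2) : exists2 K : C, 0 <= K & forall h, `|h *m J| <= K * `|h|.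
Proof.
pose c k := `|J 0 k| + `|J 1 k|; have c0 k : 0 <= c k by rewrite addr_ge0.
exists (c 0 + c 1) => [|h]; first by rewrite addr_ge0.
have H k : `|(h *m J) 0 k| <= c k * `|h|.
  rewrite mulmx2E mulrDl; apply: le_trans (ler_normD _ _) _.
  by rewrite !normrM; apply: lerD; rewrite mulrC ler_wpM2l // norm_coord.
apply: norm_plane_le; first by rewrite mulr_ge0 ?addr_ge0.
  by apply: le_trans (H _) _; rewrite ler_wpM2r // lerDl.
by apply: le_trans (H _) _; rewrite ler_wpM2r // lerDr.
Qed.

Lemma diff_of_bound X p (J : 'M[C]_2) (B d : C) : 0 < d ->
  (forall h, `|h| < d -> `|X (p + h) - X p - h *m J| <= B * `|h| ^+ 2) ->
  differentiable X p /\ forall h, 'd X p h = h *m J.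
Proof.
move=> d0 H.
pose B' := `|B|; have B'0 : 0 <= B' by exact: normr_ge0.
(* B is an arbitrary complex number here; the estimate at one nonzero vector shows that it is
   real. *)
have Br : B \is Num.real.
  have h0 : `|(const_mx (d / 2) : P)| < d.
    apply: (@le_lt_trans _ _ (d / 2)).
      by apply: norm_plane_le; rewrite ?mxE ?ger0_norm // ?divr_ge0 // ltW.
    by rewrite ltr_pdivrMr // ltr_pMr // ltr1n.
  have n0 : 0 < `|(const_mx (d / 2) : P)| ^+ 2.
    rewrite exprn_gt0 // normr_gt0; apply/eqP => /rowP/(_ 0); rewrite !mxE => /eqP.
    by rewrite mulf_eq0 (gt_eqF d0) /= invr_eq0 pnatr_eq0.
  have := H _ h0 => HH; apply: ger0_real.
  by rewrite -(pmulr_lge0 _ n0); apply: le_trans HH.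
have {}H h : `|h| < d -> `|X (p + h) - X p - h *m J| <= B' * `|h| ^+ 2.
  move=> hd; apply: le_trans (H _ hd) _.
  by rewrite ler_wpM2r ?exprn_ge0 // real_ler_norm.
have [K K0 JK] := mulrow_bound J.
have cJ : continuous (mulmxr J : P -> P).
  move=> x; apply/(@cvgrPdist_lt _ _ _ _ (nbhs_filter x)) => e e0 /=; near=> y.
  rewrite -mulmxBl; apply: le_lt_trans (JK _) _.
  apply: (@le_lt_trans _ _ ((K + 1) * `|x - y|)); first by rewrite ler_wpM2r // lerDl.
  rewrite mulrC -ltr_pdivlMr ?ltr_wpDl //.
  near: y; apply: cvgr_dist_lt => //; by rewrite divr_gt0 // ltr_wpDl.
have dE : 'd X p = mulmxr J :> (P -> P) /\ differentiable X p.
  have E : forall e : C, 0 < e -> \forall h \near (0 : P),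
      `|X (h + p) - (X p + h *m J)| <= e * `|h|.
    move=> e e0; near=> h; rewrite opprD addrA [h + p]addrC.
    apply: le_trans (H _ _) _; first by near: h; exact: near_norm_lt.
    rewrite expr2 mulrA ler_wpM2r //.
    apply: (@le_trans _ _ ((B' + 1) * `|h|)); first by rewrite ler_wpM2r // lerDl.
    rewrite mulrC -ler_pdivlMr ?ltr_wpDl //; apply: ltW; near: h.
    by apply: near_norm_lt; rewrite divr_gt0 // ltr_wpDl.
  have dE : 'd X p = mulmxr J :> (P -> P).
    by apply: diff_unique => //; apply/eqaddoP; exact: E.
  split; first exact: dE.
  apply/diff_locallyP; split; first by rewrite dE; exact: cJ.
  apply/eqaddoP; rewrite dE; exact: E.
by split; [exact: dE.2|move=> h; rewrite dE.1].
Unshelve. all: by end_near. Qed.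

(** What is used of a holomorphic field: the Taylor series of its components, a matrix J of partial
    derivatives that has expansions itself, and a quadratic remainder uniform in the base point,
    which identifies J with the differential near 0. Vectors being rows, row i of J is the
    derivative in the i-th variable. *)
Definition vf_data X (a : 'I_2 -> pser2 C) (J : P -> 'M[C]_2) :=
  [/\ forall k, holo (fun p => X p 0 k) (a k),
      forall k, has_exp (fun p => J p 0 k) (dx (a k)),
      forall k, has_exp (fun p => J p 1 k) (dy (a k)) &
      exists B d : C, [/\ 0 <= B, 0 < d & forall p h, `|p| < d -> `|h| < d ->
        `|X (p + h) - X p - h *m J p| <= B * `|h| ^+ 2]].

Lemma holomorphic_vf_data X : holomorphic_vf X -> exists a J, vf_data X a J.
Proof.
move=> hX.
have [a0 h0] := (holomorphicP _).1 (hX 0); have [a1 h1] := (holomorphicP _).1 (hX 1).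
have [f00 [f10 [e00 e10 [B0 [d0 [B00 d00 H0]]]]]] := holo_diff h0.
have [f01 [f11 [e01 e11 [B1 [d1 [B10 d10 H1]]]]]] := holo_diff h1.
exists (fun k => if k == 0 then a0 else a1).
pose J (p : P) : 'M[C]_2 := \matrix_(i, j) if i == 0 then (if j == 0 then f00 p else f01 p)
                                           else (if j == 0 then f10 p else f11 p).
exists J.
split.
- move=> k; case: (ord2P k) => -> /=; [exact: h0|exact: h1].
- move=> k; case: (ord2P k) => -> /=.
    by apply: has_exp_eq (holo_exp e00); near=> p; rewrite mxE.
  by apply: has_exp_eq (holo_exp e01); near=> p; rewrite mxE.
- move=> k; case: (ord2P k) => -> /=.
    by apply: has_exp_eq (holo_exp e10); near=> p; rewrite mxE.
  by apply: has_exp_eq (holo_exp e11); near=> p; rewrite mxE.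
have [d [d_gt0 l0 l1]] := common_lower d00 d10.
exists (B0 + B1), d; split; [by rewrite addr_ge0|exact: d_gt0|].
move=> p h pd hd.
have hJ k : (X (p + h) - X p - h *m J p) 0 k =
    X (p + h) 0 k - X p 0 k - (J p 0 k * h 0 0 + J p 1 k * h 0 1).
  by rewrite ![J p _ _ * _]mulrC -mulmx2E !mxE.
apply: norm_plane_le; first by rewrite mulr_ge0 ?addr_ge0 ?exprn_ge0.
  rewrite hJ !mxE /=; apply: le_trans (H0 _ _ (lt_le_trans pd l0) (lt_le_trans hd l0)) _.
  by rewrite ler_wpM2r ?exprn_ge0 // lerDl.
rewrite hJ !mxE /=; apply: le_trans (H1 _ _ (lt_le_trans pd l1) (lt_le_trans hd l1)) _.
by rewrite ler_wpM2r ?exprn_ge0 // lerDr.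
Unshelve. all: by end_near. Qed.

Lemma vf_data_diff X a J : vf_data X a J ->
  \forall p \near (0 : P), forall h, 'd X p h = h *m J p.
Proof.
move=> [_ _ _ [B [d [B0 d0 H]]]]; near=> p.
have pd : `|p| < d by near: p; exact: near_norm_lt.
by have [_] := diff_of_bound d0 (fun h => H p h pd).
Unshelve. all: by end_near. Qed.

Lemma vf_data_exp X a J k : vf_data X a J -> has_exp (fun p => X p 0 k) (a k).
Proof. by move=> [H _ _ _]; exact: holo_exp. Qed.

Definition fpair (a : 'I_2 -> pser2 C) : pser2 C * pser2 C := (a 0, a 1).

Lemma lie_bracket_formal X Y a J b L : vf_data X a J -> vf_data Y b L ->
  (\forall p \near (0 : P), lie_bracket X Y p = 0) ->
  forall k, act (fpair a) (b k) = act (fpair b) (a k).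
Proof.
move=> dX dY XY k.
have EX j := vf_data_exp j dX; have EY j := vf_data_exp j dY.
have DX := vf_data_diff dX; have DY := vf_data_diff dY.
have [_ x1 x2 _] := dX; have [_ y1 y2 _] := dY.
apply: (has_exp_uniq (f := fun p => X p 0 0 * L p 0 k + X p 0 1 * L p 1 k)
                    (g := fun p => Y p 0 0 * J p 0 k + Y p 0 1 * J p 1 k)).
- near=> p.
  have : lie_bracket X Y p = 0 by near: p.
  have HY : forall h, 'd Y p h = h *m L p by near: p; exact: DY.
  have HX : forall h, 'd X p h = h *m J p by near: p; exact: DX.
  have <- : X p *m L p - Y p *m J p = lie_bracket X Y p :=
    congr2 (fun u v => u - v) (esym (HY (X p))) (esym (HX (Y p))).
  move=> /subr0_eq /rowP /(_ k); rewrite (mulmx2E (X p)) (mulmx2E (Y p)) => E.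
  exact: E.
- by apply: has_expD; apply: has_expM; [exact: EX|exact: y1|exact: EX|exact: y2].
- by apply: has_expD; apply: has_expM; [exact: EY|exact: x1|exact: EY|exact: x2].
Unshelve. all: by end_near. Qed.

Definition liftF (d : option C) X : P -> P := fun p =>
  let x := X (blowup_chart d p) in
  match d with
  | Some c => vec2 (p 0 0 * x 0 0) (x 0 1 - (p 0 1 + c) * x 0 0)
  | None => vec2 (x 0 0 - p 0 0 * x 0 1) (p 0 1 * x 0 1)
  end.

Fixpoint liftwF (w : seq (option C)) X := if w is d :: w' then liftwF w' (liftF d X) else X.

(** The charts are quadratic and their remainder is the product of the two coordinates of h. The
    wedge is a determinant, so a matrix moves from one argument to the other as its adjugate; hence
    the form of [liftF]. *)
Lemma blowup_diff (d : option C) p : differentiable (blowup_chart d) p /\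
  forall h X, wedge ('d (blowup_chart d) p h) (X (blowup_chart d p)) = wedge h (liftF d X p).
Proof.
pose J : 'M[C]_2 := match d with
  | Some c => \matrix_(i, j) if i == 0 then (if j == 0 then 1 else p 0 1 + c)
                             else (if j == 0 then 0 else p 0 0)
  | None => \matrix_(i, j) if i == 0 then (if j == 0 then p 0 1 else 0)
                             else (if j == 0 then p 0 0 else 1) end.
have hJ0 h : (h *m J) 0 0 = if d is Some c then h 0 0 else h 0 0 * p 0 1 + h 0 1 * p 0 0.
  by rewrite mulmx2E /J; case: d {J} => [c|]; rewrite !mxE /= ?mulr1 ?mulr0 ?addr0.
have hJ1 h : (h *m J) 0 1 =
    if d is Some c then h 0 0 * (p 0 1 + c) + h 0 1 * p 0 0 else h 0 1.
  by rewrite mulmx2E /J; case: d {J hJ0} => [c|]; rewrite !mxE /= ?mulr1 ?mulr0 ?add0r.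
have H h : `|h| < 1 ->
    `|blowup_chart d (p + h) - blowup_chart d p - h *m J| <= 1 * `|h| ^+ 2.
  move=> _; rewrite mul1r; have hh : `|h 0 0 * h 0 1| <= `|h| ^+ 2.
    by rewrite normrM expr2 ler_pM // norm_coord.
  have hh0 : `|(0 : C)| <= `|h| ^+ 2 by rewrite normr0 exprn_ge0.
  apply: norm_plane_le; first by rewrite exprn_ge0.
    rewrite [X in `|X|](_ : _ = if d is Some _ then 0 else h 0 0 * h 0 1); last first.
      rewrite mxE [(- (h *m J)) _ _]mxE hJ0 mxE [(- blowup_chart d p) _ _]mxE.
      by case: d {J hJ0 hJ1} => [c|] /=; rewrite !vec2_0 !mxE; ring.
    by case: d {J hJ0 hJ1}.
  rewrite [X in `|X|](_ : _ = if d is Some _ then h 0 0 * h 0 1 else 0); last first.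
    rewrite mxE [(- (h *m J)) _ _]mxE hJ1 mxE [(- blowup_chart d p) _ _]mxE.
    by case: d {J hJ0 hJ1} => [c|] /=; rewrite !vec2_1 !mxE; ring.
  by case: d {J hJ0 hJ1}.
have [D E] := diff_of_bound ltr01 H; split=> // h X; rewrite E /wedge hJ0 hJ1.
case: d {J hJ0 hJ1 H D E} => [c|]; rewrite /liftF vec2_0 vec2_1; ring.
Qed.

Lemma blow_down_differentiable w p : differentiable (@blow_down R w) p.
Proof.
elim: w => [|d w IH]; first exact: (ex_diff (is_diff_def := is_diff_id p)).
exact: (differentiable_comp IH (blowup_diff d _).1).
Qed.

Lemma wedge_blow_down w p h X :
  wedge ('d (@blow_down R w) p h) (X (blow_down w p)) = wedge h (liftwF w X p).
Proof.
elim: w X => [|d w IH] X.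
  have E : 'd (@blow_down R [::]) p = id :> (P -> P) :=
    diff_val (is_diff_def := is_diff_id p).
  exact: (congr1 (fun g : P -> P => wedge (g h) (X p)) E).
have E : 'd (@blow_down R (d :: w)) p =
    'd (blowup_chart d) (blow_down w p) \o 'd (@blow_down R w) p :> (P -> P) :=
  diff_comp (blow_down_differentiable w p) (blowup_diff d (blow_down w p)).1.
apply: etrans (congr1 (fun g : P -> P => wedge (g h) (X (blow_down (d :: w) p))) E) _.
apply: etrans ((blowup_diff d (blow_down w p)).2 _ X) _.
exact: IH.
Qed.

Definition has_exp2 X (A : pser2 C * pser2 C) :=
  has_exp (fun p => X p 0 0) A.1 /\ has_exp (fun p => X p 0 1) A.2.

Lemma liftF_exp d X A : has_exp2 X A -> has_exp2 (liftF d X) (blift d A).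
Proof.
move=> [X0 X1].
have cE k (a : pser2 C) : has_exp (fun p => X p 0 k) a ->
    has_exp (fun p => X (blowup_chart d p) 0 k) (pb d a).
  move=> Xa; rewrite pbE.
  have e0 : has_exp (fun p => blowup_chart d p 0 0) (chart d).1.
    case: d => [c|] /=.
      apply: (@has_exp_eq _ (fun p => p 0 0)); first by near=> p; rewrite vec2_0.
      exact: has_exp_xx.
    apply: (@has_exp_eq _ (fun p => p 0 0 * p 0 1)).
      by near=> p; rewrite vec2_0.
    by apply: has_expM; [exact: has_exp_xx|exact: has_exp_yy].
  have e1 : has_exp (fun p => blowup_chart d p 0 1) (chart d).2.
    case: d {e0} => [c|] /=.
      apply: (@has_exp_eq _ (fun p => p 0 0 * (p 0 1 + c))).
        by near=> p; rewrite vec2_1.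
      apply: has_expM; first exact: has_exp_xx.
      by apply: has_expD; [exact: has_exp_yy|exact: has_exp_cst].
    apply: (@has_exp_eq _ (fun p => p 0 1)); first by near=> p; rewrite vec2_1.
    exact: has_exp_yy.
  apply: has_exp_eq (has_exp_comp Xa e0 e1 (vge_chart1 d) (vge_chart2 d)).
  by near=> p; congr (X _ _ _); apply: planeP; rewrite ?vec2_0 ?vec2_1.
have cE0 := cE 0 _ X0; have cE1 := cE 1 _ X1 => {cE}.
case: d cE0 cE1 => [c|] cE0 cE1; split => /=.
- apply: (@has_exp_eq _ (fun p => p 0 0 * X (blowup_chart (Some c) p) 0 0)).
    by near=> p; rewrite /liftF vec2_0.
  by apply: has_expM; [exact: has_exp_xx|exact: cE0].
- apply: (@has_exp_eq _ (fun p => X (blowup_chart (Some c) p) 0 1 -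
      (p 0 1 + c) * X (blowup_chart (Some c) p) 0 0)).
    by near=> p; rewrite /liftF vec2_1.
  apply: has_expB; [exact: cE1|apply: has_expM; last exact: cE0].
  by apply: has_expD; [exact: has_exp_yy|exact: has_exp_cst].
- apply: (@has_exp_eq _ (fun p => X (blowup_chart None p) 0 0 -
      p 0 0 * X (blowup_chart None p) 0 1)).
    by near=> p; rewrite /liftF vec2_0.
  apply: has_expB; first exact: cE0.
  by apply: has_expM; [exact: has_exp_xx|exact: cE1].
- apply: (@has_exp_eq _ (fun p => p 0 1 * X (blowup_chart None p) 0 1)).
    by near=> p; rewrite /liftF vec2_1.
  by apply: has_expM; [exact: has_exp_yy|exact: cE1].
Unshelve. all: by end_near. Qed.

Lemma liftwF_exp w X A : has_exp2 X A -> has_exp2 (liftwF w X) (bliftw w A).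
Proof. by elim: w X A => [|d w IH] X A //= XA; apply/IH/liftF_exp. Qed.

Lemma vf_data_exp2 X a J : vf_data X a J -> has_exp2 X (fpair a).
Proof. by move=> dX; split; exact: vf_data_exp dX. Qed.

(** Expansions are unique, so parallelism of germs becomes parallelism of series. *)
Lemma strict_transform_formal X a J w W b L : vf_data X a J -> vf_data W b L ->
  strict_transform X w W -> wdg (fpair b) (bliftw w (fpair a)) = 0.
Proof.
move=> dX dW [_ _ H].
have [X0 X1] := liftwF_exp w (vf_data_exp2 dX).
have [W0 W1] := vf_data_exp2 dW.
apply: (has_exp_uniq (f := fun p => wedge (W p) (liftwF w X p)) (g := fun=> 0)).
- apply: filterS H => p; rewrite wedge_blow_down; exact: id.
- by apply: has_expB; apply: has_expM; [exact: W0|exact: X1|exact: W1|exact: X0].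
- by rewrite -(rmorph0 (@cser C)); exact: has_exp_cst.
Qed.

Lemma has_exp_at0 f (a : pser2 C) : has_exp f a -> f 0 = ev0 a.
Proof.
move=> /(_ 1%N)[B B0 /nbhs_singleton].
rewrite normr0 mulr0 normr_le0 subr_eq0 => /eqP ->.
by rewrite pevE !big_ord1 !expr0 !mulr1 ev0E.
Qed.

Lemma linear_part_vf X a J : vf_data X a J -> linear_part X = J 0.
Proof.
move=> /vf_data_diff/nbhs_singleton H.
apply/matrixP => i j; rewrite /linear_part /jacobian mxE H mulmx2E !mxE /=.
by case: (ord2P i) => -> /=; rewrite ?mul1r ?mul0r ?addr0 ?add0r.
Qed.

Lemma linear_part_coef X a J : vf_data X a J ->
  forall k, linear_part X 0 k = ev0 (dx (a k)) /\ linear_part X 1 k = ev0 (dy (a k)).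
Proof.
move=> dX k; rewrite (linear_part_vf dX); have [_ h1 h2 _] := dX.
by rewrite (has_exp_at0 (h1 k)) (has_exp_at0 (h2 k)).
Qed.

Lemma det2 (A : 'M[C]_2) : \det A = A 0 0 * A 1 1 - A 0 1 * A 1 0.
Proof.
rewrite (expand_det_row _ 0) big_ord_recl big_ord1 /cofactor !det_mx11 !mxE /=.
rewrite expr0 expr1 mul1r mulN1r mulrN.
by congr (A _ _ * A _ _ - A _ _ * A _ _); apply: val_inj.
Qed.

Lemma tr_det_formal X a J : vf_data X a J ->
  \tr (linear_part X) = jac_tr (fpair a) /\ \det (linear_part X) = jac_det (fpair a).
Proof.
move=> dX; have H := linear_part_coef dX; split.
  have [h00 _] := H 0; have [_ h11] := H 1.
  rewrite /mxtrace big_ord_recl big_ord1 /jac_tr /= -h00 -h11.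
  by congr (_ + linear_part X _ _); apply: val_inj.
have [h00 h01] := H 0; have [h10 h11] := H 1.
by rewrite det2 /jac_det /= -h00 -h11 -h01 -h10; ring.
Qed.

Lemma vf_at0 X a J : vf_data X a J -> forall k, X 0 0 k = ev0 (a k).
Proof. by move=> dX k; rewrite (has_exp_at0 (vf_data_exp k dX)). Qed.

Lemma eigenvalues_tr_det (A : 'M[C]_2) l m : eigenvalues A l m ->
  \tr A = l + m /\ \det A = l * m.
Proof.
rewrite /eigenvalues => E; have := @char_poly_trace _ 2 A isT.
have := char_poly_det A; rewrite E.
have -> : ('X - l%:P) * ('X - m%:P) = 'X^2 - (l + m)%:P * 'X + (l * m)%:P.
  by rewrite rmorphD rmorphM /=; ring.
rewrite !coefD !coefN !coefXn !coefCM !coefX !coefC /= mulr0 mulr1 subr0 add0r addr0.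
rewrite sub0r sqrrN expr1n mul1r => <- /oppr_inj <-.
by [].
Qed.

(** Cayley-Hamilton for a singular matrix. *)
Lemma sqr_det0 (A : 'M[C]_2) : \det A = 0 -> A *m A = \tr A *: A.
Proof.
have trE : \tr A = A 0 0 + A 1 1.
  by rewrite /mxtrace big_ord_recl big_ord1; congr (_ + A _ _); apply: val_inj.
rewrite det2 => d0.
apply/matrixP => i j; rewrite mulmx2E !mxE trE.
case: (ord2P i) => ->; case: (ord2P j) => ->.
- by apply/eqP; rewrite -subr_eq0 -oppr_eq0 -d0; apply/eqP; ring.
- by ring.
- by ring.
- by apply/eqP; rewrite -subr_eq0 -oppr_eq0 -d0; apply/eqP; ring.
Qed.

(** By [sqr_det0], A^(k+1) is (tr A)^k times A; the trace of a vanishing power gives tr A = 0. *)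
Lemma nilpotent_tr_det (A : 'M[C]_2) : nilpotent_mx A -> \tr A = 0 /\ \det A = 0.
Proof.
move=> [n An].
have d0 : \det A = 0.
  have : \det (A ^+ n) = 0 by rewrite An det0.
  have -> : \det (A ^+ n) = \det A ^+ n.
    by elim: n {An} => [|n IH]; rewrite ?expr0 ?det1 // !exprS det_mulmx IH.
  by move/eqP; rewrite expf_eq0 => /andP[_ /eqP].
split=> //.
have sq : A * A = \tr A *: A := sqr_det0 d0.
have pw k : A ^+ k.+1 = \tr A ^+ k *: A.
  elim: k => [|k IH]; first by rewrite expr0 scale1r.
  by rewrite exprS IH -scalerAr sq scalerA exprSr.
case: n An => [|n].
  rewrite expr0 => /matrixP /(_ 0 0); rewrite !mxE => /eqP.
  by rewrite oner_eq0.
rewrite pw => /(congr1 mxtrace); rewrite mxtraceZ linear0 => /eqP.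
by rewrite mulf_eq0 expf_eq0 => /orP[/andP[_]|] /eqP.
Qed.

End VectorFields.

(** * The invariant curve *)

Section Curve.
Variable K : numFieldType.
Local Notation S := (pser2 K).
Implicit Types (f g h u v : S) (b t q : K).

Lemma coef2M_x f g n : (f * g) n 0%N = \sum_(i < n.+1) f i 0%N * g (n - i)%N 0%N.
Proof. by rewrite coef2M; apply: eq_bigr => i _; rewrite big_ord1. Qed.

Lemma psubst_vgeB N u v u' v' f : vge 1 u -> vge 1 v -> vge 1 u' -> vge 1 v' ->
  vge N (u - u') -> vge N (v - v') -> vge N (psubst u v f - psubst u' v' f).
Proof.
move=> u1 v1 u1' v1' uu vv.
apply: (vge_trans (@psubst_approx _ _ _ u1 v1 N f)).
apply: (@vge_trans _ _ _ (psubst_trunc N u' v' f)); last first.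
  by apply: vge_sym; exact: psubst_approx.
have vX (w w' : S) i : vge N (w - w') -> vge N (w ^+ i - w' ^+ i).
  move=> ww; elim: i => [|i IH]; first by rewrite !expr0 subrr; exact: vge_zero.
  by rewrite !exprS; exact: vgeMB.
rewrite psubst_trunc.unlock -sumrB; apply: vge_sum => i _.
rewrite -sumrB; apply: vge_sum => j _; apply: vgeMB _ (vX _ _ j vv).
apply: vgeMB _ (vX _ _ i uu); rewrite subrr; exact: vge_zero.
Qed.

(** Without linear terms substitution gains one order: write f = x g + y h with g and h of order
    one. This makes [cstep] a contraction. *)
Lemma psubst_vge2B N u v u' v' f : vge 2 f ->
  vge 1 u -> vge 1 v -> vge 1 u' -> vge 1 v' ->
  vge N (u - u') -> vge N (v - v') -> vge N.+1 (psubst u v f - psubst u' v' f).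
Proof.
move=> f2 u1 v1 u1' v1' uu vv.
have [g [h [fE g1 h1]]] := vge_split f2.
rewrite fE !psubstD (psubstM _ _ u1 v1) (psubstM _ _ u1 v1) (psubstM _ _ u1' v1').
rewrite (psubstM _ _ u1' v1') (psubst_xx u1 v1) (psubst_xx u1' v1').
rewrite (psubst_yy u1 v1) (psubst_yy u1' v1').
have X (w w' k : S) : vge 1 k -> vge 1 w -> vge 1 w' -> vge N (w - w') ->
    vge N.+1 (w * psubst u v k - w' * psubst u' v' k).
  move=> k1 w1 w1' ww.
  have -> : w * psubst u v k - w' * psubst u' v' k =
    (w - w') * psubst u v k + w' * (psubst u v k - psubst u' v' k) by pring.
  apply: vgeD.
    by rewrite -[N.+1]addn1; apply: vgeM => //; exact: psubst_vge.
  by rewrite -[N.+1]add1n; apply: vgeM => //; exact: psubst_vgeB.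
have -> : forall a b c d : S, a + b - (c + d) = (a - c) + (b - d) by move=> *; ring.
by apply: vgeD; apply: X.
Qed.

(* Up to a constant, these weights (0 at n = 0, since 0^-1 = 0) dominate their own
   convolution square; this makes the majorant of the invariant curve converge. *)
Definition wt n : K := (n%:R ^+ 2)^-1.

Lemma wt_ge0 n : 0 <= wt n.
Proof. by rewrite invr_ge0 exprn_ge0. Qed.

Lemma wt_le1 n : wt n <= 1.
Proof.
case: n => [|n]; first by rewrite /wt expr0n invr0.
by rewrite invf_le1 ?exprn_gt0 // exprn_ege1 // ler1n.
Qed.

(** Telescoping, from 1 / (n + 1)^2 <= 1 / n - 1 / (n + 1). *)
Lemma sum_wt n : \sum_(i < n.+1) wt i <= 2.
Proof.
suff H : \sum_(i < n.+1) wt i <= 2 - (n == 0%N)%:R - n%:R^-1.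
  by apply: le_trans H _; rewrite -addrA gerDl -opprD oppr_le0 addr_ge0 // invr_ge0.
elim: n => [|n IH]; first by rewrite big_ord1 /wt expr0n invr0 subr0 subr_ge0 ler_nat.
rewrite big_ord_recr /=; case: n IH => [|n] IH.
  by rewrite big_ord1 /wt expr0n invr0 expr1n invr1 add0r subr0 -[2]/(1 + 1) addrK.
apply: le_trans (lerD IH (lexx _)) _; rewrite /= !subr0.
rewrite -addrA lerD2l.
have a0 : (n.+1%:R : K) != 0 by rewrite pnatr_eq0.
have b0 : (n.+2%:R : K) != 0 by rewrite pnatr_eq0.
rewrite -subr_ge0 /wt.
have -> : - n.+2%:R^-1 - (- n.+1%:R^-1 + (n.+2%:R ^+ 2)^-1) =
   (n.+1%:R * n.+2%:R ^+ 2)^-1 :> K.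
  have E : n.+2%:R = n.+1%:R + 1 :> K by rewrite natr1.
  move: a0 b0; rewrite E; move: (n.+1%:R : K) => z a0 b0.
  by field; rewrite a0 b0.
by rewrite invr_ge0 mulr_ge0 // exprn_ge0.
Qed.

(** Since (i + j)^2 <= 2 (i^2 + j^2), each term is at most 2 wt(n) (wt(i) + wt(n - i)). The weights
    sum to at most 2, whence 8 = 2 (2 + 2). *)
Lemma wt_conv n : \sum_(i < n.+1) wt i * wt (n - i)%N <= 8 * wt n.
Proof.
apply: (@le_trans _ _ (\sum_(i < n.+1) 2 * wt n * (wt i + wt (n - i)%N))).
  apply: ler_sum => i _; have : (i <= n)%N by rewrite -ltnS.
  move: (nat_of_ord i) => {}i iln.
  have w0 : wt 0 = 0 by rewrite /wt expr0n invr0.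
  have R0 : 0 <= 2 * wt n * (wt i + wt (n - i)%N).
    by rewrite !mulr_ge0 ?addr_ge0 ?wt_ge0.
  have [i0|i0] := posnP i; first by rewrite {1}i0 w0 mul0r.
  have [ni0|ni0] := posnP (n - i)%N; first by rewrite {1}ni0 w0 mulr0.
  have nE : n = (i + (n - i))%N by rewrite subnKC.
  move: (n - i)%N ni0 nE {R0 iln} => j j0 ->.
  rewrite /wt natrD; set x : K := i%:R; set y : K := j%:R.
  have x0 : 0 < x by rewrite ltr0n.
  have y0 : 0 < y by rewrite ltr0n.
  rewrite -subr_ge0.
  have -> : 2 * ((x + y) ^+ 2)^-1 * ((x ^+ 2)^-1 + (y ^+ 2)^-1) - (x ^+ 2)^-1 * (y ^+ 2)^-1 =
    (x - y) ^+ 2 * ((x + y) ^+ 2 * x ^+ 2 * y ^+ 2)^-1.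
    have xy : x + y != 0 by rewrite lt0r_neq0 // addr_gt0.
    by field; rewrite xy !lt0r_neq0.
  rewrite mulr_ge0 //; last by rewrite invr_ge0 !mulr_ge0 ?exprn_ge0 ?addr_ge0 ?ltW.
  by rewrite real_exprn_even_ge0 // realB // ?realn.
rewrite -mulr_sumr big_split /=.
have -> : \sum_(i < n.+1) wt (n - i)%N = \sum_(i < n.+1) wt i.
  rewrite (reindex_inj rev_ord_inj) /=; apply: eq_bigr => i _.
  by rewrite subSS subKn // -ltnS.
have -> : 8 * wt n = 2 * wt n * (2 + 2) by rewrite -natrD mulrAC -natrM.
by rewrite ler_wpM2l ?mulr_ge0 ?wt_ge0 // lerD // sum_wt.
Qed.

Definition wbound u b := forall n, `|u n 0%N| <= b * wt n.

Lemma wboundM u v b t : wbound u b -> wbound v t -> wbound (u * v) (8 * (b * t)).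
Proof.
move=> ub vt n; rewrite coef2M_x; apply: le_trans (ler_norm_sum _ _ _) _.
have b0 : 0 <= b by have := ub 1%N; rewrite /wt expr1n invr1 mulr1; exact: le_trans.
have t0 : 0 <= t by have := vt 1%N; rewrite /wt expr1n invr1 mulr1; exact: le_trans.
have -> : 8 * (b * t) * wt n = b * t * (8 * wt n) by ring.
apply: le_trans (ler_wpM2l (mulr_ge0 b0 t0) (wt_conv n)).
rewrite mulr_sumr; apply: ler_sum => i _.
by rewrite normrM mulrACA ler_pM.
Qed.

(** A product of k factors costs k - 1 convolutions, hence 8^(k - 1) b^k. Degree 0 is excluded
    because the weight at 0 is 0. *)
Lemma wbound_mono u v b i j : wbound u b -> wbound v b -> (0 < i + j)%N ->
  wbound (u ^+ i * v ^+ j) ((8 * b) ^+ (i + j) / 8).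
Proof.
have n8 : (8 : K) != 0 by rewrite pnatr_eq0.
have step (w z : S) k : wbound w b -> ((0 < k)%N -> wbound z ((8 * b) ^+ k / 8)) ->
    (k = 0%N -> z = 1) -> wbound (w * z) ((8 * b) ^+ k.+1 / 8).
  move=> wb zb z1; have [k0|k0] := posnP k.
    by rewrite (z1 k0) mulr1 k0 expr1 mulrC mulKf.
  have -> : (8 * b) ^+ k.+1 / 8 = 8 * (b * ((8 * b) ^+ k / 8)) by rewrite exprS; ring.
  exact: wboundM wb (zb k0).
move=> ub vb; elim: i => [|i IH].
  rewrite expr0 mul1r add0n; elim: j => // j IH _.
  by rewrite exprS; apply: step => // ->; rewrite expr0.
move=> _; rewrite exprS -mulrA addSn; apply: step => //.
by move/eqP; rewrite addn_eq0 => /andP[/eqP-> /eqP->]; rewrite !expr0 mulr1.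
Qed.

(** As 8 b = r t / 2, a term of degree k is at most M t^k / (8 2^k) times the weight, with t^k <=
    t^2; the geometric double sum contributes 4. The square of t, against a b proportional to t,
    keeps the iteration in its ball. *)
Lemma wbound_psubst u v h (M r b t : K) : vge 2 h -> vge 1 u -> vge 1 v ->
  0 < r -> cauchy_bound h r M -> wbound u b -> wbound v b ->
  0 <= t -> t <= 1 -> 16 * b = r * t ->
  wbound (psubst u v h) (M * t ^+ 2 / 2).
Proof.
move=> h2 u1 v1 r0 hM ub vb t0 t1 bt n.
have M0 := cauchy_bound_ge0 hM.
have b0 : 0 <= b by have := ub 1%N; rewrite /wt expr1n invr1 mulr1; exact: le_trans.
rewrite (@coef_psubst _ _ _ u1 v1 n.+1) ?addn0 //.
have -> : M * t ^+ 2 / 2 * wt n = M * t ^+ 2 / 8 * wt n * 4.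
  have n2 : (2 : K) != 0 by rewrite pnatr_eq0.
  have -> : (8 : K) = 2 * 4 by rewrite -natrM.
  have n4 : (4 : K) != 0 by rewrite pnatr_eq0.
  by field.
have D0 : 0 <= M * t ^+ 2 / 8 * wt n.
  by rewrite mulr_ge0 ?wt_ge0 // divr_ge0 // mulr_ge0 // exprn_ge0.
apply: le_trans (ler_wpM2l D0 (@sum2_half _ n.+1 n.+1)).
apply: le_trans (ler_norm_sum _ _ _) _; rewrite mulr_sumr; apply: ler_sum => i _.
apply: le_trans (ler_norm_sum _ _ _) _; rewrite mulr_sumr; apply: ler_sum => j _.
have [ij|ij] := ltnP (i + j) 2.
  by rewrite h2 // mul0r normr0 mulr_ge0 // exprn_ge0 // invr_ge0.
have W := wbound_mono ub vb (leq_trans (ltn0Sn 1) ij) n.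
rewrite normrM; apply: le_trans (ler_wpM2l (normr_ge0 _) W) _.
have E : 8 * b = r * (t * 2^-1).
  have -> : r * (t * 2^-1) = (16 * b) * 2^-1 by rewrite bt mulrA.
  by have -> : (16 : K) = 8 * 2 by [rewrite -natrM]; field.
have -> : `|h i j| * ((8 * b) ^+ (i + j) / 8 * wt n) =
  (`|h i j| * r ^+ (i + j)) * (t ^+ (i + j) / 8 * wt n * 2^-1 ^+ (i + j)).
  by rewrite E !exprMn; ring.
have -> : M * t ^+ 2 / 8 * wt n * 2^-1 ^+ (i + j) =
   M * (t ^+ 2 / 8 * wt n * 2^-1 ^+ (i + j)) by ring.
have x0 : 0 <= t ^+ (i + j) / 8 by rewrite divr_ge0 // exprn_ge0.
have p0 : 0 <= (2^-1 : K) ^+ (i + j) by rewrite exprn_ge0 // invr_ge0.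
have w0 := wt_ge0 n; have q0 : 0 <= t ^+ (i + j) / 8 * wt n by exact: mulr_ge0.
apply: ler_pM; first by rewrite mulr_ge0 // exprn_ge0 // ltW.
- exact: mulr_ge0.
- exact: hM.
apply: (ler_wpM2r p0); apply: (ler_wpM2r w0); apply: ler_wpM2r; first by rewrite invr_ge0.
exact: ler_wiXn2l.
Qed.

(* The parameter of a curve is encoded by the variable x of two-variable series. *)
Definition xonly u := forall i j, u i j.+1 = 0.

Lemma xonlyP u : xonly u <-> dy u = 0.
Proof.
split=> [H|H i j]; first by apply: pser2P => i j; rewrite coef2_dy H mul0rn !pcoef0.
move: (coef2_dy u i j); rewrite H !pcoef0 => /esym/eqP.
by rewrite mulrn_eq0 /= => /eqP.
Qed.

Lemma xonly_psubst u v f : vge 1 u -> vge 1 v -> xonly u -> xonly v -> xonly (psubst u v f).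
Proof.
move=> u1 v1 /xonlyP ux /xonlyP vx; apply/xonlyP.
by rewrite (dy_psubst _ u1 v1) ux vx !mulr0 addr0.
Qed.

(** * The recursion for the curve, solved as a fixed point *)

Section Recursion.
Variables (h0 h1 : S) (c00 c01 c10 c11 : nat -> K) (e0 e1 : K).
Hypotheses (h02 : vge 2 h0) (h12 : vge 2 h1).

(** Here e is a component of the prescribed tangent vector, and (c n, c' n) will be a row of the
    inverse of q n - DY(0), applied from n = 2 on to the nonlinear part of Y along the curve p. *)
Definition cstep (c c' : nat -> K) e (p : S * S) : S := PSer (fun n => pser_const
  (if n is m.+1 then if m is 0%N then e else
     c n * (psubst p.1 p.2 h0) n 0%N + c' n * (psubst p.1 p.2 h1) n 0%N else 0)).

Lemma coef_cstep c c' e p n : cstep c c' e p n 0%N =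
  if n is m.+1 then if m is 0%N then e else
     c n * (psubst p.1 p.2 h0) n 0%N + c' n * (psubst p.1 p.2 h1) n 0%N else 0.
Proof. by rewrite /cstep /= pcoef_const. Qed.

Lemma cstep_xonly c c' e p : xonly (cstep c c' e p).
Proof. by move=> i j; rewrite /cstep /= pcoef_const. Qed.

Lemma cstep_vge1 c c' e p : vge 1 (cstep c c' e p).
Proof. by apply/vge1P; rewrite ev0E coef_cstep. Qed.

Lemma cstep_vgeB c c' e p p' N : vge 1 p.1 -> vge 1 p.2 -> vge 1 p'.1 -> vge 1 p'.2 ->
  vge N.+1 (p.1 - p'.1) -> vge N.+1 (p.2 - p'.2) ->
  vge N.+2 (cstep c c' e p - cstep c c' e p').
Proof.
move=> u1 v1 u1' v1' uu vv i [|j] ij; last by rewrite !pcoefB !cstep_xonly subrr.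
rewrite addn0 in ij.
have E k : vge 2 k -> psubst p.1 p.2 k i 0%N = psubst p'.1 p'.2 k i 0%N.
  move=> k2; apply/eqP; rewrite -subr_eq0 -!pcoefB; apply/eqP.
  by apply: (psubst_vge2B k2 u1 v1 u1' v1' uu vv); rewrite addn0.
rewrite !pcoefB !coef_cstep (E _ h02) (E _ h12); exact: subrr.
Qed.

Definition citer k : S * S :=
  iter k (fun p => (cstep c00 c01 e0 p, cstep c10 c11 e1 p)) (0, 0).

Lemma citer_vge1 k : vge 1 (citer k).1 /\ vge 1 (citer k).2.
Proof. by case: k => [|k]; split; try exact: vge_zero; exact: cstep_vge1. Qed.

Lemma citer_xonly k : xonly (citer k).1 /\ xonly (citer k).2.
Proof.
case: k => [|k]; split; try exact: cstep_xonly; by move=> i j; rewrite !pcoef0.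
Qed.

Lemma citer_near k : vge k.+1 ((citer k.+1).1 - (citer k).1) /\
  vge k.+1 ((citer k.+1).2 - (citer k).2).
Proof.
elim: k => [|k [IH1 IH2]].
  by split; apply: vgeB; (exact: cstep_vge1 || exact: vge_zero).
have [a1 a2] := citer_vge1 k; have [b1 b2] := citer_vge1 k.+1.
by split; apply: cstep_vgeB.
Qed.

Lemma citer_near_le k n : (k <= n)%N -> vge k.+1 ((citer n).1 - (citer k).1) /\
  vge k.+1 ((citer n).2 - (citer k).2).
Proof.
elim: n => [|n IH]; first by rewrite leqn0 => /eqP ->; rewrite !subrr; split; exact: vge_zero.
rewrite leq_eqVlt => /orP[/eqP->|]; first by rewrite !subrr; split; exact: vge_zero.
rewrite ltnS => kn; have [I1 I2] := IH kn; have [N1 N2] := citer_near n.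
by split; apply: vge_trans; [apply: vgeW N1|exact: I1|apply: vgeW N2|exact: I2].
Qed.

(** Row n is taken from the n-th iterate, after which it no longer changes. *)
Definition climit : S * S :=
  (PSer (fun n => (citer n).1 n), PSer (fun n => (citer n).2 n)).

Lemma climit_xonly : xonly climit.1 /\ xonly climit.2.
Proof. by split=> i j; [exact: (citer_xonly i).1|exact: (citer_xonly i).2]. Qed.

Lemma climit_near k : vge k.+1 (climit.1 - (citer k).1) /\ vge k.+1 (climit.2 - (citer k).2).
Proof.
split=> i [|j] ij; rewrite pcoefB pcoefB.
- rewrite addn0 ltnS in ij; have [+ _] := citer_near_le ij.
  by move=> /vge_sym/(_ i 0%N); rewrite addn0 !pcoefB; apply.
- by rewrite climit_xonly.1 (citer_xonly k).1 subrr.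
- rewrite addn0 ltnS in ij; have [_ +] := citer_near_le ij.
  by move=> /vge_sym/(_ i 0%N); rewrite addn0 !pcoefB; apply.
- by rewrite climit_xonly.2 (citer_xonly k).2 subrr.
Qed.

Lemma climit_vge1 : vge 1 climit.1 /\ vge 1 climit.2.
Proof. by have := climit_near 0; rewrite !subr0. Qed.

Lemma climit_fix : climit.1 = cstep c00 c01 e0 climit /\ climit.2 = cstep c10 c11 e1 climit.
Proof.
have [l1 l2] := climit_vge1.
split; apply: vge_eq => N.
  have [n1 n2] := climit_near N; have [a1 a2] := citer_vge1 N.
  have [m1 _] := climit_near N.+1; apply: vge_trans (vgeW _ m1) _; first by rewrite leqW.
  apply: vge_sym; apply: (@vgeW _ _ N.+2); first by rewrite leqW.
  exact: cstep_vgeB.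
have [n1 n2] := climit_near N; have [a1 a2] := citer_vge1 N.
have [_ m1] := climit_near N.+1; apply: vge_trans (vgeW _ m1) _; first by rewrite leqW.
apply: vge_sym; apply: (@vgeW _ _ N.+2); first by rewrite leqW.
exact: cstep_vgeB.
Qed.

Section Bound.
Variables (r M k t b : K).
Hypotheses (r0 : 0 < r) (h0M : cauchy_bound h0 r M)
  (h1M : cauchy_bound h1 r M) (t0 : 0 <= t) (t1 : t <= 1)
  (bt : 16 * b = r * t) (ktb : k * (M * t ^+ 2) <= b)
  (k00 : forall n, `|c00 n| <= k) (k01 : forall n, `|c01 n| <= k)
  (k10 : forall n, `|c10 n| <= k) (k11 : forall n, `|c11 n| <= k)
  (e0b : `|e0| <= b) (e1b : `|e1| <= b).

(** The hypothesis [ktb] closes the loop: the two nonlinear terms together contribute at most k M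
    t^2, hence at most b. *)
Lemma cstep_wbound c c' e p : vge 1 p.1 -> vge 1 p.2 ->
  (forall n, `|c n| <= k) -> (forall n, `|c' n| <= k) -> `|e| <= b ->
  wbound p.1 b -> wbound p.2 b -> wbound (cstep c c' e p) b.
Proof.
move=> p1 p2 ck ck' eb b1 b2 n; rewrite coef_cstep.
have b0 : 0 <= b by apply: le_trans eb.
case: n => [|[|n]]; first by rewrite normr0 mulr_ge0 // wt_ge0.
  by rewrite /wt expr1n invr1 mulr1.
have H0 := wbound_psubst h02 p1 p2 r0 h0M b1 b2 t0 t1 bt n.+2.
have H1 := wbound_psubst h12 p1 p2 r0 h1M b1 b2 t0 t1 bt n.+2.
apply: le_trans (ler_wpM2r (wt_ge0 _) ktb); apply: le_trans (ler_normD _ _) _.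
have -> : k * (M * t ^+ 2) * wt n.+2 =
    k * (M * t ^+ 2 / 2 * wt n.+2) + k * (M * t ^+ 2 / 2 * wt n.+2).
  have n2 : (2 : K) != 0 by rewrite pnatr_eq0.
  by move: (wt _) => w; field.
by apply: lerD; rewrite normrM ler_pM.
Qed.

Lemma citer_wbound n : wbound (citer n).1 b /\ wbound (citer n).2 b.
Proof.
have b0 : 0 <= b by apply: le_trans e0b.
elim: n => [|n [IH1 IH2]].
  by split=> n; rewrite !pcoef0 normr0 mulr_ge0 // wt_ge0.
have [a1 a2] := citer_vge1 n.
by split; apply: cstep_wbound.
Qed.

Lemma climit_wbound : wbound climit.1 b /\ wbound climit.2 b.
Proof. by split=> n; [exact: (citer_wbound n).1|exact: (citer_wbound n).2]. Qed.

End Bound.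
End Recursion.

Lemma cramer2 (n a00 a01 a10 a11 d x y z w : K) :
  (n - a00) * (n - a11) - a10 * a01 = d -> d != 0 ->
  d * x = (n - a11) * z + a10 * w -> d * y = a01 * z + (n - a00) * w ->
  n * x = z + a00 * x + a10 * y /\ n * y = w + a01 * x + a11 * y.
Proof.
move=> dE d0 dx dy; split; apply/eqP; rewrite -subr_eq0 -(mulrI_eq0 _ (mulfI d0)).
  have -> : d * (n * x - (z + a00 * x + a10 * y)) =
    n * (d * x) - d * z - a00 * (d * x) - a10 * (d * y) by ring.
  by apply/eqP; rewrite dx dy -dE; ring.
have -> : d * (n * y - (w + a01 * x + a11 * y)) =
  n * (d * y) - d * w - a01 * (d * x) - a11 * (d * y) by ring.
by apply/eqP; rewrite dx dy -dE; ring.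
Qed.

Section Spectral.
Variables (b0 b1 : S) (q p e0 e1 r M : K).
Let j00 := ev0 (dx b0).
Let j10 := ev0 (dy b0).
Let j01 := ev0 (dx b1).
Let j11 := ev0 (dy b1).
Hypotheses (b00 : ev0 b0 = 0) (b10 : ev0 b1 = 0) (q0 : q != 0) (pq : `|p| <= `|q|)
  (tr_qp : j00 + j11 = q + p) (det_qp : j00 * j11 - j10 * j01 = q * p)
  (eig0 : q * e0 = j00 * e0 + j10 * e1) (eig1 : q * e1 = j01 * e0 + j11 * e1).

(** The characteristic polynomial of DY(0) at q n, factored by its roots q and p. *)
Lemma det_shift n : (q * n%:R - j00) * (q * n%:R - j11) - j10 * j01 =
  q * (n%:R - 1) * (q * n%:R - p).
Proof.
transitivity (q * n%:R * (q * n%:R) - q * n%:R * (j00 + j11) +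
  (j00 * j11 - j10 * j01)); first by ring.
by rewrite tr_qp det_qp; ring.
Qed.

(** The choice of q enters here: |q (n + 2) - p| >= |q| (n + 2) - |p| >= |q| (n + 1). *)
Lemma det_shift_ge n :
  `|q| ^+ 2 * n.+1%:R ^+ 2 <= `|q * (n.+2%:R - 1) * (q * n.+2%:R - p)|.
Proof.
have -> : n.+2%:R - 1 = n.+1%:R :> K by rewrite -[n.+2%:R]natr1 addrK.
rewrite normrM normrM normr_nat.
have -> : `|q| ^+ 2 * n.+1%:R ^+ 2 = `|q| * n.+1%:R * (`|q| * n.+1%:R) by ring.
apply: ler_wpM2l; first by rewrite mulr_ge0.
apply: le_trans (lerB_dist _ _); rewrite normrM normr_nat.
rewrite -[n.+2%:R]natr1 mulrDr mulr1 -addrA lerDl subr_ge0.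
exact: pq.
Qed.

Let D n := q * (n%:R - 1) * (q * n%:R - p).

Lemma det_shift_neq0 n : (1 < n)%N -> D n != 0.
Proof.
case: n => [|[|n]] // _; rewrite -normr_gt0; apply: lt_le_trans (det_shift_ge n).
by rewrite mulr_gt0 ?exprn_gt0 // normr_gt0.
Qed.

(** Numerators grow linearly in n and the determinant quadratically, so the entries of the inverse
    matrices have a common bound. *)
Lemma shift_bound (L z : K) n : `|z| <= L -> (1 < n)%N ->
  `|(q * n%:R - z) / D n| <= 2 * (`|q| + L) / `|q| ^+ 2 /\
  `|z / D n| <= 2 * (`|q| + L) / `|q| ^+ 2.
Proof.
move=> zL; case: n => [|[|n]] // _.
have L0 : 0 <= L by apply: le_trans zL.
have nq : 0 < `|q| by rewrite normr_gt0.
have D0 := det_shift_neq0 (isT : (1 < n.+2)%N).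
have DD := det_shift_ge n.
have Q0 : 0 < `|q| ^+ 2 by rewrite exprn_gt0.
have N1 : (1 : K) <= n.+1%:R by rewrite ler1n.
suff H (w : K) : `|w| <= (`|q| + L) * n.+2%:R -> `|w / D n.+2| <= 2 * (`|q| + L) / `|q| ^+ 2.
  split; apply: H.
    apply: le_trans (ler_normB _ _) _; rewrite normrM normr_nat mulrDl lerD2l.
    by apply: le_trans zL _; rewrite ler_peMr // ler1n.
  apply: le_trans zL _; apply: (@le_trans _ _ (L * n.+2%:R)).
    by rewrite ler_peMr // ler1n.
  by rewrite ler_wpM2r // lerDr.
move=> wB; rewrite normrM normfV ler_pdivrMr ?normr_gt0 //.
apply: (le_trans wB); apply: (le_trans _ (ler_wpM2l _ DD)); last first.
  by rewrite divr_ge0 ?exprn_ge0 // mulr_ge0 // addr_ge0.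
have -> : 2 * (`|q| + L) / `|q| ^+ 2 * (`|q| ^+ 2 * n.+1%:R ^+ 2) =
   (`|q| + L) * (2 * n.+1%:R ^+ 2).
  have Q1 : `|q| != 0 by rewrite gt_eqF.
  by move: (n.+1%:R : K) => x; field.
apply: ler_wpM2l; first by rewrite addr_ge0.
apply: (@le_trans _ _ (2 * n.+1%:R)).
  by rewrite -natrM ler_nat mul2n -addnn addSn ltnS leq_addl.
by rewrite ler_wpM2l // expr2 ler_peMr.
Qed.

Let h0 := b0 - cser j00 * xx K - cser j10 * yy K.
Let h1 := b1 - cser j01 * xx K - cser j11 * yy K.

Hypotheses (r0 : 0 < r) (b0M : cauchy_bound b0 r M)
  (b1M : cauchy_bound b1 r M).

Lemma cauchy_higher f : ev0 f = 0 -> cauchy_bound f r M ->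
  cauchy_bound (f - cser (ev0 (dx f)) * xx K - cser (ev0 (dy f)) * yy K) r M.
Proof.
move=> ff fM i j; have M0 := cauchy_bound_ge0 fM.
have [ij|ij] := ltnP (i + j) 2; first by rewrite vge2P // normr0 mul0r.
have -> : (f - cser (ev0 (dx f)) * xx K - cser (ev0 (dy f)) * yy K) i j = f i j; last exact: fM.
rewrite !pcoefB !coef2_cstM coef2_xx coef2_yy.
by case: i ij => [|[|i]]; case: j => [|[|j]] //= ij; rewrite !mulr0 !subr0.
Qed.

(* The curve s |-> (u s, v s) solves q s gamma' = Y gamma. Its n-th coefficient is
   determined by the lower ones through q n - DY(0), which is invertible for n > 1,
   with uniformly bounded inverse, because |p| <= |q|. *)
Lemma curve_exists : exists t b u v, [/\ 0 < t, wbound u b /\ wbound v b,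
  [/\ xonly u, xonly v, vge 1 u & vge 1 v],
  u 1%N 0%N = t * e0 /\ v 1%N 0%N = t * e1 &
  cser q * (xx K * dx u) = psubst u v b0 /\ cser q * (xx K * dx v) = psubst u v b1].
Proof.
pose L := `|j00| + `|j01| + `|j10| + `|j11|.
pose k := 2 * (`|q| + L) / `|q| ^+ 2.
have Lj : [/\ `|j00| <= L, `|j01| <= L, `|j10| <= L & `|j11| <= L].
  have LE : L = `|j01| + `|j00| + `|j10| + `|j11| by rewrite /L; ring.
  split; rewrite {1}/L.
  - by rewrite -!addrA lerDl !addr_ge0.
  - by rewrite -/L LE -!addrA lerDl !addr_ge0.
  - by rewrite -addrA addrC -addrA lerDl !addr_ge0.
  - by rewrite lerDr !addr_ge0.
have L0 : 0 <= L by rewrite !addr_ge0.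
have M0 := cauchy_bound_ge0 b0M.
have k0 : 0 <= k by rewrite divr_ge0 ?exprn_ge0 // mulr_ge0 // addr_ge0.
(* With b = r t / 16 the condition k M t^2 <= b reads 16 k M t <= r; the summand r in the
   denominator also gives t <= 1. *)
pose t := r / (16 * k * M + r).
have kM0 : 0 <= 16 * k * M by rewrite mulr_ge0 // mulr_ge0.
have d0 : 0 < 16 * k * M + r by rewrite ltr_wpDl.
have t0 : 0 < t by rewrite divr_gt0.
have t1 : t <= 1 by rewrite ler_pdivrMr // mul1r lerDr.
pose b := r * t / 16; have b_gt0 : 0 < b by rewrite divr_gt0 // mulr_gt0.
have bt : 16 * b = r * t by rewrite mulrC divfK // pnatr_eq0.
have ktb : k * (M * t ^+ 2) <= b.
  rewrite ler_pdivlMr //; have -> : k * (M * t ^+ 2) * 16 = (16 * k * M * t) * t by ring.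
  rewrite ler_wpM2r ?(ltW t0) // /t mulrA ler_pdivrMr // mulrC ler_wpM2l ?(ltW r0) //.
  by rewrite lerDl ltW.
pose ee := `|e0| + `|e1| + 1; have ee0 : 0 < ee by rewrite ltr_wpDl // addr_ge0.
(* An eigenvector may be rescaled: s shrinks it into the ball of radius b. *)
pose s := b / ee; have s0 : 0 < s by rewrite divr_gt0.
have sb (e : K) : `|e| <= ee -> `|s * e| <= b.
  by move=> eee; rewrite normrM (gtr0_norm s0) /s mulrAC ler_pdivrMr // ler_pM2l.
(* The determinant is controlled only for n > 1; the values at 0 and 1 are never read by [cstep]. *)
pose cut (c : nat -> K) n := if (1 < n)%N then c n else 0.
have cutb c : (forall n, (1 < n)%N -> `|c n| <= k) -> forall n, `|cut c n| <= k.
  by move=> H n; rewrite /cut; case: ifP => [/H//|_]; rewrite normr0.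
pose c00 := cut (fun n => (q * n%:R - j11) / D n).
pose c01 := cut (fun n => j10 / D n).
pose c10 := cut (fun n => j01 / D n).
pose c11 := cut (fun n => (q * n%:R - j00) / D n).
have [J00 J01 J10 J11] := Lj.
have h02 : vge 2 h0 by exact: vge2P.
have h12 : vge 2 h1 by exact: vge2P.
have k00 : forall n, `|c00 n| <= k by apply: cutb => n n1; have [] := shift_bound J11 n1.
have k01 : forall n, `|c01 n| <= k by apply: cutb => n n1; have [] := shift_bound J10 n1.
have k10 : forall n, `|c10 n| <= k by apply: cutb => n n1; have [] := shift_bound J01 n1.
have k11 : forall n, `|c11 n| <= k by apply: cutb => n n1; have [] := shift_bound J00 n1.
have eb0 : `|s * e0| <= b by apply: sb; rewrite /ee -addrA lerDl addr_ge0.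
have eb1 : `|s * e1| <= b by apply: sb; rewrite /ee addrAC lerDr addr_ge0.
have [W0 W1] := climit_wbound h02 h12 r0 (cauchy_higher b00 b0M) (cauchy_higher b10 b1M)
  (ltW t0) t1 bt ktb k00 k01 k10 k11 eb0 eb1.
have [x0 x1] := climit_xonly h0 h1 c00 c01 c10 c11 (s * e0) (s * e1).
have [v0 v1] := climit_vge1 c00 c01 c10 c11 (s * e0) (s * e1) h02 h12.
have [F0 F1] := climit_fix c00 c01 c10 c11 (s * e0) (s * e1) h02 h12.
move: (climit _ _ _ _ _ _ _ _) W0 W1 x0 x1 v0 v1 F0 F1 => [u v] /= W0 W1 x0 x1 v0 v1 F0 F1.
exists s, b, u, v; split=> //.
  by split; [rewrite F0|rewrite F1]; rewrite coef_cstep.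
have lin c0 c1 c2 : psubst u v (c0 - cser c1 * xx K - cser c2 * yy K) =
   psubst u v c0 - cser c1 * u - cser c2 * v.
  rewrite !psubstB !(psubstM _ _ v0 v1) (psubst_xx v0 v1) (psubst_yy v0 v1).
  by rewrite !(psubst_cst v0 v1).
have P0 := lin b0 j00 j10; have P1 := lin b1 j01 j11.
have R n : (1 < n)%N ->
    D n * u n 0%N = (q * n%:R - j11) * psubst u v h0 n 0%N + j10 * psubst u v h1 n 0%N /\
    D n * v n 0%N = j01 * psubst u v h0 n 0%N + (q * n%:R - j00) * psubst u v h1 n 0%N.
  move=> n1; have Dn := det_shift_neq0 n1.
  have U := congr1 (fun f : S => f n 0%N) F0; have V := congr1 (fun f : S => f n 0%N) F1.
  rewrite coef_cstep in U; rewrite coef_cstep in V.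
  move: n1 Dn U V; case: n => [|[|n]] //= _ Dn -> ->; rewrite /c00 /c01 /c10 /c11 /cut /=.
  by split; move: (psubst _ _ _ _ _) (psubst _ _ _ _ _) Dn; move=> z z' Dn; field.
have X (w : S) n : (cser q * (xx K * dx w)) n 0%N = q * n%:R * w n 0%N.
  rewrite coef2_cstM coef2_xxM; case: n => [|n]; first by rewrite mulr0 mul0r.
  by rewrite coef2_dx -mulrA mulr_natl.
have Xo (w : S) : xonly w -> xonly (cser q * (xx K * dx w)).
  move=> wx i j; rewrite coef2_cstM coef2_xxM; case: i => [|i]; first by rewrite mulr0.
  by rewrite coef2_dx wx mul0rn mulr0.
have G (w z : S) : xonly w -> xonly z -> (forall n, w n 0%N = z n 0%N) -> w = z.
  by move=> wx zx H; apply: pser2P => i [|j] //; rewrite wx zx.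
have bE0 : psubst u v b0 = psubst u v h0 + cser j00 * u + cser j10 * v.
  by rewrite P0; ring.
have bE1 : psubst u v b1 = psubst u v h1 + cser j01 * u + cser j11 * v.
  by rewrite P1; ring.
have u1 : u 1%N 0%N = s * e0 by rewrite F0 coef_cstep.
have v11 : v 1%N 0%N = s * e1 by rewrite F1 coef_cstep.
have q20 : psubst u v h0 1%N 0%N = 0 by apply: (psubst_vge v0 v1 h02).
have q21 : psubst u v h1 1%N 0%N = 0 by apply: (psubst_vge v0 v1 h12).
have q00 : psubst u v h0 0%N 0%N = 0 by apply: (psubst_vge v0 v1 h02).
have q01 : psubst u v h1 0%N 0%N = 0 by apply: (psubst_vge v0 v1 h12).
have u00 : u 0%N 0%N = 0 by apply: v0.
have v00 : v 0%N 0%N = 0 by apply: v1.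
(* Degree 0 is trivial, degree 1 is the eigenvector equation, and higher degrees are solved by
   [cramer2]. *)
split; apply: G; try exact: Xo; try exact: xonly_psubst.
- case=> [|[|n]]; rewrite X ?bE0 ?bE1 !pcoefD !coef2_cstM.
  + by rewrite u00 v00 q00 !mulr0 !addr0.
  + by rewrite u1 v11 q20 mulr1 add0r mulrCA eig0; ring.
  have [R0 R1] := R n.+2 isT; have Dn := det_shift_neq0 (isT : (1 < n.+2)%N).
  exact: (cramer2 (det_shift n.+2) Dn R0 R1).1.
- case=> [|[|n]]; rewrite X ?bE0 ?bE1 !pcoefD !coef2_cstM.
  + by rewrite u00 v00 q01 !mulr0 !addr0.
  + by rewrite u1 v11 q21 mulr1 add0r mulrCA eig1; ring.
  have [R0 R1] := R n.+2 isT; have Dn := det_shift_neq0 (isT : (1 < n.+2)%N).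
  exact: (cramer2 (det_shift n.+2) Dn R0 R1).2.
Qed.

(* As X and Y commute, U = X o gamma solves the linear equation
   q s U' = DY(gamma) U, whose only solution in O(s^2) is 0. *)
Lemma curve_in_zeros (a : bool -> S) u v :
  (forall k, act (b0, b1) (a k) = a true * dx (if k then b0 else b1) +
                                  a false * dy (if k then b0 else b1)) ->
  xonly u -> xonly v -> vge 1 u -> vge 1 v ->
  cser q * (xx K * dx u) = psubst u v b0 -> cser q * (xx K * dx v) = psubst u v b1 ->
  (forall k, vge 2 (psubst u v (a k))) -> forall k, psubst u v (a k) = 0.
Proof.
move=> ab ux vx u1 v1 bu bv a2 k; apply: vge_eq0 => N; move: k.
(* [true] and [false] index the first and the second coordinate. *)
pose U k := psubst u v (a k).
have eqU k : cser q * (xx K * dx (U k)) =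
   U true * psubst u v (dx (if k then b0 else b1)) +
   U false * psubst u v (dy (if k then b0 else b1)).
  rewrite -!(psubstM _ _ u1 v1) -psubstD -ab /act /= psubstD !(psubstM _ _ u1 v1).
  by rewrite -bu -bv /U (dx_psubst _ u1 v1); pring.
have Ux k : xonly (U k) by exact: xonly_psubst.
(* At the lowest order n only the constant term of DY along the curve contributes. *)
have coefU n k : (1 < n)%N -> (forall k, vge n (U k)) ->
    q * n%:R * U k n 0%N = ev0 (dx (if k then b0 else b1)) * U true n 0%N +
      ev0 (dy (if k then b0 else b1)) * U false n 0%N.
  move=> n1 Un; have := congr1 (fun f : S => f n 0%N) (eqU k).
  have low g h : vge n g -> (g * h) n 0%N = ev0 h * g n 0%N.
    move=> gn; rewrite coef2M_x big_ord_recr /= big1 ?add0r.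
      by rewrite subnn ev0E mulrC.
    by move=> i _; rewrite gn ?mul0r // addn0.
  rewrite pcoefD pcoefD (low _ _ (Un true)) (low _ _ (Un false)) !(ev0_psubst u1 v1) coef2_cstM coef2_xxM.
  case: n n1 {Un low} => // n _; rewrite coef2_dx => <-.
  by rewrite -mulrA mulr_natl.
elim: N => [|N IH] k; first exact: vge0.
have [N2|N2] := ltnP N 2; first exact: (vgeW N2 (a2 k)).
have D0 := det_shift_neq0 N2.
have E0 := coefU N true N2 IH; have E1 := coefU N false N2 IH.
(* The coefficients of order N lie in the kernel of q N - DY(0), whose determinant [D N] is
   nonzero. *)
have Z : U true N 0%N = 0 /\ U false N 0%N = 0.
  move: E0 E1 D0 (det_shift N); rewrite /= -/j00 -/j10 -/j01 -/j11 -/(D N).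
  move: (U true N 0%N) (U false N 0%N) (q * N%:R) (D N) => x y n d E0 E1 d0 dE.
  split; apply: (mulfI d0); rewrite mulr0 -dE.
    transitivity ((n - j11) * (n * x - j00 * x - j10 * y) + j10 * (n * y - j01 * x - j11 * y)).
      by ring.
    by rewrite E0 E1; ring.
  transitivity ((n - j00) * (n * y - j01 * x - j11 * y) + j01 * (n * x - j00 * x - j10 * y)).
    by ring.
  by rewrite E0 E1; ring.
move=> i [|j]; last by rewrite (Ux k).
rewrite addn0 ltnS leq_eqVlt => /orP[/eqP ->|iN]; first by case: k; rewrite ?Z.1 ?Z.2.
by apply: IH; rewrite addn0.
Qed.

End Spectral.
End Curve.

(** * Restriction to a curve *)

Section PolynomialMajorants.
Variable K : numFieldType.
Implicit Types (p q : {poly K}) (u v : pser2 K) (a : nat -> nat -> K).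

Definition pmaj p q := forall i, `|p`_i| <= q`_i.

Lemma pmajM p q p' q' : pmaj p p' -> pmaj q q' -> pmaj (p * q) (p' * q').
Proof.
move=> pp qq i; rewrite !coefM; apply: le_trans (ler_norm_sum _ _ _) _.
by apply: ler_sum => j _; rewrite normrM ler_pM.
Qed.

Lemma pmajX p q n : pmaj p q -> pmaj (p ^+ n) (q ^+ n).
Proof.
move=> pq; elim: n => [|n IH]; last by rewrite !exprS; exact: pmajM.
by move=> i; rewrite !expr0 coef1 normr_nat.
Qed.

Lemma pmaj_sum n (F G : 'I_n -> {poly K}) : (forall i, pmaj (F i) (G i)) ->
  pmaj (\sum_(i < n) F i) (\sum_(i < n) G i).
Proof.
move=> FG i; rewrite !coef_sum; apply: le_trans (ler_norm_sum _ _ _) _.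
by apply: ler_sum => j _; exact: FG.
Qed.

(** Each power of |s| / t contributes a factor 1 / 2, and only powers from N on occur. *)
Lemma pmaj_horner p q (s t : K) N : pmaj p q -> (forall i, (i < N)%N -> p`_i = 0) ->
  `|s| * 2 <= t -> `|p.[s]| <= 2^-1 ^+ N * q.[t].
Proof.
move=> pq p0 st; have t0 : 0 <= t by apply: le_trans st; rewrite mulr_ge0.
have q0 i : 0 <= q`_i by apply: le_trans (pq i).
rewrite (horner_coef_wide s (leq_maxl (size p) (size q))).
rewrite (horner_coef_wide t (leq_maxr (size p) (size q))) mulr_sumr.
apply: le_trans (ler_norm_sum _ _ _) _; apply: ler_sum => i _.
have T0 : 0 <= 2^-1 ^+ N * (q`_i * t ^+ i).
  by rewrite !mulr_ge0 ?exprn_ge0 // invr_ge0.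
have [iN|iN] := ltnP i N; first by rewrite p0 // mul0r normr0.
rewrite normrM normrX mulrCA; apply: ler_pM; rewrite ?exprn_ge0 //.
apply: (@le_trans _ _ ((2^-1 * t) ^+ i)).
  by apply: lerXn2r; rewrite ?nnegrE // ?mulr_ge0 ?invr_ge0 // ler_pdivlMl // mulrC.
rewrite exprMn ler_wpM2r ?exprn_ge0 //.
by apply: ler_wiXn2l; rewrite ?invr_ge0 // invf_le1 // ler1n.
Qed.

Definition xpoly L u : {poly K} := \poly_(i < L) u i 0%N.

Definition ppoly N a p q := \sum_(i < N) \sum_(j < N) (a i j)%:P * p ^+ i * q ^+ j.

Lemma horner_ppoly N a p q s : (ppoly N a p q).[s] = rect N N a p.[s] q.[s].
Proof.
rewrite /ppoly horner_sum; apply: eq_bigr => i _.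
rewrite horner_sum; apply: eq_bigr => j _.
by rewrite !hornerM hornerC !horner_exp.
Qed.

Lemma ppoly_maj N a p q p' q' : pmaj p p' -> pmaj q q' ->
  pmaj (ppoly N a p q) (ppoly N (fun i j => `|a i j|) p' q').
Proof.
move=> pp qq; apply: pmaj_sum => i; apply: pmaj_sum => j.
apply: pmajM; last exact: pmajX.
apply: pmajM; last exact: pmajX.
by move=> k; rewrite !coefC; case: (k == 0%N); rewrite ?normr0.
Qed.

Lemma coef_ppoly N L (f : pser2 K) u v n : (n < N)%N -> (N <= L)%N ->
  vge 1 u -> vge 1 v ->
  (ppoly N (fun i j => f i j) (xpoly L u) (xpoly L v))`_n = psubst u v f n 0%N.
Proof.
move=> nN NL u1 v1; rewrite (@coef_psubst _ _ _ u1 v1 N) ?addn0 //.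
have nL : (n < L)%N by exact: leq_trans NL.
have M (p q : {poly K}) (g h : pser2 K) :
   (forall k, (k < L)%N -> p`_k = g k 0%N) -> (forall k, (k < L)%N -> q`_k = h k 0%N) ->
   forall k, (k < L)%N -> (p * q)`_k = (g * h) k 0%N.
  move=> pg qh k kL; rewrite coefM coef2M_x; apply: eq_bigr => i _.
  have ik : (i <= k)%N by rewrite -ltnS.
  by rewrite pg ?(leq_ltn_trans ik) // qh // (leq_ltn_trans (leq_subr _ _)).
have X w i : forall k, (k < L)%N -> (xpoly L w ^+ i)`_k = (w ^+ i) k 0%N.
  elim: i => [|i IH]; last first.
    by rewrite !exprS; apply: M => // k kL; rewrite coef_poly kL.
  by move=> k _; rewrite !expr0 coef1 -(rmorph1 (@cser K)) coef2_cst andbT; case: eqP.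
rewrite coef_sum; apply: eq_bigr => i _; rewrite coef_sum; apply: eq_bigr => j _.
by rewrite -mulrA coefCM; congr (_ * _); apply: M => //; exact: X.
Qed.

Lemma sum_half_pow (t : K) L : 0 <= t -> t * 2 <= 1 ->
  \sum_(i < L) (if (i == 0 :> nat)%N then 0 else t ^+ i) <= 2 * t.
Proof.
move=> t0 t2; case: L => [|L]; first by rewrite big_ord0 mulr_ge0.
rewrite big_ord_recl /= add0r.
apply: (@le_trans _ _ (\sum_(i < L) t * 2^-1 ^+ i)).
  apply: ler_sum => i _; rewrite /bump /= exprS ler_wpM2l //.
  apply: lerXn2r; rewrite ?nnegrE ?invr_ge0 //.
  by rewrite -[2^-1]mul1r ler_pdivlMr.
by rewrite -mulr_sumr mulrC ler_wpM2r // sum_half.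
Qed.

(** As the series f(u, v) is zero, the polynomial built from the truncations of f, u and v has no
    term of degree below N. Its majorant at t is at most 4 M, and [pmaj_horner] supplies the decay
    in N. *)
Lemma ppoly_bound N L (f : pser2 K) u v (b r M s t : K) : (N <= L)%N ->
  vge 1 u -> vge 1 v -> psubst u v f = 0 ->
  (forall n, `|u n 0%N| <= b) -> (forall n, `|v n 0%N| <= b) ->
  0 < r -> cauchy_bound f r M ->
  t * 2 <= 1 -> b * t * 4 <= r -> `|s| * 2 <= t ->
  `|rect N N (fun i j => f i j) (xpoly L u).[s] (xpoly L v).[s]| <= 4 * M * 2^-1 ^+ N.
Proof.
move=> NL u1 v1 uv0 ub vb r0 fM t2 bt st.
have t0 : 0 <= t by apply: le_trans st; rewrite mulr_ge0.
have b0 : 0 <= b by apply: le_trans (ub 0%N).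
have M0 := cauchy_bound_ge0 fM.
pose mu (w : pser2 K) : {poly K} := \poly_(i < L) `|w i 0%N|.
have muP w : pmaj (xpoly L w) (mu w).
  by move=> i; rewrite !coef_poly; case: ifP; rewrite ?normr0.
have mub w : vge 1 w -> (forall n, `|w n 0%N| <= b) -> 0 <= (mu w).[t] <= r / 2.
  move=> w1 wb; rewrite horner_poly sumr_ge0 /=; last first.
    by move=> i _; rewrite mulr_ge0 // exprn_ge0.
  apply: (@le_trans _ _ (b * (2 * t))); last first.
    rewrite ler_pdivlMr //; apply: le_trans bt.
    have -> : b * (2 * t) * 2 = b * t * (2 * 2) by ring.
    by rewrite -natrM.
  apply: le_trans (ler_wpM2l b0 (sum_half_pow L t0 t2)); rewrite mulr_sumr.
  apply: ler_sum => i _; case: eqP => [->|_]; first by rewrite w1 // normr0 mul0r mulr0.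
  by rewrite ler_wpM2r // exprn_ge0.
rewrite -horner_ppoly.
have H0 i : (i < N)%N -> (ppoly N (fun i j => f i j) (xpoly L u) (xpoly L v))`_i = 0.
  by move=> iN; rewrite coef_ppoly // uv0 !pcoef0.
apply: le_trans (pmaj_horner (ppoly_maj N _ (muP u) (muP v)) H0 st) _.
rewrite mulrC ler_wpM2r ?exprn_ge0 ?invr_ge0 // horner_ppoly.
have /andP[mu0 mur] := mub u u1 ub; have /andP[mv0 mvr] := mub v v1 vb.
rewrite mulrC; apply: le_trans (ler_wpM2l M0 (@sum2_half _ N N)).
rewrite /rect mulr_sumr; apply: ler_sum => i _; rewrite mulr_sumr; apply: ler_sum => j _.
apply: (@le_trans _ _ (`|f i j| * (r / 2) ^+ i * (r / 2) ^+ j)).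
  have r20 : 0 <= r / 2 by apply: le_trans mur.
  apply: ler_pM; rewrite ?mulr_ge0 ?exprn_ge0 //; last by apply: lerXn2r; rewrite ?nnegrE.
  by rewrite ler_wpM2l //; apply: lerXn2r; rewrite ?nnegrE.
have -> : `|f i j| * (r / 2) ^+ i * (r / 2) ^+ j = `|f i j| * r ^+ (i + j) * 2^-1 ^+ (i + j).
  by rewrite !exprMn !exprD; ring.
by rewrite ler_wpM2r // exprn_ge0 // invr_ge0.
Qed.

End PolynomialMajorants.

Section Vanishing.
Variable R : realType.
Local Notation C := (R[i]^o).
Local Notation P := ('rV[R[i]^o]_2).
Implicit Types (f g : P -> C) (p q h : P) (X Y W : P -> P) (a b u v : pser2 C).

Lemma cvg_rect N (a : nat -> nat -> C) (x y : nat -> C) (l m : C) :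
  x @ \oo --> l -> y @ \oo --> m ->
  (fun n => rect N N a (x n) (y n)) @ \oo --> rect N N a l m.
Proof.
move=> xl ym.
have X (z : nat -> C) (k : C) i : z @ \oo --> k -> (fun n => z n ^+ i) @ \oo --> k ^+ i.
  move=> zk; elim: i => [|i IH]; first exact: cvg_cst.
  have -> : (fun n => z n ^+ i.+1) = z \* (fun n => z n ^+ i).
    by apply/funext => n; rewrite exprS.
  by rewrite exprS; exact: (cvgM zk IH).
apply: cvg_big => [|i _]; first exact: add_continuous.
apply: cvg_big => [|j _]; first exact: add_continuous.
apply: cvgM; last exact: X.
by apply: cvgM; [exact: cvg_cst|exact: X].
Qed.

Lemma pev_xonly u L p : xonly u -> pev L u p = (xpoly L u).[p 0 0].
Proof.
move=> ux; rewrite horner_poly; apply: eq_bigr => i _.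
case: L i => [[]//|L] i; rewrite big_ord_recl /= expr0 mulr1 big1 ?addr0 // => j _.
by rewrite ux !mul0r.
Qed.

(** The zero series as expansion would only make f(g1, g2) flat at 0. Actual vanishing comes from
    the geometric bound of [ppoly_bound]: the truncations of u and v first tend to their sums, then
    N grows. *)
Lemma comp_vanish f a g1 g2 u v (b : C) : holo f a -> holo g1 u -> holo g2 v ->
  xonly u -> xonly v -> vge 1 u -> vge 1 v ->
  (forall n, `|u n 0%N| <= b) -> (forall n, `|v n 0%N| <= b) ->
  psubst u v a = 0 ->
  \forall p \near (0 : P), f (vec2 (g1 p) (g2 p)) = 0.
Proof.
move=> fa gu gv ux vx u1 v1 ub vb uv0.
have [r [M [r0 aM fe]]] := fa.
have [ru [Mu [_ _ ue]]] := gu; have [rv [Mv [_ _ ve]]] := gv.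
have b0 : 0 <= b by apply: le_trans (ub 0%N).
have bu : bO 1 g1 by exact: (has_exp_bO (holo_exp gu)).
have bv : bO 1 g2 by exact: (has_exp_bO (holo_exp gv)).
have fe' := near_comp bu bv fe.
(* Small enough for 2 t <= 1 and 4 b t <= r. *)
pose t := r / (r * 2 + b * 4 + 1); pose d := r * 2 + b * 4 + 1.
have rb : 0 <= r * 2 + b * 4 by rewrite addr_ge0 // mulr_ge0 // ltW.
have d0 : 0 < d by rewrite ltr_wpDl.
have t0 : 0 < t by rewrite divr_gt0.
have t2 : t * 2 <= 1.
  by rewrite /t mulrAC ler_pdivrMr // mul1r /d -addrA lerDl addr_ge0 // mulr_ge0.
have bt : b * t * 4 <= r.
  rewrite /t mulrA mulrAC ler_pdivrMr // mulrAC mulrC ler_wpM2l ?(ltW r0) //.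
  by rewrite addrAC lerDr addr_ge0 // mulr_ge0 // ltW.
have r40 : 0 < r / 4 by rewrite divr_gt0.
have n1 := bO1_lt bu r40; have n2 := bO1_lt bv r40.
have tt := near_norm_lt (divr_gt0 t0 (ltr0n C 2)).
apply: filterS (filterI (filterI fe' (filterI ue ve)) (filterI tt (filterI n1 n2))).
move=> p [[fp [up vp]] [pt' [p1 p2]]].
have pt : `|p 0 0| * 2 <= t.
  by rewrite -ler_pdivlMr //; apply: le_trans (norm_coord p 0) _; exact: ltW.
have gp : `|(vec2 (g1 p) (g2 p) : P)| * 4 <= r.
  rewrite -ler_pdivlMr //; apply: norm_plane_le; first exact: ltW.
    by rewrite vec2_0; exact: ltW.
  by rewrite vec2_1; exact: ltW.
have M0 := cauchy_bound_ge0 aM.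
apply/eqP; rewrite -normr_le0.
apply: (@le_half_limit _ _ _ (12 * M)); first by rewrite mulr_ge0.
move=> N; rewrite add0r.
have T := holo_tail_half r0 aM fp gp (leqnn N) (leqnn N).
rewrite vec2_0 vec2_1 in T.
have S : `|rect N N (fun i j => a i j) (g1 p) (g2 p) - 0| <= 4 * M * 2^-1 ^+ N.
  pose rr L : C := rect N N (fun i j => a i j) (pev L u p) (pev L v p).
  have rl : rr @ \oo --> (rect N N (fun i j => a i j) (g1 p) (g2 p) : C).
    exact: (@cvg_rect N (fun i j => a i j) _ _ _ _ up vp).
  apply: (@cvg_norm_le _ rr _ 0 _ N rl) => L NL.
  rewrite subr0 /rr (pev_xonly _ _ ux) (pev_xonly _ _ vx).
  exact: (ppoly_bound NL u1 v1 uv0 ub vb r0 aM t2 bt pt).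
rewrite subr0 in S.
rewrite -[f _](subrK (rect N N (fun i j => a i j) (g1 p) (g2 p))).
apply: le_trans (ler_normD _ _) _.
have -> : 12 * M * 2^-1 ^+ N = 8 * M * 2^-1 ^+ N + 4 * M * 2^-1 ^+ N.
  by have -> : (12 : C) = 8 + 4 by [rewrite -natrD]; rewrite !mulrDl.
exact: lerD.
Qed.

End Vanishing.

(** * Vector fields commuting with a nilpotent one *)

Section Final.
Variable R : realType.
Local Notation C := (R[i]^o).
Local Notation P := ('rV[R[i]^o]_2).
Implicit Types (f g : P -> C) (p q h : P) (X Y W : P -> P) (a b : 'I_2 -> pser2 C).

Lemma eigenvalues_exist (A : 'M[C]_2) : exists l m : C, eigenvalues A l m /\ `|m| <= `|l|.
Proof.
have [s E] := @closed_field_poly_normal R[i] (char_poly A).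
have lc : lead_coef (char_poly A) = 1 by apply/monicP; exact: char_poly_monic.
rewrite lc scale1r in E.
have := size_char_poly A; rewrite E size_prod_XsubC => -[].
case: s E => [|l [|m []]] // E _; rewrite !big_cons big_nil mulr1 in E.
have [ml|lm] := real_leP (normr_real m) (normr_real l).
  by exists l, m; split; [exact: E|exact: ml].
by exists m, l; split; [rewrite /eigenvalues mulrC; exact: E|exact: ltW].
Qed.

(** N^2 = 0 and N commutes with A: an eigenvector e of A is killed by N, or else e N is an
    eigenvector for the same eigenvalue and is killed. *)
Lemma common_eigenvector (A N : 'M[C]_2) : A *m N = N *m A -> \tr N = 0 -> \det N = 0 ->
  ~ (\tr A = 0 /\ \det A = 0) ->
  exists (l m : C) (e : P), [/\ l != 0, `|m| <= `|l|, \tr A = l + m, \det A = l * m &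
    [/\ e != 0, e *m A = l *: e & e *m N = 0]].
Proof.
move=> AN trN detN Anil.
have [l [m [lmA ml]]] := eigenvalues_exist A.
have [trA detA] := eigenvalues_tr_det lmA.
have l0 : l != 0.
  apply/eqP => l0; apply: Anil; move: ml; rewrite trA detA l0 normr0 normr_le0 => /eqP ->.
  by rewrite addr0 mulr0.
have : eigenvalue A l.
  by rewrite eigenvalue_root_char lmA rootE hornerM !hornerXsubC subrr mul0r.
move=> /eigenvalueP[e eA e0].
have N2 : N *m N = 0 by rewrite sqr_det0 // trN scale0r.
exists l, m; have [eN|eN] := eqVneq (e *m N) 0; first by exists e.
exists (e *m N); split=> //; split=> //; last by rewrite -mulmxA N2 mulmx0.
by rewrite -mulmxA -AN mulmxA eA scalemxAl.
Qed.

(** Differentiate the bracket identity at 0; second derivatives drop out because both fields vanish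
    there. *)
Lemma linear_parts_commute X Y a b J L : vf_data X a J -> vf_data Y b L ->
  X 0 = 0 -> Y 0 = 0 ->
  (forall k, act (fpair a) (b k) = act (fpair b) (a k)) ->
  linear_part Y *m linear_part X = linear_part X *m linear_part Y.
Proof.
move=> dX dY X0 Y0 ab.
have a0 k : ev0 (a k) = 0 by rewrite -(vf_at0 dX) X0 mxE.
have b0 k : ev0 (b k) = 0 by rewrite -(vf_at0 dY) Y0 mxE.
have LX := linear_part_coef dX; have LY := linear_part_coef dY.
move: (linear_part X) (linear_part Y) LX LY => A B LX LY.
apply/matrixP => i j; rewrite !mulmx2E.
have := congr1 (fun s : pser2 C => ev0 (if i == 0 then dx s else dy s)) (ab j).
rewrite /act /fpair /=; case: (ord2P i) => -> /=.
  rewrite !dxD !dxM !rmorphD !rmorphM /= !a0 !b0 !mul0r !addr0.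
  by have [-> ->] := LX j; have [-> ->] := LY j; have [-> _] := LX 0; have [-> _] := LX 1;
     have [-> _] := LY 0; have [-> _] := LY 1.
rewrite !dyD !dyM !rmorphD !rmorphM /= !a0 !b0 !mul0r !addr0.
by have [-> ->] := LX j; have [-> ->] := LY j; have [_ ->] := LX 0; have [_ ->] := LX 1;
   have [_ ->] := LY 0; have [_ ->] := LY 1.
Qed.

(** The invariant curve of Y lies in the zeros of X. Isolation would make it constant, against its
    nonzero tangent vector t e. *)
Lemma zeros_not_isolated X Y a b J L : vf_data X a J -> vf_data Y b L ->
  X 0 = 0 -> Y 0 = 0 ->
  (forall k, act (fpair a) (b k) = act (fpair b) (a k)) ->
  \tr (linear_part X) = 0 -> \det (linear_part X) = 0 ->
  ~ (\tr (linear_part Y) = 0 /\ \det (linear_part Y) = 0) ->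
  ~ \forall p \near (0 : P)^', X p != 0.
Proof.
move=> dX dY X0 Y0 ab trX detX Ynil iso.
have [q [p [e [q0 pq trY detY [e0 eY eX]]]]] :=
  common_eigenvector (linear_parts_commute dX dY X0 Y0 ab) trX detX Ynil.
have a0 k : ev0 (a k) = 0 by rewrite -(vf_at0 dX) X0 mxE.
have b0 k : ev0 (b k) = 0 by rewrite -(vf_at0 dY) Y0 mxE.
have LX := linear_part_coef dX; have LY := linear_part_coef dY.
have [trF detF] := tr_det_formal dY.
have [hX _ _ _] := dX; have [hY _ _ _] := dY.
have [r0 [M0 [r00 bM0 _]]] := hY 0; have [r1 [M1 [r10 bM1 _]]] := hY 1.
have [r [r_gt0 rle0 rle1]] := common_lower r00 r10.
have B0 : cauchy_bound (b 0) r (M0 + M1).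
  move=> i j; apply: le_trans (cauchy_bound_le (ltW r_gt0) rle0 bM0 i j) _.
  by rewrite lerDl (cauchy_bound_ge0 bM1).
have B1 : cauchy_bound (b 1) r (M0 + M1).
  move=> i j; apply: le_trans (cauchy_bound_le (ltW r_gt0) rle1 bM1 i j) _.
  by rewrite lerDr (cauchy_bound_ge0 bM0).
have tr_qp : ev0 (dx (b 0)) + ev0 (dy (b 1)) = q + p by rewrite -trY trF.
have det_qp : ev0 (dx (b 0)) * ev0 (dy (b 1)) - ev0 (dy (b 0)) * ev0 (dx (b 1)) = q * p.
  by rewrite -detY detF.
have eig k : q * e 0 k = ev0 (dx (b k)) * e 0 0 + ev0 (dy (b k)) * e 0 1.
  have := congr1 (fun x : P => x 0 k) eY; rewrite mulmx2E [RHS]mxE => <-.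
  by have [-> ->] := LY k; ring.
have [t [B [u [v [t0 [uB vB] [ux vx u1 v1] [ue ve] [qu qv]]]]]] :=
  curve_exists (b0 0) (b0 1) q0 pq tr_qp det_qp (eig 0) (eig 1) r_gt0 B0 B1.
(* Along the curve X has order two, because DX(0) kills the tangent vector. *)
have U2 k : vge 2 (psubst u v (a k)).
  have lin : psubst u v (a k) = psubst u v (a k - cser (ev0 (dx (a k))) * xx C -
      cser (ev0 (dy (a k))) * yy C) + cser (ev0 (dx (a k))) * u + cser (ev0 (dy (a k))) * v.
    rewrite !psubstB !(psubstM _ _ u1 v1) (psubst_xx u1 v1) (psubst_yy u1 v1).
    by rewrite !(psubst_cst u1 v1); pring.
  have h2 := psubst_vge u1 v1 (vge2P (a0 k)).
  move=> i [|j] ij; last by rewrite (xonly_psubst _ u1 v1 ux vx).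
  rewrite lin !pcoefD h2 // !coef2_cstM.
  case: i ij => [|[|i]] // _; first by rewrite (u1 0%N 0%N) // (v1 0%N 0%N) // !mulr0 !addr0.
  rewrite ue ve add0r; have := congr1 (fun x : P => x 0 k) eX; rewrite mulmx2E [RHS]mxE.
  have [-> ->] := LX k => E; rewrite -[RHS](mulr0 t) -E; ring.
have kill := @curve_in_zeros _ (b 0) (b 1) q p q0 pq tr_qp det_qp
  (fun k => if k then a 0 else a 1) u v.
have U0 (k : 'I_2) : psubst u v (a k) = 0.
  have {}kill := kill _ ux vx u1 v1 qu qv _.
  case: (ord2P k) => ->.
    apply: (kill _ _ true) => [[]|[]]; [exact: esym (ab 0)|exact: esym (ab 1)|exact: U2|exact: U2].
  apply: (kill _ _ false) => [[]|[]]; [exact: esym (ab 0)|exact: esym (ab 1)|exact: U2|exact: U2].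
have wb w : wbound w B -> forall n, `|w n 0%N| <= B.
  move=> wB n; apply: le_trans (wB n) _; rewrite ler_piMr ?wt_le1 //.
  by have := wB 1%N; rewrite /wt expr1n invr1 mulr1; exact: le_trans.
(* The weights are at most 1, so the series of the curve satisfy a Cauchy estimate with radius 1. *)
have cb w : xonly w -> wbound w B -> cauchy_bound w 1 B.
  move=> wx wB i [|j]; rewrite expr1n mulr1; first exact: wb.
  by rewrite wx normr0; apply: le_trans (wb _ wB 0%N).
have [g1 hu] := holo_exists ltr01 (cb u ux uB).
have [g2 hv] := holo_exists ltr01 (cb v vx vB).
have V k := comp_vanish (hX k) hu hv ux vx u1 v1 (wb u uB) (wb v vB) (U0 k).
have bu : bO 1 g1 by exact: (has_exp_bO (holo_exp hu)).
have bv : bO 1 g2 by exact: (has_exp_bO (holo_exp hv)).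
have iso' : \forall p \near (0 : P), p != 0 -> X p != 0 by exact: iso.
have N := near_comp bu bv iso'.
have G : \forall p \near (0 : P), g1 p = 0 /\ g2 p = 0.
  apply: filterS (filterI N (filterI (V 0) (V 1))) => z [zX [z0 z1]].
  have [E|E] := eqVneq (vec2 (g1 z) (g2 z) : P) 0.
    by have := E => /rowP E'; have := E' 0; have := E' 1; rewrite !mxE.
  by have := zX E; rewrite (planeP (p := X _) (q := 0)) ?eqxx // mxE.
have zero w g : holo g w -> (\forall p \near (0 : P), g p = 0) -> w = 0.
  move=> gw g0; apply: (has_exp_uniq g0 (holo_exp gw)).
  by rewrite -(rmorph0 (@cser C)); exact: has_exp_cst.
have uz := zero u g1 hu (filterS (fun z (H : g1 z = 0 /\ g2 z = 0) => H.1) G).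
have vz := zero v g2 hv (filterS (fun z (H : g1 z = 0 /\ g2 z = 0) => H.2) G).
move/eqP: e0; apply; apply: planeP; rewrite mxE.
  by move/eqP: ue; rewrite uz !pcoef0 eq_sym mulf_eq0 (gt_eqF t0) => /eqP.
by move/eqP: ve; rewrite vz !pcoef0 eq_sym mulf_eq0 (gt_eqF t0) => /eqP.
Qed.

End Final.

(** * The two inclusions for the centralizer *)

Section Centralizer.
Variable R : realType.
Local Notation C := (R[i]^o).
Local Notation P := ('rV[R[i]^o]_2).
Implicit Types (f g : P -> C) (p q h : P) (X Y W : P -> P) (a b : pser2 C) (c : C).

Lemma holo_uniq f g a : holo f a -> holo g a -> \forall p \near (0 : P), f p = g p.
Proof.
move=> [r [M [_ _ fa]]] [s [N [_ _ ga]]].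
apply: filterS (filterI fa ga) => p [fp gp].
exact: (cvg_unique (@norm_hausdorff _ _) fp gp).
Qed.

Lemma holo_scale c f a : holo f a -> holo (fun p => c * f p) (cser c * a).
Proof.
move=> [r [M [r0 aM fa]]]; exists r, (`|c| * M); split; first exact: r0.
  by move=> i j; rewrite coef2_cstM normrM -mulrA ler_wpM2l.
apply: filterS fa => p fp.
have -> : (fun n => pev n (cser c * a) p) = (cst c \* (fun n => pev n a p)).
  by apply/funext => n; rewrite pev_cstM.
by apply: cvgM; [exact: cvg_cst|exact: fp].
Qed.

Lemma complex_line_centralizer X : holomorphic_vf X -> complex_line X `<=` centralizer X.
Proof.
move=> hX Y [c YX]; split.
  move=> k; have [a ha] := (holomorphicP _).1 (hX k); apply/holomorphicP.
  exists (cser c * a); have [r [M [r0 aM fa]]] := holo_scale c ha.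
  exists r, M; split; [exact: r0|exact: aM|].
  apply: filterS (filterI fa YX) => p [fp ->]; rewrite mxE; exact: fp.
have [a [J dX]] := holomorphic_vf_data hX.
have DX := vf_data_diff dX; have [_ _ _ [B [d [B0 d0 H]]]] := dX.
move: YX => /[dup] YX /nbhs_norm0P[s /= s0 sYX].
have s20 : 0 < s / 2 by rewrite divr_gt0.
apply: filterS (filterI DX (filterI (near_norm_lt d0) (filterI YX (near_norm_lt s20)))).
move=> p [DXp [pd [Yp ps]]].
have [e [e0 ed es]] := common_lower d0 s20.
(* Y equals c X only near 0; p and h are kept below s / 2 so that p + h stays in that
   neighbourhood. *)
have HY h : `|h| < e -> `|Y (p + h) - Y p - h *m (c *: J p)| <= `|c| * B * `|h| ^+ 2.
  move=> he; rewrite sYX ?Yp; last first.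
    apply: le_lt_trans (ler_normD _ _) _; rewrite [ltRHS]splitr ltrD //.
    exact: lt_le_trans he es.
  rewrite -scalemxAr -!scalerBr normrZ -mulrA ler_wpM2l //.
  by apply: H => //; exact: lt_le_trans he ed.
have [_ DY] := diff_of_bound e0 HY.
have -> : lie_bracket X Y p = X p *m (c *: J p) - Y p *m J p :=
  congr2 (fun u v => u - v) (DY (X p)) (DXp (Y p)).
by rewrite Yp -scalemxAr scalemxAl subrr.
Qed.

(** If both Taylor series vanished, X would vanish near 0. Isolation would then leave no point but 0
    there, and the first coordinate function would have both x and 0 as expansions. *)
Lemma formal_nonzero X (a : 'I_2 -> pser2 C) J : vf_data X a J ->
  (\forall p \near (0 : P)^', X p != 0) -> vneq0 (fpair a).
Proof.
move=> dX iso; apply: contrapT => H.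
have [/contrapT a0 /contrapT a1] := (not_orP _ _).1 H.
have iso' : \forall p \near (0 : P), p != 0 -> X p != 0 by exact: iso.
have [hX _ _ _] := dX.
have h0 : holo (fun=> 0) (0 : pser2 C).
  exists 1, 0; split; [exact: ltr01|by move=> i j; rewrite !pcoef0 normr0 mul0r|].
  apply: filterE => p; have -> : (fun n => pev n (0 : pser2 C) p) = cst 0.
    by apply/funext => n; rewrite pev0.
  exact: cvg_cst.
have X0 := hX 0; have X1 := hX 1; rewrite /= in a0 a1; rewrite a0 in X0; rewrite a1 in X1.
have : xx C = 0.
  apply: (@has_exp_uniq _ (fun p => p 0 0) (fun=> 0)); last exact: holo_exp h0.
    apply: filterS (filterI iso' (filterI (holo_uniq X0 h0) (holo_uniq X1 h0))).
    move=> p [pX [p0 p1]]; have [->|pn] := eqVneq p 0; first by rewrite mxE.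
    by move: (pX pn); rewrite (planeP (p := X p) (q := 0)) ?eqxx // mxE.
  exact: has_exp_xx.
move/(congr1 (fun s : pser2 C => s 1%N 0%N)); rewrite mono10 coef2_mono !pcoef0.
by move/eqP; rewrite oner_eq0.
Qed.

(** Y(0) nonzero and DY(0) nilpotent are the two ways to start [blowup_inv]; otherwise the zero of X
    is not isolated. The formal constant is valid for germs because a convergent series determines
    its sum. *)
Lemma centralizer_complex_line X : holomorphic_vf X -> isolated_singularity X ->
  non_rational_type X -> nilpotent_mx (linear_part X) -> centralizer X `<=` complex_line X.
Proof.
move=> hX [X0 iso] [S [_ [w [_ [W [stW W0 [l [m [lmW l0 m0 irr]]]]]]]]] nilX Y [hY XY].
have [a [J dX]] := holomorphic_vf_data hX; have [b [L dY]] := holomorphic_vf_data hY.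
have [hW _ _] := stW; have [e [T dW]] := holomorphic_vf_data hW.
have ab := lie_bracket_formal dX dY XY.
have [trX detX] := nilpotent_tr_det nilX.
have inv : blowup_inv (fpair b) 1.
  have [B0|B0] := EM (Y 0 = 0); last first.
    apply: Or32; apply: contrapT => H.
    have [/contrapT b0 /contrapT b1] := (not_orP _ _).1 H.
    by apply: B0; apply: planeP; rewrite mxE (vf_at0 dY).
  have [tdY|tdY] := EM (\tr (linear_part Y) = 0 /\ \det (linear_part Y) = 0); last first.
    by case: (zeros_not_isolated dX dY X0 B0 ab trX detX tdY iso).
  have [trY detY] := tr_det_formal dY; rewrite trY detY in tdY; case: tdY => tY eY.
  by apply: Or31; split=> //; split=> //=; rewrite -(vf_at0 dY) B0 mxE.
have nr : nonresonant (fpair e) l m.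
  have [trW detW] := tr_det_formal dW; have [tW eW] := eigenvalues_tr_det lmW.
  by split; rewrite /= -?(vf_at0 dW) ?W0 ?mxE -?trW -?detW.
have [c [c0 c1]] := formal_centralizer (Y := fpair b) l0 m0 irr nr (formal_nonzero dX iso)
  (strict_transform_formal dX dW stW) (ab 0) (ab 1) inv.
exists c.
have [HX _ _ _] := dX; have [HY _ _ _] := dY.
have E k : b k = cser c * a k -> \forall p \near (0 : P), Y p 0 k = c * X p 0 k.
  by move=> bk; have := HY k; rewrite bk => HYk; exact: holo_uniq HYk (holo_scale c (HX k)).
apply: filterS (filterI (E 0 c0) (E 1 c1)) => p [p0 p1].
by apply: planeP; rewrite [RHS]mxE.
Qed.

End Centralizer.

Theorem theorem4 (R : realType) (X : vfield R) :
  holomorphic_vf X ->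
  isolated_singularity X ->
  non_dicritical X ->
  generalized_curve X ->
  non_rational_type X ->
  nilpotent_mx (linear_part X) ->
  centralizer X = complex_line X.
Proof.
move=> hX isoX _ _ nrX nilX; apply/seteqP; split.
  exact: centralizer_complex_line.
exact: complex_line_centralizer.
Qed.
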